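(* Let $n\ge 1$, $\mathbb{T}^n=\mathbb{R}^n/\mathbb{Z}^n$, and let $p\ge 4$. Let $b\in C^\infty(\mathbb{T}^n\times[0,\infty);\mathbb{R}^n)$. Let $W_t$ be a standard $n$-dimensional Brownian motion. For $\varepsilon>0$ let $(X^\varepsilon_t,V^\varepsilon_t)$ solve $$dX^\varepsilon_t=V^\varepsilon_t\,dt,\qquad dV^\varepsilon_t=\frac1\varepsilon\big(b(X^\varepsilon_t,t)-V^\varepsilon_t\big)\,dt+\sqrt{\frac2\varepsilon}\,dW_t,$$ and let $Z^\varepsilon_t$ solve $$dZ^\varepsilon_t=F(Z^\varepsilon_t,t)\,dt+\sqrt{2\varepsilon}\,dW_t,\qquad F(x,t)=b(x,t)-\varepsilon\big(\partial_t b(x,t)+D_xb(x,t)\,b(x,t)\big),$$ driven by the same $W$. Assume $X^\varepsilon_0=Z^\varepsilon_0=x$ for a deterministic point $x$, and that $\tilde V^\varepsilon_0:=V^\varepsilon_0-b(X^\varepsilon_0,0)$ satisfies $\mathbf{E}\,\tilde V^\varepsilon_0=0$ and $\mathbf{E}|\tilde V^\varepsilon_0|^p<\infty$. Then for each $T>0$ there exist $C,\varepsilon_0>0$ depending on $T$ such that for all $\varepsilon<\varepsilon_0$, $$\sup_{t\in[0,T]}\mathbf{E}\,|X^\varepsilon_t-Z^\varepsilon_t|^p\le C(1+T)\varepsilon^p .$$ Furthermore, for every $\varphi\in C^\infty(\mathbb{T}^n)$ there exists a constant $C$ (independent of $\varepsilon$) such that $$\sup_{t\in[0,T]}\big|\mathbf{E}\big(\varphi(X^\varepsilon_t)-\varphi(Z^\varepsilon_t)\big)\big|\le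 C\varepsilon^2 .$$
   Context: $D_xb$ denotes the $n\times n$ Jacobian matrix of $b$ in $x$. The function $b$ is regarded as a function on $\mathbb{R}^n\times[0,\infty)$ that is $\mathbb{Z}^n$-periodic in $x$, and positions $X^\varepsilon_t,Z^\varepsilon_t$ are lifted to $\mathbb{R}^n$ (so $|X^\varepsilon_t-Z^\varepsilon_t|$ is the Euclidean norm of the difference of the lifts); $\varphi\in C^\infty(\mathbb{T}^n)$ is viewed as a $\mathbb{Z}^n$-periodic function on $\mathbb{R}^n$. The initial velocity $V^\varepsilon_0$ is a random variable measurable with respect to the initial sigma-algebra of the filtration of $W$ (hence independent of $W$).
   Formalization: The p-th moments of the initial deviation are assumed bounded uniformly in ε (with moments finite for each ε only, b=0 and deviation ξ/ε is a counterexample); b is taken smooth for all real times (extension), and paths are continuous and the equations hold for every ω, not just almost surely. *)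

(* Defs.v *)
From mathcomp Require Import all_boot all_order all_algebra.
From mathcomp Require Import all_classical all_reals all_analysis.
Set Implicit Arguments. Unset Strict Implicit. Unset Printing Implicit Defensive.
Import Order.TTheory GRing.Theory Num.Theory.
Import numFieldNormedType.Exports.
Local Open Scope classical_set_scope.
Local Open Scope ring_scope.

Section Defs.
Variable R : realType.

Section Smooth.
Variables (V W : normedModType R).
Fixpoint iterD (vs : seq V) (f : V -> W) : V -> W :=
  match vs with
  | [::] => f
  | v :: vs' => fun a => 'D_v (iterD vs' f) a
  end.
Definition smooth (f : V -> W) : Prop :=
  forall vs : seq V, continuous (iterD vs f) /\
                     (forall (v a : V), derivable (iterD vs f) a v).
End Smooth.

Variable n : nat.

Definition intvec (k : 'rV[int]_n) : 'rV[R]_n := map_mx (fun z : int => z%:~R) k.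

(* Z^n-periodicity in x, i.e. functions on the torus T^n lifted to R^n *)
Definition periodic_x (b : ('rV[R]_n * R)%type -> 'rV[R]_n) : Prop :=
  forall (y : 'rV[R]_n) (t : R) (k : 'rV[int]_n), b (y + intvec k, t) = b (y, t).
Definition periodic_fn (phi : 'rV[R]_n -> R) : Prop :=
  forall (y : 'rV[R]_n) (k : 'rV[int]_n), phi (y + intvec k) = phi y.

Definition dotv (u w : 'rV[R]_n) : R := \sum_(i < n) u ord0 i * w ord0 i.
Definition enorm (u : 'rV[R]_n) : R := Num.sqrt (dotv u u).

Definition Fcorr (b : ('rV[R]_n * R)%type -> 'rV[R]_n) (eps : R)
  (z : ('rV[R]_n * R)%type) : 'rV[R]_n :=
  b z - eps *: ('D_((0 : 'rV[R]_n), (1 : R)) b z + 'D_((b z), (0 : R)) b z).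

Definition vint (f : R -> 'rV[R]_n) (t : R) : 'rV[R]_n :=
  \row_(i < n) Rintegral lebesgue_measure [set s | 0 <= s <= t] (fun s => f s ord0 i).

Section Prob.
Context {d : measure_display} {Omega : measurableType d}.
Variable P : probability Omega R.

Definition rv_meas (G : set (set Omega)) (Y : Omega -> 'rV[R]_n) : Prop :=
  forall (i : 'I_n) (B : set R), measurable B -> G ((fun w => Y w ord0 i) @^-1` B).

Definition filtration (F : R -> set (set Omega)) : Prop :=
  (forall t, 0 <= t -> sigma_algebra setT (F t) /\ (F t `<=` measurable)) /\
  (forall s t, 0 <= s -> s <= t -> F s `<=` F t).

(* standard n-dimensional (F_t)-Brownian motion: W_0 = 0, continuous paths,
   adapted, and for s <= t the increment W_t - W_s is independent of F_s with law
   N(0,(t-s)I), expressed via its characteristic function conditioned on F_s: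
   E[1_A exp(i <u, W_t - W_s>)] = P(A) exp(-|u|^2 (t-s)/2) for A in F_s. *)
Definition brownian (F : R -> set (set Omega)) (W : R -> Omega -> 'rV[R]_n) : Prop :=
  (forall w, W 0 w = 0) /\
  (forall w, {within [set t | 0 <= t], continuous (fun t => W t w)}) /\
  (forall t, 0 <= t -> rv_meas (F t) (W t)) /\
  (forall (s t : R) (A : set Omega) (u : 'rV[R]_n), 0 <= s -> s <= t -> F s A ->
     (\int[P]_(w in A) (cos (dotv u (W t w - W s w)))%:E =
        P A * (expR (- (enorm u ^+ 2) * (t - s) / 2))%:E)%E /\
     (\int[P]_(w in A) (sin (dotv u (W t w - W s w)))%:E = 0)%E).

(* (X,V) solves  dX = V dt, dV = (1/eps)(b(X,t) - V) dt + sqrt(2/eps) dW,  X_0 = x0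
   (additive noise: written pathwise in integral form) *)
Definition langevin_sol (b : ('rV[R]_n * R)%type -> 'rV[R]_n) (eps : R)
  (x0 : 'rV[R]_n) (W : R -> Omega -> 'rV[R]_n) (X V : R -> Omega -> 'rV[R]_n) : Prop :=
  (forall t, 0 <= t -> rv_meas measurable (X t) /\ rv_meas measurable (V t)) /\
  (forall w, {within [set t | 0 <= t], continuous (fun t => X t w)} /\
             {within [set t | 0 <= t], continuous (fun t => V t w)}) /\
  (forall w t, 0 <= t ->
     X t w = x0 + vint (fun s => V s w) t /\
     V t w = V 0 w + eps^-1 *: vint (fun s => b (X s w, s) - V s w) t
             + Num.sqrt (2 / eps) *: W t w).

Definition sde_sol (G : ('rV[R]_n * R)%type -> 'rV[R]_n) (eps : R)
  (x0 : 'rV[R]_n) (W : R -> Omega -> 'rV[R]_n) (Z : R -> Omega -> 'rV[R]_n) : Prop :=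
  (forall t, 0 <= t -> rv_meas measurable (Z t)) /\
  (forall w, {within [set t | 0 <= t], continuous (fun t => Z t w)}) /\
  (forall w t, 0 <= t ->
     Z t w = x0 + vint (fun s => G (Z s w, s)) t + Num.sqrt (2 * eps) *: W t w).
End Prob.
End Defs.

(* Main.v *)
(** Writing [l = 1/eps], the velocity equation is solved pathwise by [V = b(X, t) + U - lag],
    where [U] is the Ornstein-Uhlenbeck fluctuation and [lag], the exponentially averaged
    increment of [b(X, t)], is of order [eps].  Inserting [eps (V_t - V_0)] and the equation of
    [Z] into the equation of [X] gives
    [X - Z = int (b(X) - b(Z)) + eps (dA - U + lag + devV)], where [dA], [U], [devV] are bounded
    in [L^p], and Gronwall's lemma gives the strong estimate.  For the weak estimate let [y] be
    an approximate solution of [y' = b(y, t)] and [D = Z - y], which is of order [sqrt eps].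
    The expectations of [U] and [devV] vanish and that of [dA] is of order [eps], because
    [E D] is.  Expanding [b(X) - b(Z)] around [y] to second order leaves the products
    [E (D_r Y_t)] with [Y = X - Z]; these are of order [eps^2] since [E (D_r U_t)] is of order
    [eps], and Gronwall's lemma gives [E Y = O(eps^2)].  The same expansion applied to [phi]
    concludes. *)
From mathcomp Require Import all_boot all_order all_algebra.
From mathcomp Require Import all_classical all_reals all_analysis.
From mathcomp Require Import measurable_realfun.
From mathcomp Require Import ring lra.
Require Import Defs.
Set Implicit Arguments. Unset Strict Implicit. Unset Printing Implicit Defensive.
Import Order.TTheory GRing.Theory Num.Theory.
Import numFieldNormedType.Exports.
Local Open Scope classical_set_scope.
Local Open Scope ring_scope.

(** * Integrals over time intervals, Jensen's inequality, exponential relaxation *)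

Section TimeIntegrals.
Variable R : realType.
Implicit Types (f g : R -> R) (a s t c l : R).

(** The noise is additive, so both equations are treated pathwise, without Ito calculus: probability
    enters through moments, centering and correlations of Brownian increments, all extracted from
    the conditional characteristic function. A direct Gronwall argument for [E Y] fails because the
    Taylor coefficients of [b] at [Z] are random and cannot leave the expectation; a deterministic
    center makes them deterministic. The price is the products [D_r Y_t], which by size alone are of
    order [eps^(3/2)]. The missing half power comes from decorrelation: [U_t] remembers the noise
    over times of order [eps] only, so that its correlation with any [W_r] is of order [sqrt eps].
    The times [r] and [t] are kept separate so that [D_r] is a fixed weight while Gronwall's lemma
    runs in [t]. Moment bounds have the normalized form [E (|f| / c)^q <= 1], which avoids [q]-th
    roots and turns norm inequalities into pointwise convexity. Gronwall's lemma is an iteration: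
    under an exponential weight, one use of the integral inequality halves an a priori bound up to a
    constant. *)

Lemma eq_ler (x y : R) : x = y -> x <= y.
Proof. by move=> ->. Qed.

Definition tint a t f : R := \int[@lebesgue_measure R]_(s in `[a, t]) f s.

Lemma cont_integrable a t f : continuous f ->
  (@lebesgue_measure R).-integrable `[a, t] (EFin \o f).
Proof.
move=> cf; apply: continuous_compact_integrable; first exact: segment_compact.
by apply: continuous_subspaceT => x; exact: cf.
Qed.

Lemma eq_tint a t f g : (forall s, a <= s -> s <= t -> f s = g s) ->
  tint a t f = tint a t g.
Proof.
by move=> fg; apply: eq_Rintegral => s; rewrite inE /= in_itv /= => /andP[]; exact: fg.
Qed.

Lemma tintD a t f g : continuous f -> continuous g ->
  tint a t (fun s => f s + g s) = tint a t f + tint a t g.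
Proof. by move=> cf cg; rewrite /tint RintegralD//; exact: cont_integrable. Qed.

Lemma tintB a t f g : continuous f -> continuous g ->
  tint a t (fun s => f s - g s) = tint a t f - tint a t g.
Proof. by move=> cf cg; rewrite /tint RintegralB//; exact: cont_integrable. Qed.

Lemma tintZ a t c f : continuous f -> tint a t (fun s => c * f s) = c * tint a t f.
Proof. by move=> cf; rewrite /tint RintegralZl//; exact: cont_integrable. Qed.

Lemma tint_cst a t c : a <= t -> tint a t (fun=> c) = c * (t - a).
Proof.
move=> at_; rewrite /tint Rintegral_cst//= lebesgue_measure_itv/=.
by case: ifPn => //=; rewrite -leNgt => ta; rewrite mulr0 (_ : t = a) ?subrr ?mulr0//; apply/le_anti/andP.
Qed.

Lemma tint_le a t f g : continuous f -> continuous g ->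
  (forall s, a <= s -> s <= t -> f s <= g s) -> tint a t f <= tint a t g.
Proof.
move=> cf cg fg; apply: le_Rintegral => //; try exact: cont_integrable.
by move=> s; rewrite /= in_itv /= => /andP[]; exact: fg.
Qed.

Lemma continuous_norm_comp f : continuous f -> continuous (fun s => `|f s|).
Proof. by move=> cf s; apply: continuous_comp; [exact: cf | exact: norm_continuous]. Qed.

Lemma tint_norm a t f : continuous f -> `|tint a t f| <= tint a t (fun s => `|f s|).
Proof. by move=> cf; apply: le_normr_Rintegral => //; exact: cont_integrable. Qed.

Lemma tint_le_cst a t f c : continuous f -> a <= t ->
  (forall s, a <= s -> s <= t -> `|f s| <= c) -> `|tint a t f| <= c * (t - a).
Proof.
move=> cf at_ fc; apply: le_trans (tint_norm _ _ cf) _; rewrite -tint_cst//.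
apply: tint_le => //; first exact: continuous_norm_comp.
by move=> s; exact: cst_continuous.
Qed.

Lemma tint_split a s t f : continuous f -> a <= s -> s <= t ->
  tint a t f = tint a s f + tint s t f.
Proof.
move=> cf as_ st; rewrite /tint.
have := @Rintegral_itvB _ f (BLeft a) (BRight t) s (cont_integrable _ _ cf).
rewrite !bnd_simp => /(_ as_ st) /eqP; rewrite subr_eq => /eqP ->.
rewrite addrC; congr (_ + _); rewrite Rintegral_itv_obnd_cbnd//.
by apply: integrableS (cont_integrable s t cf) => //; exact: subset_itv_oc_cc.
Qed.

Lemma tint_refl a f : tint a a f = 0.
Proof. by rewrite /tint set_itv1 Rintegral_set1. Qed.

Lemma is_derive_tint f x t : continuous f -> x < t ->
  is_derive t 1 (fun t => tint x t f) (f t).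
Proof.
move=> cf xt.
have tt : t < t + 1 by rewrite ltrDl.
have [d1 d2] := @continuous_FTC1_closed _ f x t (t + 1) tt (cont_integrable _ _ cf) xt (cf t).
by apply: DeriveDef; [exact: d1 | rewrite -derive1E; exact: d2].
Qed.

Lemma continuous_expRM l : continuous (fun s : R => expR (l * s)).
Proof.
move=> x; apply: continuous_comp; last exact: continuous_expR.
exact: mulrl_continuous.
Qed.

Lemma tint_expR l t : l != 0 -> 0 <= t ->
  tint 0 t (fun s => expR (l * s)) = (expR (l * t) - 1) / l.
Proof.
move=> l0; rewrite le_eqVlt => /predU1P[<-|t0].
  by rewrite tint_refl mulr0 expR0 subrr mul0r.
pose G (s : R) : R := expR (l * s) / l.
have dG (x : R) : is_derive x 1 G (expR (l * x)).
  rewrite /G; apply: is_derive_eq.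
  by rewrite /GRing.scale /=; field.
have := @continuous_FTC2 _ (fun s => expR (l * s)) G 0 t t0.
rewrite /tint /Rintegral => ->.
- by rewrite -EFinB /= /G mulr0 expR0; ring.
- exact/continuous_subspaceT/continuous_expRM.
- have dG' : forall x, derivable G x 1 by move=> x; apply: @ex_derive.
  split => //.
    by apply: cvg_at_right_filter; apply: differentiable_continuous; apply/derivable1_diffP.
  by apply: cvg_at_left_filter; apply: differentiable_continuous; apply/derivable1_diffP.
- by move=> x _; rewrite derive1E; apply: derive_val.
Qed.

Lemma cont_cst c : continuous (fun _ : R => c).
Proof. by move=> s; exact: cst_continuous. Qed.

Lemma contD f g : continuous f -> continuous g -> continuous (fun s => f s + g s).
Proof. by move=> cf cg s; apply: (@continuousD _ _ _ f g); [exact: cf|exact: cg]. Qed.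

Lemma contB f g : continuous f -> continuous g -> continuous (fun s => f s - g s).
Proof. by move=> cf cg s; apply: (@continuousB _ _ _ f g); [exact: cf|exact: cg]. Qed.

Lemma contM f g : continuous f -> continuous g -> continuous (fun s => f s * g s).
Proof. by move=> cf cg s; apply: (@continuousM _ _ f g); [exact: cf|exact: cg]. Qed.

Hint Resolve cont_cst continuous_expRM : core.

(** At 0 the bound [|y|^q <= |y|] for [|y| <= 1] is used, which is where [1 <= q] enters; elsewhere
    [powR] is differentiable. *)
Lemma continuous_powR_norm (q : R) : 1 <= q -> continuous (fun x : R => powR `|x| q).
Proof.
move=> q1 x; have q0 : 0 < q by apply: lt_le_trans q1.
have [->|x0] := eqVneq x 0.
  apply/cvgrPdist_lt => e e0.
  rewrite normr0 powR0 ?gt_eqF//; near=> y.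
  rewrite sub0r normrN ger0_norm ?powR_ge0//.
  have y1 : `|y| <= 1.
    near: y; have := @nbhsx_ballx R R 0 1 ltr01; apply: filterS => z.
    by rewrite /ball /= sub0r normrN => /ltW.
  have ye : `|y| < e.
    near: y; have := @nbhsx_ballx R R 0 e e0; apply: filterS => z.
    by rewrite /ball /= sub0r normrN.
  have [->|y0] := eqVneq y 0; first by rewrite normr0 powR0// gt_eqF.
  by apply: le_lt_trans (ye); apply: ge1r_powR => //; rewrite normr_gt0 y0.
apply: (@continuous_comp _ _ _ (fun y : R => `|y|) (fun y : R => powR y q)).
  exact: norm_continuous.
apply: differentiable_continuous; apply/derivable1_diffP.
by apply: derivable_powR; rewrite in_itv /= andbT normr_gt0.
Unshelve. all: by end_near. Qed.

(** Young's inequality for the product [y * 1] with exponents [q] and [(1 - q^-1)^-1], multiplied by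
    [q]. The case [q = 1] is separate because its conjugate exponent is infinite. *)
Lemma bernoulli_powR (q y : R) : 1 <= q -> 0 <= y -> 1 + q * (y - 1) <= powR y q.
Proof.
rewrite le_eqVlt => /predU1P[<- y0|q1 y0]; first by rewrite powRr1// mul1r addrC subrK.
have q0 : 0 < q by apply: lt_trans q1.
have r0 : 0 < (1 - q^-1)^-1 by rewrite invr_gt0 subr_gt0 invf_lt1.
have := @conjugate_powR R y 1 q (1 - q^-1)^-1 y0 ler01 q0 r0.
rewrite invrK mulr1 powR1 mul1r => h; have {h} := h (ltac:(rewrite addrC subrK//)).
rewrite -(ler_pM2l q0) mulrDr mulrCA divff ?gt_eqF// mulr1 mulrBr mulr1 divff ?gt_eqF//.
lra.
Qed.

(** Bernoulli's inequality at [x / m], scaled by [m^q]: the graph of the power lies above its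
    tangent at [m]. This is the form of convexity behind the next lemmas. *)
Lemma powR_tangent (q x m : R) : 1 <= q -> 0 <= x -> 0 < m ->
  powR m q + q * (powR m q / m) * (x - m) <= powR x q.
Proof.
move=> q1 x0 m0; have q0 : 0 < q by apply: lt_le_trans q1.
have := bernoulli_powR q1 (divr_ge0 x0 (ltW m0)).
have -> : powR x q = powR m q * powR (x / m) q.
  rewrite -{1}(divfK (lt0r_neq0 m0) x).
  rewrite [LHS]powRM; [exact: mulrC|by rewrite divr_ge0 ?(ltW m0)|exact: ltW].
rewrite -(ler_pM2l (powR_gt0 q m0)); apply: le_trans.
by apply: eq_ler; field; rewrite gt_eqF.
Qed.

(** The tangent inequalities at the common mean [m] are averaged with the weights [u / (u + v)] and
    [v / (u + v)]; the linear terms cancel. This will be Minkowski's inequality for the normalized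
    moments. *)
Lemma powR_convex2 (q x y u v : R) : 1 <= q -> 0 <= x -> 0 <= y -> 0 < u -> 0 < v ->
  powR ((x + y) / (u + v)) q <=
    u / (u + v) * powR (x / u) q + v / (u + v) * powR (y / v) q.
Proof.
move=> q1 x0 y0 u0 v0; have uv : 0 < u + v by rewrite addr_gt0.
have q0 : 0 < q by apply: lt_le_trans q1.
have [m0|m0] := eqVneq ((x + y) / (u + v)) 0.
  rewrite m0 powR0 ?gt_eqF//.
  by apply: addr_ge0; rewrite mulr_ge0 ?powR_ge0// divr_ge0 ?(ltW u0) ?(ltW v0) ?(ltW uv).
have {}m0 : 0 < (x + y) / (u + v).
  by rewrite lt_def m0 divr_ge0//; [exact: addr_ge0|exact: ltW].
set m := _ / _ in m0 *.
have h1 := powR_tangent q1 (divr_ge0 x0 (ltW u0)) m0.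
have h2 := powR_tangent q1 (divr_ge0 y0 (ltW v0)) m0.
have u1 : 0 <= u / (u + v) by rewrite divr_ge0 ?(ltW u0) ?(ltW uv).
have v1 : 0 <= v / (u + v) by rewrite divr_ge0 ?(ltW v0) ?(ltW uv).
apply: le_trans (lerD (ler_wpM2l u1 h1) (ler_wpM2l v1 h2)).
apply: eq_ler; rewrite /m; field.
by rewrite !gt_eqF//= -/m; rewrite /m in m0; rewrite pmulr_lgt0 ?invr_gt0// in m0.
Qed.

Lemma continuous_jensen (q C : R) f (c : R -> R) : 1 <= q -> continuous f -> continuous c ->
  (forall s, 0 < c s) -> continuous (fun s => c s / C * powR (`|f s| / c s) q).
Proof.
move=> q1 cf cc c0; apply: contM; first exact: contM.
have cx : continuous (fun s => f s / c s).
  by apply: contM => // s; apply: continuousV; [rewrite gt_eqF|exact: cc].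
move=> s; have := @continuous_comp _ _ _ (fun s => f s / c s) (fun x => powR `|x| q) s (cx s)
  (@continuous_powR_norm q q1 _).
rewrite (_ : (_ \o _) = (fun s => powR (`|f s| / c s) q))//.
by apply/funext => r; rewrite /= normrM normfV (gtr0_norm (c0 r)).
Qed.

(** Jensen's inequality for the measure [c s / C ds], applied to [|f| / c]. The total mass may be
    less than 1: this only adds the nonnegative surplus [(q - 1) * m^q * (1 - mass)]. *)
Lemma jensen_tint (q C a t : R) f (c : R -> R) : 1 <= q -> continuous f -> continuous c ->
  (forall s, 0 < c s) -> 0 < C -> tint a t c <= C ->
  powR (`|tint a t f| / C) q <= tint a t (fun s => c s / C * powR (`|f s| / c s) q).
Proof.
move=> q1 cf cc c0 C0 cC; have q0 : 0 < q by apply: lt_le_trans q1.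
have cw : continuous (fun s => c s / C).
  exact: contM.
have cx : continuous (fun s => f s / c s).
  by apply: contM => // s; apply: continuousV; [rewrite gt_eqF|exact: cc].
have xE s : `|f s| / c s = `|f s / c s| by rewrite normrM normfV (gtr0_norm (c0 s)).
have cp : continuous (fun s => powR `|f s / c s| q).
  move=> s; apply: (@continuous_comp _ _ _ (fun s => f s / c s) (fun x => powR `|x| q)).
    exact: cx.
  exact: continuous_powR_norm.
have cwp : continuous (fun s => c s / C * powR `|f s / c s| q).
  exact: contM.
under [X in _ <= tint _ _ X]eq_fun do rewrite xE.
have [m0|m0] := eqVneq (`|tint a t f| / C) 0.
  rewrite m0 powR0 ?gt_eqF//; apply: Rintegral_ge0 => s _.
  by rewrite mulr_ge0 ?powR_ge0// divr_ge0 ?ltW.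
have {}m0 : 0 < `|tint a t f| / C by rewrite lt_def m0 divr_ge0//; exact: ltW.
set m := _ / _ in m0 *.
(* Constant term and slope of the tangent at [m], the slope with the factor [1 / C] of the weight
   included, so that the lower bound is linear in [|f s|]. *)
pose A := powR m q - q * powR m q; pose B := q * (powR m q / m) / C.
have cnf := continuous_norm_comp cf.
have h : tint a t (fun s => A * (c s / C) + B * `|f s|)
   <= tint a t (fun s => c s / C * powR `|f s / c s| q).
  apply: tint_le => //.
    by apply: contD; apply: contM.
  move=> s _ _; have := powR_tangent q1 (normr_ge0 (f s / c s)) m0.
  have w0 : 0 <= c s / C by rewrite divr_ge0 ?ltW.
  move=> /(ler_wpM2l w0); apply: le_trans.
  rewrite -xE; apply: eq_ler; rewrite /A /B; field.
  by rewrite !gt_eqF//= c0.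
apply: le_trans h.
rewrite tintD; [|by apply: contM|by apply: contM].
rewrite !tintZ//.
have -> : tint a t (fun s => c s / C) = tint a t c / C.
  by under eq_fun do rewrite mulrC; rewrite tintZ// mulrC.
have mu1 : tint a t c / C <= 1 by rewrite ler_pdivrMr// mul1r.
have h2 : m * C <= tint a t (fun s => `|f s|) by rewrite /m divfK ?gt_eqF// tint_norm.
have B0 : 0 <= B.
  apply: divr_ge0; last exact: ltW.
  by apply: mulr_ge0; [exact: ltW|apply: divr_ge0; [exact: powR_ge0|exact: ltW]].
apply: le_trans (lerD (lexx _) (ler_wpM2l B0 h2)).
have -> : B * (m * C) = q * powR m q by rewrite /B; field; rewrite !gt_eqF.
rewrite /A; have : 0 <= (q - 1) * powR m q * (1 - tint a t c / C).
  by rewrite mulr_ge0 ?mulr_ge0 ?powR_ge0 ?subr_ge0.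
lra.
Qed.

(* The solution operator of [dV = l (beta - V) dt + dw] started from [beta_0]
   differs from [beta] by [relax l w - relax l beta]. *)
Definition relax l (q : R -> R) t : R :=
  expR (- (l * t)) * (q t - q 0 + l * tint 0 t (fun s => expR (l * s) * (q t - q s))).

(** The increments [q t - q s] in [relax] serve the estimates, the plain form on the right serves
    algebraic identities. They agree because the exponential weight integrates to
    [(expR (l * t) - 1) / l]. *)
Lemma relaxE l (q : R -> R) t : 0 < l -> 0 <= t -> continuous q ->
  relax l q t = q t - expR (- (l * t)) * (q 0 + l * tint 0 t (fun s => expR (l * s) * q s)).
Proof.
move=> l0 t0 cq; rewrite /relax.
have -> : tint 0 t (fun s => expR (l * s) * (q t - q s)) =
   q t * ((expR (l * t) - 1) / l) - tint 0 t (fun s => expR (l * s) * q s).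
  rewrite -tint_expR ?gt_eqF// -tintZ// -tintB; [|exact: contM|exact: contM].
  by apply: eq_tint => s _ _; ring.
by rewrite expRN; field; rewrite !gt_eqF ?expR_gt0.
Qed.

(** Variation of constants without differentiating [v], which contains the rough path [w]: only the
    integral of [v - be] is differentiated. Multiplied by [expR (l * s)], it differs from an
    explicit integral by the function [J], whose derivative vanishes. *)
Lemma relaxation l (v be w : R -> R) : 0 < l -> continuous v -> continuous be -> continuous w ->
  (forall t, 0 <= t -> v t = v 0 + l * tint 0 t (fun s => be s - v s) + (w t - w 0)) ->
  forall t, 0 <= t ->
    v t = be t + expR (- (l * t)) * (v 0 - be 0) + relax l w t - relax l be t.
Proof.
move=> l0 cv cbe cw vE t t0.
pose h s := v 0 + (w s - w 0) - be s.
have ch : continuous h by apply: contB => //; apply: contD => //; apply: contB.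
have ceh : continuous (fun s => expR (l * s) * h s) by apply: contM.
have cvb : continuous (fun s => v s - be s) by apply: contB.
pose J s := expR (l * s) * tint 0 s (fun s => v s - be s)
            - tint 0 s (fun s => expR (l * s) * h s).
have J0 : J t = 0.
  have := t0; rewrite le_eqVlt => /predU1P[<-|tpos].
    by rewrite /J !tint_refl mulr0 subr0.
  have dJ (x : R) : x \in `]0, t[ -> is_derive x 1 J 0.
    rewrite in_itv /= => /andP[x0 _].
    have d1 := is_derive_tint cvb x0.
    have d2 := is_derive_tint ceh x0.
    have d3 : is_derive x 1 (fun s : R => expR (l * s)) (l * expR (l * x)).
      by apply: is_derive_eq; rewrite /GRing.scale /=; ring.
    have dd := is_deriveB (is_deriveM d3 d1) d2.
    rewrite (_ : 0 = expR (l * x) *: (v x - be x) +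
      tint 0 x (fun s => v s - be s) *: (l * expR (l * x)) - expR (l * x) * h x).
      exact: dd.
    have := vE x (ltW x0).
    have -> : (fun s => be s - v s) = (fun s => -1 * (v s - be s)).
      by apply/funext => s; ring.
    by rewrite tintZ// /GRing.scale /= /h => ->; ring.
  have [|x _] := MVT tpos dJ.
    have p1 := parameterized_integral_continuous t0 (cont_integrable 0 t cvb).
    have p2 := parameterized_integral_continuous t0 (cont_integrable 0 t ceh).
    have p3 := @continuous_subspaceT _ _ `[0, t] _ (@continuous_expRM l).
    move=> y; apply: (@continuousB _ _ (subspace `[0, t])
      (fun s => expR (l * s) * tint 0 s (fun s => v s - be s))
      (fun s => tint 0 s (fun s => expR (l * s) * h s))); last exact: p2.
    apply: (@continuousM _ (subspace `[0, t]) (fun s => expR (l * s))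
      (fun s => tint 0 s (fun s => v s - be s))); [exact: p3|exact: p1].
  by rewrite mul0r /J !tint_refl mulr0 !subr0.
have E1 : tint 0 t (fun s => v s - be s) = expR (- (l * t)) * tint 0 t (fun s => expR (l * s) * h s).
  by move/subr0_eq: J0 => <-; rewrite mulrA -expRD addNr expR0 mul1r.
rewrite !relaxE// vE//.
have -> : (fun s => be s - v s) = (fun s => -1 * (v s - be s)).
  by apply/funext => s; ring.
rewrite tintZ// E1.
have -> : tint 0 t (fun s => expR (l * s) * h s) = (v 0 - w 0) * ((expR (l * t) - 1) / l)
   + tint 0 t (fun s => expR (l * s) * w s) - tint 0 t (fun s => expR (l * s) * be s).
  rewrite -tint_expR ?gt_eqF// -tintZ// -tintD; [|exact: contM|exact: contM].
  rewrite -tintB; [|by apply: contD; apply: contM|exact: contM].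
  by apply: eq_tint => s _ _; rewrite /h; ring.
by rewrite expRN; field; rewrite !gt_eqF ?expR_gt0.
Qed.

(** This and the next bound trade a power of a time increment for half of the exponential rate; the
    other half remains for integrating the weight in [relax]. *)
Lemma sqrt_le_expR (x : R) : Num.sqrt x <= expR (x / 2).
Proof.
have [x0|x0] := leP 0 x; last by rewrite ltr0_sqrtr// expR_ge0.
rewrite -ler_sqr ?nnegrE ?expR_ge0 ?sqrtr_ge0// sqr_sqrtr// -expRM_natl.
rewrite (_ : 2%:R * (x / 2) = x); last by field.
by apply: le_trans (expR_ge1Dx x); rewrite lerDr.
Qed.

Lemma le_expR_half (x : R) : x <= 2 * expR (x / 2).
Proof. by have := expR_ge1Dx (x / 2); lra. Qed.

(** The map [M -> c + M / 2] contracts towards [2 * c], and finitely many steps from any start end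
    below [3 * c]. Both Gronwall lemmas use it to replace an a priori bound of the wrong order by
    one proportional to the source term. *)
Lemma iterate_to_fixpoint (B : R -> Prop) c M0 : 0 < c ->
  (forall M, B M -> B (c + M / 2)) -> (forall M N, M <= N -> B M -> B N) ->
  B M0 -> B (3 * c).
Proof.
move=> c0 Bs Bm B0.
have Bk k : B (2 * c + `|M0| / 2 ^+ k).
  elim: k => [|k /Bs].
    apply: Bm B0; rewrite expr0 divr1; apply: le_trans (ler_norm _) _.
    by rewrite lerDr mulr_ge0// ltW.
  apply: Bm; rewrite exprS; apply: eq_ler.
  by field; rewrite expf_neq0.
pose k := Num.bound (`|M0| / c).
apply: Bm (Bk k); rewrite (_ : 3 * c = 2 * c + c); last by ring.
rewrite lerD2l ler_pdivrMr ?exprn_gt0// mulrC -ler_pdivrMr//.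
apply: le_trans (ltW (archi_boundP _)) _; first by rewrite divr_ge0// ltW.
by rewrite -natrX ler_nat ltnW// ltn_expl.
Qed.
End TimeIntegrals.

(** * Joint measurability of functions continuous in one variable *)

Section Caratheodory.
Variable R : realType.

Lemma floor_approx (k : nat) (x : R) :
  `|x - (Num.floor (k.+1%:R * x))%:~R / k.+1%:R| <= k.+1%:R^-1.
Proof.
have k0 : (0 : R) < k.+1%:R by [].
have := floor_itv (k.+1%:R * x); rewrite intrD => /andP[h1 h2].
have -> : x - (Num.floor (k.+1%:R * x))%:~R / k.+1%:R =
  (k.+1%:R * x - (Num.floor (k.+1%:R * x))%:~R) / k.+1%:R by field; rewrite gt_eqF.
rewrite normrM ger0_norm ?subr_ge0// gtr0_norm ?invr_gt0//.
by rewrite ler_pdivrMr// mulVf ?gt_eqF// lerBlDl ltW.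
Qed.

(** Rounding [X] down to the grid of mesh [1 / (k + 1)] leaves countably many values, on each of
    which [F] is evaluated at a fixed vector; continuity in the vector gives the limit. *)
Lemma measurable_caratheodory n d (T : measurableType d) (F : 'rV[R]_n -> T -> R)
    (X : T -> 'rV[R]_n) :
  (forall w, continuous (F^~ w)) -> (forall v, measurable_fun setT (F v)) ->
  (forall i, measurable_fun setT (fun w => X w ord0 i)) ->
  measurable_fun setT (fun w => F (X w) w).
Proof.
move=> cF mF mX.
pose Xk (k : nat) w : 'rV[R]_n :=
  \row_i ((Num.floor (k.+1%:R * X w ord0 i))%:~R / k.+1%:R).
apply: (@measurable_realfun.measurable_fun_cvg _ _ _ _ (fun k w => F (Xk k w) w)).
  move=> k _ B mB; rewrite setTI.
  pose E (z : 'rV[int]_n) : set T :=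
    (\bigcap_(i in [set: 'I_n])
       ((fun w => k.+1%:R * X w ord0 i) @^-1` `[(z ord0 i)%:~R, (z ord0 i + 1)%:~R[))
    `&` (F (\row_i ((z ord0 i)%:~R / k.+1%:R)) @^-1` B).
  have mE z : measurable (E z).
    apply: measurableI.
      apply: fin_bigcap_measurable => // i _; rewrite -[X in measurable X]setTI.
      have : measurable_fun setT (fun w => k.+1%:R * X w ord0 i) by apply: measurable_funM.
      by apply.
    by rewrite -[X in measurable X]setTI; exact: mF.
  rewrite (_ : _ @^-1` B = \bigcup_j (if unpickle j is Some z then E z else set0)).
    by apply: bigcupT_measurable => j; case: unpickle.
  apply/seteqP; split => w /=.
    move=> Bw; pose z : 'rV[int]_n := \row_i Num.floor (k.+1%:R * X w ord0 i).
    exists (pickle z) => //; rewrite pickleK; split.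
      by move=> i _ /=; rewrite in_itv /= /z mxE floor_itv.
    rewrite /= (_ : \row_i _ = Xk k w)//; apply/rowP => i.
    by rewrite !mxE.
  move=> [j _]; case: unpickle => // z [/= hz Bz].
  rewrite (_ : Xk k w = \row_i ((z ord0 i)%:~R / k.+1%:R))//; apply/rowP => i.
  rewrite !mxE; congr (_%:~R / _); apply: floor_def.
  by have := hz i Logic.I; rewrite /= in_itv.
move=> w _; apply: (@cvg_comp _ _ _ (fun k => Xk k w) (F^~ w)); last exact: cF.
apply/cvg_ballP => e e0; near=> k; split => // i j; rewrite (ord1 i) mxE /ball /=.
apply: le_lt_trans (floor_approx k _) _.
near: k; exact: (near_infty_natSinv_lt (PosNum e0)).
Unshelve. all: by end_near. Qed.

(** Time plays the role of a one-dimensional random vector on the product space. *)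
Lemma measurable_process d (T : measurableType d) (f : R -> T -> R) :
  (forall w, continuous (f^~ w)) -> (forall t, measurable_fun setT (f t)) ->
  measurable_fun setT (fun z : R * T => f z.1 z.2).
Proof.
move=> cf mf.
have := @measurable_caratheodory 1 _ (R * T)%type
  (fun v z => f (v ord0 ord0) z.2) (fun z => \row_(i < 1) z.1).
under eq_fun do rewrite mxE; apply.
- move=> z v; apply: (@continuous_comp _ _ _ (fun v : 'rV[R]_1 => v ord0 ord0) (f^~ z.2)).
    exact: coord_continuous.
  exact: cf.
- by move=> v; exact: measurableT_comp.
- move=> i; rewrite (_ : (fun _ => _) = fst)//.
  by apply/funext => z; rewrite mxE.
Qed.

End Caratheodory.

(** * Bounds on moments and on expectations, and their integration in time *)

Section Moments.
Context (R : realType) (d : measure_display) (Omega : measurableType d)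
  (P : probability Omega R).
Implicit Types (f g : Omega -> R) (q a b c k l t : R).

(* [bnd q f c] says that the [L^q] norm of [f] is at most [c]. *)
Definition bnd q f c := [/\ 0 < c, measurable_fun setT f &
  (\int[P]_w (powR (`|f w| / c) q)%:E <= 1)%E].

Lemma bnd_gt0 q f c : bnd q f c -> 0 < c. Proof. by case. Qed.
Lemma bnd_meas q f c : bnd q f c -> measurable_fun setT f. Proof. by case. Qed.

Lemma measurable_powR_norm q f c : measurable_fun setT f ->
  measurable_fun setT (fun w => (powR (`|f w| / c) q)%:E).
Proof.
move=> mf; apply/measurable_EFinP.
apply: (@measurableT_comp _ _ _ _ _ _ (fun x : R => powR x q)).
  exact: measurable_powR.
by apply: measurable_funM => //; exact: measurableT_comp.
Qed.
Hint Resolve measurable_powR_norm : core.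

(** The common source of domination, Minkowski's inequality, monotonicity in the exponent and
    Cauchy-Schwarz: each reduces to a pointwise bound by a convex combination of normalized
    powers. *)
Lemma bnd_mean (q p r u v : R) f g (h : Omega -> R) a b c : 0 <= u -> 0 <= v -> u + v = 1 ->
  bnd p f a -> bnd r g b -> measurable_fun setT h -> 0 < c ->
  (forall w, powR (`|h w| / c) q <= u * powR (`|f w| / a) p + v * powR (`|g w| / b) r) ->
  bnd q h c.
Proof.
move=> u0 v0 uv [a0 mf fa] [b0 mg gb] mh c0 hfg; split; [exact: c0|exact: mh|].
have mF k p' (f' : Omega -> R) a' : measurable_fun setT f' ->
    measurable_fun setT (fun w => k%:E * (powR (`|f' w| / a') p')%:E)%E.
  by move=> mf'; apply: measurable_funeM; exact: measurable_powR_norm.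
apply: (@le_trans _ _ (\int[P]_w (u%:E * (powR (`|f w| / a) p)%:E +
   v%:E * (powR (`|g w| / b) r)%:E))%E).
  apply: ge0_le_integral => //.
  - by move=> w _; rewrite lee_fin powR_ge0.
  - exact: measurable_powR_norm.
  - by apply: emeasurable_funD; exact: mF.
  - by move=> w _; rewrite -!EFinM -EFinD lee_fin.
rewrite ge0_integralD//; try exact: mF;
  try by move=> w _; rewrite -EFinM lee_fin mulr_ge0 ?powR_ge0.
rewrite !ge0_integralZl//; try exact: measurable_powR_norm;
  try by move=> w _; rewrite lee_fin powR_ge0.
rewrite -uv EFinD -[X in (_ <= X + _)%E]mule1 -[X in (_ <= _ + X)%E]mule1.
by apply: leeD; apply: lee_wpmul2l; [rewrite lee_fin|exact: fa|rewrite lee_fin|exact: gb].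
Qed.

Lemma bnd_dom q f g a b : 0 <= q -> bnd q f a -> measurable_fun setT g -> 0 < b ->
  (forall w, `|g w| / b <= `|f w| / a) -> bnd q g b.
Proof.
move=> q0 fa mg b0 gf; have a0 := bnd_gt0 fa.
apply: (bnd_mean ler01 (lexx 0) (addr0 1) fa fa) => // w; rewrite mul1r mul0r addr0.
by rewrite ge0_ler_powR// nnegrE divr_ge0// ltW.
Qed.

Lemma bnd_le q f a b : 0 <= q -> a <= b -> bnd q f a -> bnd q f b.
Proof.
move=> q0 ab fa; have [a0 mf _] := fa; have b0 := lt_le_trans a0 ab.
by apply: (bnd_dom q0 fa mf b0) => // w; rewrite ler_wpM2l// lef_pV2 ?posrE.
Qed.

Lemma bnd_abs_le q f g c : 0 <= q -> bnd q f c -> measurable_fun setT g ->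
  (forall w, `|g w| <= `|f w|) -> bnd q g c.
Proof.
move=> q0 fc mg gf; have c0 := bnd_gt0 fc.
by apply: (bnd_dom q0 fc) => // w; rewrite ler_wpM2r// invr_ge0 ltW.
Qed.

Lemma bnd_norm q f c : 0 <= q -> bnd q f c -> bnd q (fun w => `|f w|) c.
Proof.
move=> q0 fc; apply: (bnd_abs_le q0 fc); last by move=> w; rewrite normr_id.
by apply: measurableT_comp => //; exact: bnd_meas fc.
Qed.

Lemma bnd_bounded q f c : 0 <= q -> 0 < c -> measurable_fun setT f ->
  (forall w, `|f w| <= c) -> bnd q f c.
Proof.
move=> q0 c0 mf fc; split => //.
rewrite -(@probability_setT _ _ _ P) -[X in (_ <= X)%E]mul1e -integral_cst//.
apply: ge0_le_integral => //; try exact: measurable_powR_norm.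
- by move=> w _; rewrite lee_fin powR_ge0.
- have E1 : powR (1 : R) q = 1 by rewrite powR1.
  move=> w _; rewrite lee_fin -[X in _ <= X]E1.
  apply: ge0_ler_powR => //; rewrite ?nnegrE ?ler01 ?divr_ge0 ?(ltW c0)//.
  by rewrite ler_pdivrMr// mul1r.
Qed.

Lemma bndZ q f c k K : 0 <= q -> bnd q f c -> `|k| <= K -> 0 < K ->
  bnd q (fun w => k * f w) (K * c).
Proof.
move=> q0 fc kK K0; have [c0 mf _] := fc.
apply: (bnd_dom q0 fc); [exact: measurable_funM|exact: mulr_gt0|] => w.
rewrite normrM -mulf_div.
rewrite -[X in _ <= X]mul1r ler_wpM2r ?divr_ge0 ?(ltW c0)// ler_pdivrMr// mul1r//.
Qed.

Lemma bndD q f g a b : 1 <= q -> bnd q f a -> bnd q g b ->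
  bnd q (fun w => f w + g w) (a + b).
Proof.
move=> q1 fa gb; have q0 : 0 <= q by apply: le_trans q1.
have [a0 mf _] := fa; have [b0 mg _] := gb; have ab : 0 < a + b by rewrite addr_gt0.
have uv : a / (a + b) + b / (a + b) = 1 by rewrite -mulrDl divff ?gt_eqF.
apply: (bnd_mean _ _ uv fa gb (measurable_funD mf mg) ab) => [||w].
- by rewrite divr_ge0 ?(ltW a0) ?(ltW ab).
- by rewrite divr_ge0 ?(ltW b0) ?(ltW ab).
- apply: le_trans (powR_convex2 q1 (normr_ge0 _) (normr_ge0 _) a0 b0).
  apply: ge0_ler_powR => //.
  + by rewrite nnegrE divr_ge0// ltW.
  + by rewrite nnegrE divr_ge0 ?addr_ge0// ltW.
  + by rewrite ler_wpM2r ?ler_normD// invr_ge0 ltW.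
Qed.

Lemma bndB q f g a b : 1 <= q -> bnd q f a -> bnd q g b ->
  bnd q (fun w => f w - g w) (a + b).
Proof.
move=> q1 fa gb; apply: (bndD q1 fa); have [_ mg _] := gb.
apply: (bnd_dom (le_trans ler01 q1) gb _ (bnd_gt0 gb)) => [|w]; last by rewrite normrN.
exact: measurableT_comp.
Qed.

(** The successor keeps the bound positive for the empty sum, as [bnd] demands. *)
Lemma bnd_sum q (I : Type) (r : seq I) (F : I -> Omega -> R) c : 1 <= q -> 0 < c ->
  (forall i, bnd q (F i) c) -> bnd q (fun w => \sum_(i <- r) F i w) ((size r).+1%:R * c).
Proof.
move=> q1 c0 Fc; have q0 : 0 <= q by apply: le_trans q1.
elim: r => [|i r IH] /=.
  under eq_fun do rewrite big_nil.
  by apply: bnd_bounded => //; [rewrite mul1r|move=> w; rewrite normr0 mul1r ltW].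
under eq_fun do rewrite big_cons.
rewrite (_ : _ * c = c + (size r).+1%:R * c); first exact: (bndD q1 (Fc i) IH).
by rewrite -(natr1 (size r).+1) mulrDl mul1r addrC.
Qed.

(** Bernoulli's inequality with exponent [p / q] gives [x^q <= (q / p) * x^p + (1 - q / p)], a
    convex combination with the constant function 1. *)
Lemma bnd_exponent q p f c : 0 < q -> q <= p -> bnd p f c -> bnd q f c.
Proof.
move=> q0 qp fc; have [c0 mf _] := fc; have p0 := lt_le_trans q0 qp.
have l0 : 0 <= q / p by rewrite divr_ge0 ?(ltW q0) ?(ltW p0).
have l1 : 0 <= 1 - q / p by rewrite subr_ge0 ler_pdivrMr// mul1r.
have b1 : bnd p (fun=> 1) 1 by apply: bnd_bounded; rewrite ?(ltW p0)// => w; rewrite normr1.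
apply: (bnd_mean l0 l1 _ fc b1) => // [|w]; first by rewrite addrC subrK.
rewrite normr1 divr1 powR1 mulr1.
have := @bernoulli_powR R (p / q) (powR (`|f w| / c) q).
rewrite -powRrM [q * _]mulrC divfK ?gt_eqF// powR_ge0 ler_pdivlMr// mul1r => /(_ qp erefl).
set y := powR _ p; set x := powR _ q => /(ler_wpM2l l0).
have -> : q / p * (1 + p / q * (x - 1)) = q / p + x - 1 by field; rewrite !gt_eqF.
lra.
Qed.

(** Cauchy-Schwarz in normalized form, from [2 * x * y <= x^2 + y^2]. *)
Lemma bndM q f g a b : 0 < q -> bnd (2 * q) f a -> bnd (2 * q) g b ->
  bnd q (fun w => f w * g w) (a * b).
Proof.
move=> q0 fa gb; have [a0 mf _] := fa; have [b0 mg _] := gb.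
have h0 : 0 <= 2^-1 :> R by rewrite invr_ge0.
have h1 : 2^-1 + 2^-1 = 1 :> R by field.
apply: (bnd_mean h0 h0 h1 fa gb (measurable_funM mf mg) (mulr_gt0 a0 b0)) => w.
rewrite normrM -mulf_div powRM ?divr_ge0 ?(ltW a0) ?(ltW b0)//.
rewrite ![2 * q]mulrC !powRrM !powR_mulrn ?powR_ge0//.
have := sqr_ge0 (powR (`|f w| / a) q - powR (`|g w| / b) q); rewrite sqrrB; lra.
Qed.

(** Unlike [bnd], this keeps cancellation inside the expectation, and [c = 0] is allowed, which
    expresses exact centering. *)
Definition eb f c := P.-integrable setT (EFin \o f) /\ `|Rintegral P setT f| <= c.

Lemma eb_le f a b : a <= b -> eb f a -> eb f b.
Proof. by move=> ab [fi fa]; split; [exact: fi|exact: le_trans ab]. Qed.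

Lemma bnd1_integral f c : bnd 1 f c -> (\int[P]_w (`|f w|)%:E <= c%:E)%E.
Proof.
move=> [c0 mf fc].
have E w : (`|f w|)%:E = (c%:E * (powR (`|f w| / c) 1)%:E)%E.
  rewrite powRr1 ?divr_ge0 ?(ltW c0)// -EFinM mulrC divfK//.
  by rewrite gt_eqF.
under eq_integral do rewrite E.
rewrite ge0_integralZl//.
- by rewrite -[X in (_ <= X)%E]mule1; apply: lee_wpmul2l; rewrite // lee_fin ltW.
- exact: measurable_powR_norm.
- by move=> w _; rewrite lee_fin powR_ge0.
- by rewrite lee_fin ltW.
Qed.

Lemma bnd_integrable q f c : 1 <= q -> bnd q f c -> P.-integrable setT (EFin \o f).
Proof.
move=> q1 fc; have mf := bnd_meas fc.
apply/integrableP; split; first exact/measurable_EFinP.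
have := bnd1_integral (bnd_exponent ltr01 q1 fc).
by move=> /le_lt_trans; apply; rewrite ltry.
Qed.

Lemma eb_bnd q f c : 1 <= q -> bnd q f c -> eb f c.
Proof.
move=> q1 fc; have fi := bnd_integrable q1 fc; split => //.
have := bnd1_integral (bnd_exponent ltr01 q1 fc).
rewrite -lee_fin; apply: le_trans.
apply: le_trans (_ : (`|Rintegral P setT f|%:E <= (\int[P]_w `|f w|)%:E)%E) _.
  by rewrite lee_fin; exact: le_normr_Rintegral.
rewrite /Rintegral fineK//.
by apply: integrable_fin_num => //; exact: integrable_norm.
Qed.

Lemma ebD f g a b : eb f a -> eb g b -> eb (fun w => f w + g w) (a + b).
Proof.
move=> [fi fa] [gi gb]; split; first exact: integrableD fi gi.
by rewrite RintegralD//; apply: le_trans (ler_normD _ _) _; exact: lerD.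
Qed.

Lemma ebZ f c k K : eb f c -> `|k| <= K -> eb (fun w => k * f w) (K * c).
Proof.
move=> [fi fc] kK; split; first exact: integrableZl fi.
by rewrite RintegralZl// normrM ler_pM.
Qed.

Lemma eb0 c : 0 <= c -> eb (fun=> 0) c.
Proof.
move=> c0; split; first exact: integrable0.
by rewrite Rintegral_cst// mul0r normr0.
Qed.

Lemma eb_sum (I : Type) (r : seq I) (F : I -> Omega -> R) c : 0 <= c ->
  (forall i, eb (F i) c) -> eb (fun w => \sum_(i <- r) F i w) ((size r)%:R * c).
Proof.
move=> c0 Fc; elim: r => [|i r IH] /=.
  by under eq_fun do rewrite big_nil; apply: eb0; rewrite mul0r.
under eq_fun do rewrite big_cons.
rewrite (_ : _ * c = c + (size r)%:R * c); first exact: ebD.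
by rewrite -(natr1 (size r)) mulrDl mul1r addrC.
Qed.

(* Jointly measurable because the paths are continuous. *)
Definition process (f : R -> Omega -> R) :=
  (forall w, continuous (f^~ w)) /\ (forall t, measurable_fun setT (f t)).

(** Extension by 0 outside [[a, t]], so that Tonelli and Fubini apply on the product of the full
    spaces. *)
Definition cut (f : R -> Omega -> R) a t (z : R * Omega) : \bar R :=
  (f z.1 z.2 * \1_(`[a, t]%classic) z.1)%:E.

Lemma cutE (f : R -> Omega -> R) a t w :
  ((fun s => (f s w)%:E) \_ `[a, t] = fun s => cut f a t (s, w))%E.
Proof.
apply/funext => s; rewrite /cut patchE indicE /=.
by case: ifPn => h; rewrite ?mulr1 ?mulr0.
Qed.

Lemma measurable_cut (f : R -> Omega -> R) a t : process f ->
  measurable_fun setT (cut f a t).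
Proof.
move=> [cf mf]; apply/measurable_EFinP.
apply: measurable_funM; first exact: measurable_process.
by apply: measurableT_comp => //; exact: measurable_indic.
Qed.

Lemma tint_cut (f : R -> Omega -> R) a t w : process f ->
  (tint a t (f^~ w))%:E = (\int[@lebesgue_measure R]_s cut f a t (s, w))%E.
Proof.
move=> [cf mf]; rewrite /tint /Rintegral fineK.
  by rewrite integral_mkcond cutE.
by apply: integrable_fin_num => //; exact: cont_integrable.
Qed.

Lemma measurable_tint (f : R -> Omega -> R) a t : process f ->
  measurable_fun setT (fun w => tint a t (f^~ w)).
Proof.
move=> pf; apply/measurable_EFinP.
have E w : ((tint a t (f^~ w))%:E = fubini_G (@lebesgue_measure R) (cut f a t)^\+ w -
    fubini_G (@lebesgue_measure R) (cut f a t)^\- w)%E.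
  rewrite tint_cut// integralE.
  by congr (_ - _)%E; apply: eq_integral => s _; rewrite ?funeposE ?funenegE.
rewrite /comp; under eq_fun do rewrite E.
apply: emeasurable_funB; apply: measurable_fun_fubini_tonelli_G => //.
  by apply: measurable_funepos; exact: measurable_cut.
by apply: measurable_funeneg; exact: measurable_cut.
Qed.

Lemma integral_cutE (f : R -> Omega -> R) a t s :
  (\int[P]_w cut f a t (s, w) =
   ((fun s => \int[P]_w (f s w)%:E) \_ `[a, t]) s)%E.
Proof.
rewrite patchE /cut; case: ifPn => h.
  by apply: eq_integral => w _; rewrite indicE /= h mulr1.
by rewrite integral0_eq// => w _; rewrite indicE /= (negbTE h) mulr0.
Qed.

Lemma tonelli_tint (f : R -> Omega -> R) a t : process f -> (forall s w, 0 <= f s w) ->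
  (\int[P]_w (tint a t (f^~ w))%:E =
   \int[@lebesgue_measure R]_(s in `[a, t]) \int[P]_w (f s w)%:E)%E.
Proof.
move=> pf f0; under eq_integral do rewrite tint_cut//.
rewrite [RHS]integral_mkcond; under [RHS]eq_integral do rewrite -integral_cutE.
have := @fubini_tonelli _ _ _ _ _ (@lebesgue_measure R) P (cut f a t).
rewrite /fubini_F /fubini_G => -> //; first exact: measurable_cut.
by move=> z; rewrite /cut lee_fin mulr_ge0.
Qed.

(** Minkowski's integral inequality: the norm of the integral is at most the integral of the norms.
    Jensen's inequality is applied on each path with weight [c s / C], then Tonelli exchanges time
    and expectation. *)
Lemma bnd_tint q (f : R -> Omega -> R) (c : R -> R) a t C : 1 <= q -> process f ->
  continuous c -> (forall s, 0 < c s) ->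
  (forall s, a <= s -> s <= t -> bnd q (f s) (c s)) -> 0 < C -> tint a t c <= C ->
  bnd q (fun w => tint a t (f^~ w)) C.
Proof.
move=> q1 pf cc c0 fc C0 cC; have [cf mf] := pf.
split; [exact: C0|exact: measurable_tint|].
pose g s w := c s / C * powR (`|f s w| / c s) q.
have g0 s w : 0 <= g s w by rewrite mulr_ge0 ?powR_ge0// divr_ge0 ?(ltW C0) ?(ltW (c0 s)).
have pg : process g.
  split=> [w|s]; first exact: continuous_jensen.
  by apply: measurable_funM => //; apply/measurable_EFinP; exact: measurable_powR_norm.
apply: (@le_trans _ _ (\int[P]_w (tint a t (g^~ w))%:E)%E).
  apply: ge0_le_integral => //.
  - by move=> w _; rewrite lee_fin powR_ge0.
  - by apply: measurable_powR_norm; exact: measurable_tint.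
  - by apply/measurable_EFinP; exact: measurable_tint.
  - by move=> w _; rewrite lee_fin; exact: jensen_tint.
rewrite tonelli_tint//.
have ccC : continuous (fun s => c s / C) by apply: contM => //; exact: cont_cst.
apply: (@le_trans _ _ (\int[@lebesgue_measure R]_(s in `[a, t]) (c s / C)%:E)%E).
  apply: ge0_le_integral => //.
  - by move=> s _; apply: integral_ge0 => w _; rewrite lee_fin.
  - apply: measurable_funTS.
    apply: (measurable_fun_fubini_tonelli_F (fun z : R * Omega => (g z.1 z.2)%:E)).
      by apply/measurable_EFinP; case: pg => *; exact: measurable_process.
    by move=> z; rewrite lee_fin.
  - by apply/measurable_EFinP; apply: measurable_funTS; exact: continuous_measurable_fun.
  - move=> s; rewrite /= in_itv /= => /andP[as_ st].
    have [_ ms fs] := fc s as_ st.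
    rewrite /g; under eq_integral do rewrite EFinM.
    rewrite ge0_integralZl//.
    + rewrite -[X in (_ <= X)%E]mule1; apply: lee_wpmul2l => //.
      by rewrite lee_fin divr_ge0 ?(ltW C0) ?(ltW (c0 s)).
    + exact: measurable_powR_norm.
    + by move=> w _; rewrite lee_fin powR_ge0.
    + by rewrite lee_fin divr_ge0 ?(ltW C0) ?(ltW (c0 s)).
have : tint a t (fun s => c s / C) <= 1.
  under eq_fun do rewrite mulrC; rewrite tintZ//.
  by rewrite mulrC ler_pdivrMr// mul1r.
rewrite -lee_fin /tint /Rintegral fineK//.
by apply: integrable_fin_num => //; exact: cont_integrable.
Qed.

(** The uniform bound [M] gives the integrability for Fubini and does not enter [C]; the size comes
    from the expectations at single times. *)
Lemma eb_tint (f : R -> Omega -> R) (c : R -> R) a t C M : process f -> a <= t ->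
  continuous c ->
  (forall s, a <= s -> s <= t -> bnd 1 (f s) M) ->
  (forall s, a <= s -> s <= t -> eb (f s) (c s)) -> tint a t c <= C ->
  eb (fun w => tint a t (f^~ w)) C.
Proof.
move=> pf at_ cc fM fc cC; have [cf mf] := pf.
have mc := measurable_cut a t pf.
have ic : (@lebesgue_measure R \x P)%E.-integrable setT (cut f a t).
  have h := @integrable12ltyP _ _ _ _ _ (@lebesgue_measure R) P (cut f a t) mc.
  apply: h.2; clear h.
  apply: (@le_lt_trans _ _ (\int[@lebesgue_measure R]_(s in `[a, t]) M%:E)%E); last first.
    by rewrite integral_cst//= lebesgue_measure_itv/=; case: ifP => _; rewrite -?EFinD -EFinM ltry.
  rewrite [X in (_ <= X)%E]integral_mkcond.
  apply: ge0_le_integral => //.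
  - by move=> s _; apply: integral_ge0.
  - apply: (measurable_fun_fubini_tonelli_F (abse \o cut f a t)) => //.
      exact: measurableT_comp.
    by move=> z; exact: abse_ge0.
  - by apply: (measurable_restrictT _ _).1.
  - move=> s _; rewrite patchE /cut; case: ifPn => h.
      move: (h); rewrite inE /= in_itv /= => /andP[as_ st].
      under eq_integral do rewrite indicE /= h mulr1.
      exact: bnd1_integral (fM s as_ st).
    by rewrite integral0_eq// => w _; rewrite indicE /= (negbTE h) mulr0 ?abse0 ?normr0.
split.
  have M0 : 0 < M by apply: bnd_gt0 (fM a (lexx _) at_).
  have h : bnd 1 (fun w => tint a t (f^~ w)) (M * (t - a) + M).
    apply: (@bnd_tint 1 f (fun=> M)) => //; first exact: cont_cst.
      by rewrite ltr_wpDl// mulr_ge0 ?subr_ge0// ltW.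
    by rewrite tint_cst// lerDl ltW.
  exact: bnd_integrable h.
rewrite /Rintegral; under eq_integral do rewrite tint_cut//.
rewrite -(Fubini ic).
have iF := integrable_fubini_F ic.
have fF : (\int[@lebesgue_measure R]_s \int[P]_w cut f a t (s, w))%E \is a fin_num.
  exact: integrable_fin_num iF.
rewrite -lee_fin -[X in (X <= _)%E]/(`|(fine _)%:E|%E) fineK//.
apply: le_trans (le_abse_integral _ _ (measurable_int _ iF)) _ => //.
apply: (@le_trans _ _ (\int[@lebesgue_measure R]_(s in `[a, t]) (c s)%:E)%E); last first.
  move: cC; rewrite -lee_fin /tint /Rintegral fineK//.
  by apply: integrable_fin_num => //; exact: cont_integrable.
rewrite [X in (_ <= X)%E]integral_mkcond.
apply: ge0_le_integral => //.
- by apply: measurableT_comp => //; exact: measurable_int iF.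
- apply: (measurable_restrictT _ _).1 => //.
  by apply/measurable_EFinP; apply: measurable_funTS; exact: continuous_measurable_fun.
- move=> s _; rewrite /fubini_F integral_cutE !patchE; case: ifPn => h; last by rewrite abse0.
  move: (h); rewrite inE /= in_itv /= => /andP[as_ st].
  have [fi fs] := fc s as_ st.
  rewrite -(fineK (integrable_fin_num _ fi))//.
Qed.

End Moments.

(** * Closure of processes, and moments of the relaxation functional *)

Section MomentCalculus.
Context (R : realType) (d : measure_display) (Omega : measurableType d)
  (P : probability Omega R).
Implicit Types (f g : Omega -> R) (q a b c k l t : R).

Local Notation bnd := (@bnd R d Omega P).
Local Notation eb := (@eb R d Omega P).
Local Notation process := (@process R d Omega).

Lemma processD (f g : R -> Omega -> R) : process f -> process g ->
  process (fun s w => f s w + g s w).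
Proof. by move=> [cf mf] [cg mg]; split=> [w|s]; [exact: contD|exact: measurable_funD]. Qed.

Lemma processB (f g : R -> Omega -> R) : process f -> process g ->
  process (fun s w => f s w - g s w).
Proof. by move=> [cf mf] [cg mg]; split=> [w|s]; [exact: contB|exact: measurable_funB]. Qed.

Lemma processM (f g : R -> Omega -> R) : process f -> process g ->
  process (fun s w => f s w * g s w).
Proof. by move=> [cf mf] [cg mg]; split=> [w|s]; [exact: contM|exact: measurable_funM]. Qed.

Lemma process_const_time g : measurable_fun setT g -> process (fun _ w => g w).
Proof. by move=> mg; split=> [w|s] //; exact: cont_cst. Qed.

Lemma process_path (c : R -> R) : continuous c ->
  process (fun s _ => c s).
Proof. by move=> cc; split=> [w|s] //; exact: measurable_cst. Qed.

Lemma process_norm (f : R -> Omega -> R) : process f -> process (fun s w => `|f s w|).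
Proof.
move=> [cf mf]; split=> [w|s]; first exact: continuous_norm_comp.
exact: measurableT_comp.
Qed.

Lemma process_sum (I : Type) (r : seq I) (f : I -> R -> Omega -> R) :
  (forall i, process (f i)) -> process (fun s w => \sum_(i <- r) f i s w).
Proof.
move=> pf; elim: r => [|i r IH].
  have -> : (fun s w => \sum_(i <- [::]) f i s w) = (fun _ _ => 0).
    by apply/funext => s; apply/funext => w; rewrite big_nil.
  by apply: process_const_time; exact: measurable_cst.
have -> : (fun s w => \sum_(j <- i :: r) f j s w) =
          (fun s w => f i s w + \sum_(j <- r) f j s w).
  by apply/funext => s; apply/funext => w; rewrite big_cons.
exact: processD.
Qed.

(** The integrand is [expR (l * s)] times a bound growing like [expR (l * (t - s) / 2)]; half of the
    rate survives and its integral gives the factor [2 / l]. *)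
Lemma relax_weight l t k : 0 < l -> 0 <= t ->
  tint 0 t (fun s => k * expR (l * t / 2) * expR ((l / 2) * s)) <=
  2 * `|k| / l * expR (l * t).
Proof.
move=> l0 t0; rewrite tintZ; last exact: continuous_expRM.
have l2 : l / 2 != 0 by rewrite mulf_neq0 ?gt_eqF.
rewrite tint_expR//.
have -> : expR (l * t) = expR (l * t / 2) * expR (l * t / 2).
  by rewrite -expRD; congr expR; field.
rewrite (_ : l / 2 * t = l * t / 2); last by field.
have e0 := expR_gt0 (l * t / 2); have e1 : 1 <= expR (l * t / 2).
  by rewrite -expR0 ler_expR; apply: divr_ge0 => //; apply: mulr_ge0; rewrite ?(ltW l0).
set e := expR _ in e0 e1 *.
have -> : k * e * ((e - 1) / (l / 2)) = 2 * k / l * (e * (e - 1)) by field; rewrite gt_eqF.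
have -> : 2 * `|k| / l * (e * e) = 2 * `|k| / l * (e * (e - 1)) + 2 * `|k| / l * e by ring.
have h : 0 <= 2 / l by rewrite divr_ge0// ltW.
apply: ler_wpDr.
  by apply: mulr_ge0; rewrite ?(ltW e0)// mulrAC mulr_ge0.
apply: ler_wpM2r; first by rewrite mulr_ge0 ?subr_ge0// ltW.
by rewrite -!mulrA ler_wpM2l// ler_wpM2r ?ler_norm// invr_ge0 ltW.
Qed.

(** Of the [3 * k], one [k] bounds the boundary term [q t - q 0] of [relax] and [2 * k] its
    integral. *)
Lemma relax_weight_total l t k : 0 < l -> 0 <= t -> 0 <= k ->
  expR (- (l * t)) * (k * expR (l * t / 2) + l * (2 * k / l * expR (l * t))) <= 3 * k.
Proof.
move=> l0 t0 k0; have e0 := expR_gt0 (l * t / 2); have e1 : 1 <= expR (l * t / 2).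
  by rewrite -expR0 ler_expR; apply: divr_ge0 => //; apply: mulr_ge0; rewrite ?(ltW l0).
rewrite expRN (_ : expR (l * t) = expR (l * t / 2) * expR (l * t / 2)); last first.
  by rewrite -expRD; congr expR; field.
set e := expR _ in e0 e1 *.
have -> : (e * e)^-1 * (k * e + l * (2 * k / l * (e * e))) = k / e + 2 * k.
  by field; rewrite !gt_eqF.
have : k / e <= k by rewrite ler_pdivrMr// ler_peMr.
lra.
Qed.

Lemma process_relax_integrand l (q : R -> Omega -> R) t : process q ->
  process (fun s w => expR (l * s) * (q t w - q s w)).
Proof.
move=> pq; apply: processM; first by apply: process_path; exact: continuous_expRM.
by apply: processB => //; apply: process_const_time; exact: pq.2.
Qed.

(** Relaxation averages increments with full rate [l], so increments growing at half that rate still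
    average to the size [k]. Only [s < t] is assumed, since Brownian bounds proportional to
    [sqrt (t - s)] are positive only there. *)
Lemma bnd_relax q l (f : R -> Omega -> R) t k : 1 <= q -> 0 < l -> 0 <= t -> 0 < k ->
  process f ->
  (forall s, 0 <= s -> s < t ->
    bnd q (fun w => f t w - f s w) (k * expR (l * (t - s) / 2))) ->
  bnd q (fun w => relax l (f^~ w) t) (3 * k).
Proof.
move=> q1 l0 t0 k0 pf hf'; have q0 : 0 <= q by apply: le_trans q1.
have hf s : 0 <= s -> s <= t -> bnd q (fun w => f t w - f s w) (k * expR (l * (t - s) / 2)).
  move=> s0; rewrite le_eqVlt => /predU1P[->|]; last exact: hf'.
  have ke := mulr_gt0 k0 (expR_gt0 (l * (t - t) / 2)).
  under eq_fun do rewrite subrr.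
  by apply: bnd_bounded => // w; rewrite normr0 ltW.
have h1 : bnd q (fun w => tint 0 t (fun s => expR (l * s) * (f t w - f s w)))
     (2 * k / l * expR (l * t)).
  apply: (@bnd_tint _ _ _ P q (fun s w => expR (l * s) * (f t w - f s w))
    (fun s => k * expR (l * t / 2) * expR ((l / 2) * s))); [exact: q1| | | | | |].
  - exact: process_relax_integrand.
  - by apply: contM; [exact: cont_cst|exact: continuous_expRM].
  - by move=> s; rewrite !mulr_gt0 ?expR_gt0.
  - move=> s s0 st; have := @bndZ _ _ _ P q _ _ (expR (l * s)) (expR (l * s)) q0 (hf s s0 st).
    rewrite (ger0_norm (expR_ge0 _)) => /(_ (lexx _) (expR_gt0 _)).
    congr bnd; rewrite mulrCA -!mulrA -!expRD; congr (_ * expR _); by field.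
  - by rewrite !mulr_gt0 ?expR_gt0 ?invr_gt0.
  - by have := relax_weight k l0 t0; rewrite (gtr0_norm k0).
have h2 := bndD q1 (hf 0 (lexx 0) t0) (bndZ q0 h1 (_ : `|l| <= l) l0).
have {h2} := h2 (ltac:(rewrite gtr0_norm//)).
move=> /(@bndZ _ _ _ P q _ _ (expR (- (l * t))) (expR (- (l * t))) q0).
rewrite (ger0_norm (expR_ge0 _)) => /(_ (lexx _) (expR_gt0 _)).
by apply: bnd_le => //; rewrite subr0; apply: relax_weight_total => //; exact: ltW.
Qed.

(** The counterpart for expectations, with a weight [g] that carries correlations. Taking [k = 0]
    turns centered increments into an exactly centered relaxation. *)
Lemma eb_relax l (g : Omega -> R) (f : R -> Omega -> R) t k M : 0 < l -> 0 <= t -> 0 <= k ->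
  process f -> measurable_fun setT g ->
  (forall s, 0 <= s -> s <= t -> bnd 1 (fun w => g w * (f t w - f s w)) M) ->
  (forall s, 0 <= s -> s <= t ->
    eb (fun w => g w * (f t w - f s w)) (k * expR (l * (t - s) / 2))) ->
  eb (fun w => g w * relax l (f^~ w) t) (3 * k).
Proof.
move=> l0 t0 k0 pf mg hM hf.
have h1 : eb (fun w => tint 0 t (fun s => expR (l * s) * (g w * (f t w - f s w))))
     (2 * k / l * expR (l * t)).
  have lt0 s : 0 <= s -> 0 <= l * s by move=> s0; rewrite mulr_ge0// ltW.
  apply: (@eb_tint _ _ _ P (fun s w => expR (l * s) * (g w * (f t w - f s w)))
    (fun s => k * expR (l * t / 2) * expR ((l / 2) * s)) _ _ _ (expR (l * t) * M));
    [|exact: t0| | | |].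
  - apply: processM; first by apply: process_path; exact: continuous_expRM.
    apply: processM; first exact: process_const_time.
    by apply: processB => //; apply: process_const_time; exact: pf.2.
  - by apply: contM; [exact: cont_cst|exact: continuous_expRM].
  - move=> s s0 st; apply: bndZ => //; first exact: hM.
      by rewrite ger0_norm ?expR_ge0// ler_expR ler_pM2l.
    exact: expR_gt0.
  - move=> s s0 st; have := @ebZ _ _ _ P _ _ (expR (l * s)) (expR (l * s)) (hf s s0 st).
    rewrite (ger0_norm (expR_ge0 _)) => /(_ (lexx _)).
    congr eb; rewrite mulrCA -!mulrA -!expRD; congr (_ * expR _); by field.
  - by have := relax_weight k l0 t0; rewrite (ger0_norm k0).
have h2 := ebD (hf 0 (lexx 0) t0) (ebZ h1 (_ : `|l| <= l)).
have {h2} := h2 (ltac:(rewrite gtr0_norm//)).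
move=> /(@ebZ _ _ _ P _ _ (expR (- (l * t))) (expR (- (l * t)))).
rewrite (ger0_norm (expR_ge0 _)) => /(_ (lexx _)).
rewrite subr0.
rewrite (_ : (fun w => _) = (fun w => g w * relax l (f^~ w) t)); last first.
  apply/funext => w; rewrite /relax.
  have -> : tint 0 t (fun s => expR (l * s) * (g w * (f t w - f s w))) =
     g w * tint 0 t (fun s => expR (l * s) * (f t w - f s w)).
    rewrite -tintZ; first by apply: eq_tint => s _ _; ring.
    by case: (process_relax_integrand l t pf) => + _; apply.
  ring.
by apply: eb_le; exact: relax_weight_total.
Qed.
End MomentCalculus.

(** * Second differences of the Gaussian characteristic function *)

Section GaussianDifferences.
Variable R : realType.
Implicit Types (f g : R -> R) (v h x y : R) (p : {poly R}) (k m : nat).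

(** The negative of the second central difference; with this sign it multiplies [cos (v * y)] by the
    nonnegative factor [2 - 2 * cos (h * y)]. *)
Definition sdiff h f v := 2 * f v - f (v + h) - f (v - h).

Lemma is_derive_shift f g c x : (forall v, is_derive v 1 f (g v)) ->
  is_derive x 1 (fun v => f (v + c)) (g (x + c)).
Proof.
move=> df; have dc : is_derive x 1 (fun v : R => v + c) 1.
  by apply: is_derive_eq; rewrite addr0.
by have := @is_derive1_comp R f (fun v : R => v + c) x (g (x + c)) 1 (df _) dc; rewrite mulr1.
Qed.

Lemma is_derive_sdiff h f g : (forall v, is_derive v 1 f (g v)) ->
  forall v, is_derive v 1 (sdiff h f) (sdiff h g v).
Proof.
move=> df v.
have d1 := is_derive_shift h v df; have d2 := is_derive_shift (- h) v df.
have d0 : is_derive v 1 (fun v => 2 * f v) (2 * g v) by have := is_deriveZ 2 (df v).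
by have := is_deriveB (is_deriveB d0 d1) d2.
Qed.

Lemma MVT_line f g a b : (forall v, is_derive v 1 f (g v)) ->
  exists2 c, f b - f a = g c * (b - a) & `|c - a| <= `|b - a|.
Proof.
move=> df.
have cf : continuous f.
  by move=> v; apply: differentiable_continuous; apply/derivable1_diffP; apply: @ex_derive.
have [ab|ba] := leP a b.
  have [c cab E] := @MVT_segment R f g a b ab (fun x _ => df x) (continuous_subspaceT cf).
  exists c => //; move: cab; rewrite in_itv /= => /andP[ac cb].
  by rewrite !ger0_norm ?subr_ge0// lerB.
have [c cab E] := @MVT_segment R f g b a (ltW ba) (fun x _ => df x) (continuous_subspaceT cf).
exists c; first by rewrite -opprB E -mulrN opprB.
move: cab; rewrite in_itv /= => /andP[bc ca].
by rewrite distrC [`|b - a|]distrC !ger0_norm ?subr_ge0 ?(ltW ba)// lerB.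
Qed.

Lemma sdiff_bound h f f1 f2 K : (forall v, is_derive v 1 f (f1 v)) ->
  (forall v, is_derive v 1 f1 (f2 v)) -> (forall v, `|f2 v| <= K) ->
  forall v, `|sdiff h f v| <= h ^+ 2 * K.
Proof.
move=> df df1 f2K v.
pose psi x := f (x + h) - f x.
have dpsi x : is_derive x 1 psi (f1 (x + h) - f1 x).
  by have := is_deriveB (is_derive_shift h x df) (df x).
have [c E _] := MVT_line (v - h) v dpsi.
have [c' E' _] := MVT_line c (c + h) df1.
have -> : sdiff h f v = - (f2 c' * h * h).
  have -> : sdiff h f v = - (psi v - psi (v - h)) by rewrite /psi /sdiff subrK; ring.
  by rewrite E E'; ring.
by rewrite normrN !normrM -mulrA -expr2 real_normK ?num_real// mulrC ler_wpM2l ?sqr_ge0.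
Qed.

(** The sequence [f] lists successive derivatives. Differences commute with differentiation, and
    each one costs two derivatives and gains [h ^+ 2]. *)
Lemma iter_sdiff_bound h (f : nat -> R -> R) (B : nat -> R) :
  (forall m v, is_derive v 1 (f m) (f m.+1 v)) -> (forall m v, `|f m v| <= B m) ->
  forall k m v, `|iter k (sdiff h) (f m) v| <= h ^+ (2 * k) * B (m + 2 * k)%N.
Proof.
move=> df fB k.
have dk j m v : is_derive v 1 (iter j (sdiff h) (f m)) (iter j (sdiff h) (f m.+1) v).
  by elim: j m v => [|j IH] m v; [exact: df|apply: is_derive_sdiff => {}v; exact: IH].
elim: k => [|k IH] m v; first by rewrite muln0 addn0 expr0 mul1r; exact: fB.
rewrite iterS.
have := @sdiff_bound h _ _ _ (h ^+ (2 * k) * B (m.+2 + 2 * k)%N) (dk k m) (dk k m.+1)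
   (IH m.+2) v.
by rewrite mulrA -exprD mulnS add2n !addnS !addSn.
Qed.

(** The Hermite polynomials up to the sign [(-1)^m]: the [m]-th derivative of [expR (- v ^+ 2 / 2)]
    is [gpoly m] times the same exponential. *)
Fixpoint gpoly m : {poly R} := if m is m'.+1 then (gpoly m')^`() - 'X * gpoly m' else 1.

Definition gder m v := (gpoly m).[v] * expR (- v ^+ 2 / 2).

Lemma is_derive_gder m v : is_derive v 1 (gder m) (gder m.+1 v).
Proof.
have d1 : is_derive v 1 (fun v => (gpoly m).[v]) ((gpoly m)^`()).[v].
  exact: is_derive_poly.
have d2 : is_derive v 1 (fun v : R => expR (- v ^+ 2 / 2)) (- v * expR (- v ^+ 2 / 2)).
  have d3 : is_derive v 1 (fun v : R => - v ^+ 2 / 2) (- v).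
    by apply: is_derive_eq; rewrite /GRing.scale /=; field.
  have := @is_derive1_comp R expR (fun v : R => - v ^+ 2 / 2) v _ _ (is_derive_expR _) d3.
  by rewrite mulrC.
have := is_deriveM d1 d2; rewrite /gder /= => dd.
rewrite (_ : _ * _ = (gpoly m).[v] *: (- v * expR (- v ^+ 2 / 2)) +
   expR (- v ^+ 2 / 2) *: ((gpoly m)^`()).[v])//.
by rewrite hornerD hornerN hornerM hornerX /GRing.scale /=; ring.
Qed.

(** Induction on the degree: half of the exponent bounds the lower-degree factor, the other half
    absorbs the additional factor [v]. *)
Lemma poly_expR_bound p : forall a : R, 0 < a ->
  exists2 B, 0 <= B & forall v, `|p.[v]| <= B * expR (a * v ^+ 2).
Proof.
elim/poly_ind: p => [|p c IH] a a0.
  by exists 0 => // v; rewrite horner0 normr0 mul0r.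
have [B B0 HB] := IH (a / 2) (ltac:(rewrite divr_gt0//)).
exists (B * (1 + 2 / a) + `|c|) => [|v].
  by rewrite addr_ge0// mulr_ge0// addr_ge0// divr_ge0// ltW.
rewrite hornerMXaddC; apply: le_trans (ler_normD _ _) _; rewrite mulrDl; apply: lerD.
  rewrite normrM; have E : expR (a * v ^+ 2) = expR (a / 2 * v ^+ 2) * expR (a / 2 * v ^+ 2).
    by rewrite -expRD; congr expR; field.
  set e := expR (a / 2 * _) in E *.
  rewrite E (_ : _ * _ * (e * e) = (B * e) * ((1 + 2 / a) * e)); last by ring.
  apply: ler_pM => //.
  have h1 : `|v| <= 1 + v ^+ 2.
    have := sqr_ge0 (`|v| - 1); rewrite sqrrB real_normK ?num_real//; have := normr_ge0 v; lra.
  apply: le_trans h1 _.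
  have h2 := expR_ge1Dx (a / 2 * v ^+ 2).
  have h3 : 0 <= a / 2 * v ^+ 2 by rewrite mulr_ge0 ?sqr_ge0// divr_ge0// ltW.
  have E3 : v ^+ 2 = (2 / a) * (a / 2 * v ^+ 2) by field; rewrite gt_eqF.
  rewrite {1}E3.
  have h4 : 0 < 2 / a by rewrite divr_gt0.
  move: h2 h3; rewrite -/e; set z := a / 2 * _ => h2 h3.
  rewrite [X in _ <= X]mulrDl mul1r; apply: lerD; first by lra.
  by rewrite ler_pM2l//; lra.
rewrite -[X in X <= _]mulr1 ler_wpM2l// -expR0 ler_expR.
by rewrite mulr_ge0 ?sqr_ge0// ltW.
Qed.

Lemma gder_bounded : exists B : nat -> R, forall m v, `|gder m v| <= B m.
Proof.
suff h m : exists B : R, forall v, `|gder m v| <= B by have [B HB] := choice h; exists B.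
have h0 : 0 < (1 / 2 : R) by rewrite divr_gt0.
have [B B0 HB] := poly_expR_bound (gpoly m) h0.
exists B => v; rewrite /gder normrM (ger0_norm (expR_ge0 _)).
rewrite mulNr expRN ler_pdivrMr ?expR_gt0//.
by have := HB v; rewrite [1 / 2 * _]mulrC mul1r.
Qed.

Lemma gder0 v : gder 0 v = expR (- v ^+ 2 / 2).
Proof. by rewrite /gder /= hornerC mul1r. Qed.

Lemma abs_sin_le y : `|sin y| <= `|y|.
Proof.
have [c] := MVT_line 0 y (@is_derive_sin R).
rewrite sin0 !subr0 => -> _; rewrite normrM -[X in _ <= X]mul1r ler_wpM2r//.
by rewrite ler_norml cos_geN1 cos_le1.
Qed.

Lemma sin_sub_le y : `|sin y - y| <= `|y| ^+ 2.
Proof.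
have ds x : is_derive x 1 (fun y => sin y - y) (cos x - 1) by exact: is_deriveB.
have [c] := MVT_line 0 y ds; rewrite sin0 !subr0 => -> cy.
rewrite normrM expr2 ler_wpM2r//.
have [c'] := MVT_line 0 c (@is_derive_cos R).
rewrite cos0 subr0 => -> _; rewrite normrM normrN.
apply: le_trans cy; rewrite -[X in _ <= X]mul1r ler_wpM2r//.
by rewrite ler_norml sin_geN1 sin_le1.
Qed.

(** The functions [sin (x / N) * N] are bounded, so their moments can be read off a characteristic
    function, and they recover [x] with error at most [|x|^2 / N]. *)
Lemma cvg_sin_ratio x : (sin (x / k.+1%:R) * k.+1%:R) @[k --> \oo] --> x.
Proof.
apply/cvgrPdist_le => e e0; near=> k.
have k0 : (0 : R) < k.+1%:R by [].
have E : x - sin (x / k.+1%:R) * k.+1%:R = - (sin (x / k.+1%:R) - x / k.+1%:R) * k.+1%:R.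
  by field; rewrite gt_eqF.
rewrite E normrM normrN (gtr0_norm k0).
apply: le_trans (ler_wpM2r (ltW k0) (sin_sub_le _)) _.
rewrite normrM exprMn normfV (gtr0_norm k0).
have -> : `|x| ^+ 2 * k.+1%:R^-1 ^+ 2 * k.+1%:R = `|x| ^+ 2 * k.+1%:R^-1.
  by field; rewrite gt_eqF.
have h : k.+1%:R^-1 <= e / (`|x| ^+ 2 + 1).
  near: k; have d0 : 0 < e / (`|x| ^+ 2 + 1) by rewrite divr_gt0// ltr_wpDl// sqr_ge0.
  by apply: filterS (near_infty_natSinv_lt (PosNum d0)) => k /= /ltW.
apply: le_trans (ler_wpM2l (sqr_ge0 _) h) _.
rewrite mulrCA -[X in _ <= X]mulr1 ler_wpM2l ?(ltW e0)//.
by rewrite ler_pdivrMr ?mul1r ?lerDl// ltr_wpDl// sqr_ge0.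
Unshelve. all: by end_near. Qed.

Lemma sdiff_cos h y v : (2 - 2 * cos (h * y)) * cos (v * y) = sdiff h (fun v => cos (v * y)) v.
Proof. by rewrite /sdiff [(v + h) * y]mulrDl [(v - h) * y]mulrBl cosD cosB; ring. Qed.

Lemma half_angle y : 2 - 2 * cos (2 * y) = 4 * sin y ^+ 2.
Proof.
have -> : 2 * y = y *+ 2 by rewrite mulr_natl.
by rewrite cos_mulr2n sin2cos2; ring.
Qed.

End GaussianDifferences.

(** * Gaussian moments from the characteristic function *)

Section BrownianIncrements.
Context (R : realType) (d : measure_display) (Omega : measurableType d)
  (P : probability Omega R).
Implicit Types (f g : Omega -> R) (q a b c l t : R) (k j : nat).

Local Notation bnd := (@bnd R d Omega P).
Local Notation eb := (@eb R d Omega P).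
Local Notation process := (@process R d Omega).

Lemma fatou_le (f : nat -> Omega -> R) (g : Omega -> R) (c : R) :
  (forall k, measurable_fun setT (f k)) -> (forall k w, 0 <= f k w) ->
  (forall w, f k w @[k --> \oo] --> g w) ->
  (forall k, (\int[P]_w (f k w)%:E <= c%:E)%E) -> (\int[P]_w (g w)%:E <= c%:E)%E.
Proof.
move=> mf f0 fg fc.
have E w : (g w)%:E = limn_einf (fun k => (f k w)%:E).
  have h : (f k w)%:E @[k --> \oo] --> (g w)%:E by apply: cvg_EFin (fg w); exact: nearW.
  by have [-> _] := cvg_limn_einf_sup h.
under eq_integral do rewrite E.
apply: le_trans (fatou P _ _ _) _ => //.
- by move=> k; exact/measurable_EFinP.
- by move=> k w _; rewrite lee_fin.
rewrite limn_einf_lim; apply: lime_le; first exact: is_cvg_einfs.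
near=> k; apply: le_trans (fc k).
by apply: ereal_inf_lbound; exists k => /=.
Unshelve. all: by end_near. Qed.

Lemma bounded_integrable (f : Omega -> R) (M : R) : measurable_fun setT f ->
  (forall w, `|f w| <= M) -> P.-integrable setT (EFin \o f).
Proof.
move=> mf fM; have M0 (w : Omega) : 0 <= M by apply: le_trans (fM w).
apply: (@bnd_integrable _ _ _ _ 1 _ (`|M| + 1)) => //.
apply: bnd_bounded => [||//|w]; [exact: ler01|by rewrite ltr_wpDl|].
by apply: le_trans (fM w) _; rewrite (le_trans (ler_norm _))// lerDl.
Qed.

Lemma measurable_cosM (D : Omega -> R) (v : R) : measurable_fun setT D ->
  measurable_fun setT (fun w => cos (v * D w)).
Proof.
move=> mD; apply: (@measurableT_comp _ _ _ _ _ _ (@cos R)).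
  by apply: continuous_measurable_fun; exact: continuous_cos.
exact: measurable_funM.
Qed.

Lemma measurable_sin_div (D : Omega -> R) (v : R) : measurable_fun setT D ->
  measurable_fun setT (fun w => sin (D w / v)).
Proof.
move=> mD; apply: (@measurableT_comp _ _ _ _ _ _ (@sin R)).
  by apply: continuous_measurable_fun; exact: continuous_sin.
exact: measurable_funM.
Qed.

Lemma trig_integrable (D : Omega -> R) (h u : R) k : measurable_fun setT D ->
  P.-integrable setT (EFin \o (fun w => (2 - 2 * cos (h * D w)) ^+ k * cos (u * D w))).
Proof.
move=> mD.
apply: (@bounded_integrable _ (4 ^+ k)) => [|w].
  apply: measurable_funM; last exact: measurable_cosM.
  apply: measurable_funX; apply: measurable_funB => //; apply: measurable_funM => //.
  exact: measurable_cosM.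
have c1 x : `|cos x| <= 1 :> R by rewrite ler_norml cos_geN1 cos_le1.
rewrite normrM normrX -[X in _ <= X]mulr1; apply: ler_pM => //.
apply: lerXn2r; rewrite ?nnegrE//.
by have := c1 (h * D w); rewrite !ler_norml => /andP[? ?]; apply/andP; split; lra.
Qed.

(** Each factor [2 - 2 * cos (h * D)] under the expectation acts on the characteristic function as
    one [sdiff h]. *)
Lemma trig_moment (D : Omega -> R) (h : R) k v : measurable_fun setT D ->
  Rintegral P setT (fun w => (2 - 2 * cos (h * D w)) ^+ k * cos (v * D w)) =
  iter k (sdiff h) (fun v => Rintegral P setT (fun w => cos (v * D w))) v.
Proof.
move=> mD; elim: k v => [|k IH] v.
  by apply: eq_Rintegral => w _; rewrite expr0 mul1r.
have iA u : P.-integrable setT (EFin \o (fun w => (2 - 2 * cos (h * D w)) ^+ k * cos (u * D w))).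
  exact: trig_integrable.
rewrite iterS /sdiff -!IH.
rewrite -RintegralZl// -!RintegralB//=.
- apply: eq_Rintegral => w _; rewrite exprSr -mulrA sdiff_cos /sdiff; ring.
- exact: (integrableB measurableT (integrableZl measurableT 2 (iA v)) (iA (v + h))).
- exact: integrableZl (iA v).
Qed.

(* [E ((2 - 2 cos (h D))^k cos (v D))] is the k-th iterate of [sdiff h] on the characteristic
   function of [D], hence [O(h^(2k))]; then [h] tends to 0. *)
Lemma gaussian_even_moment k : exists2 B : R, 0 < B &
  forall D : Omega -> R, measurable_fun setT D ->
  (forall v, (\int[P]_w (cos (v * D w))%:E = (expR (- v ^+ 2 / 2))%:E)%E) ->
  (\int[P]_w (D w ^+ (2 * k))%:E <= B%:E)%E.
Proof.
have [B HB] := gder_bounded R.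
exists (`|B (2 * k)%N| + 1) => [|D mD hD]; first by rewrite ltr_wpDl.
apply: (@fatou_le (fun j w => (sin (D w / j.+1%:R) * j.+1%:R) ^+ (2 * k))).
- move=> j; apply: measurable_funX; apply: measurable_funM => //.
  exact: measurable_sin_div.
- by move=> j w; rewrite exprM exprn_ge0// sqr_ge0.
- move=> w; apply: (@cvg_comp _ _ _ (fun j : nat => sin (D w / j.+1%:R) * j.+1%:R)
    (fun x : R => x ^+ (2 * k))).
    exact: cvg_sin_ratio.
  exact: exprn_continuous.
move=> j; have j0 : (0 : R) < j.+1%:R by [].
(* With this step, [half_angle] turns [2 - 2 * cos (h * D)] into [4 * sin (D / (j + 1)) ^+ 2], that
   is [h ^+ 2] times the square of the bounded approximation of [D]. *)
set h : R := 2 / j.+1%:R.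
have h0 : 0 < h by rewrite /h divr_gt0.
have E w : (sin (D w / j.+1%:R) * j.+1%:R) ^+ (2 * k) =
   (h ^+ (2 * k))^-1 * ((2 - 2 * cos (h * D w)) ^+ k * cos (0 * D w)).
  rewrite mul0r cos0 mulr1 !exprM -exprVn -exprMn; congr (_ ^+ k).
  rewrite (_ : h * D w = 2 * (D w / j.+1%:R)); last by rewrite /h mulrAC mulrA.
  by rewrite half_angle /h; field; rewrite gt_eqF.
have phiE : (fun v => Rintegral P setT (fun w => cos (v * D w))) = gder 0.
  by apply/funext => v; rewrite gder0 /Rintegral hD.
under eq_integral do rewrite E EFinM.
have iT : P.-integrable setT (EFin \o (fun w => (2 - 2 * cos (h * D w)) ^+ k * cos (0 * D w))).
  exact: trig_integrable.
rewrite integralZl// -[integral _ _ _]fineK; last exact: integrable_fin_num iT.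
rewrite -EFinM lee_fin -/(Rintegral _ _ _) trig_moment// phiE.
rewrite mulrC ler_pdivrMr ?exprn_gt0//.
have := @iter_sdiff_bound R h _ _ (@is_derive_gder R) HB k 0 0.
move=> /(le_trans (ler_norm _)) /le_trans; apply; rewrite add0n mulrC ler_wpM2r ?exprn_ge0 ?(ltW h0)//.
by rewrite (le_trans (ler_norm _))// lerDl.
Qed.

(** The exponent is raised to an even integer. The constant [B + 1] is at least 1, hence its power
    [2 * k] exceeds the moment bound [B] and no root is taken. It serves all standard Gaussian
    variables at once. *)
Lemma gaussian_bnd (q : R) : 1 <= q -> exists2 C : R, 0 < C &
  forall D : Omega -> R, measurable_fun setT D ->
  (forall v, (\int[P]_w (cos (v * D w))%:E = (expR (- v ^+ 2 / 2))%:E)%E) ->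
  bnd q D C.
Proof.
move=> q1; pose k := Num.bound q; have q0 : 0 < q by apply: lt_le_trans q1.
have kq : q <= k%:R by apply/ltW/archi_boundP/ltW.
have k0 : (0 < k)%N by rewrite -(ltr_nat R); apply: lt_le_trans kq.
have qk : q <= (2 * k)%:R by apply: le_trans kq _; rewrite ler_nat leq_pmull.
have [B B0 HB] := gaussian_even_moment k.
have C0 : 0 < B + 1 by rewrite addr_gt0.
exists (B + 1) => // D mD hD; apply: (bnd_exponent q0 qk); split => //.
have E w : ((powR (`|D w| / (B + 1)) (2 * k)%:R)%:E =
   ((B + 1) ^- (2 * k))%:E * (D w ^+ (2 * k))%:E)%E.
  rewrite powR_mulrn ?divr_ge0 ?(ltW C0)// -EFinM; congr EFin.
  by rewrite expr_div_n mulrC; congr (_ * _); rewrite exprM real_normK ?num_real// -exprM.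
under eq_integral do rewrite E.
rewrite ge0_integralZl//.
- apply: (@le_trans _ _ (((B + 1) ^- (2 * k))%:E * B%:E)%E).
    by apply: lee_wpmul2l; [rewrite lee_fin invr_ge0 exprn_ge0 ?(ltW C0)|exact: HB].
  rewrite -EFinM lee_fin mulrC ler_pdivrMr ?exprn_gt0// mul1r.
  apply: (@le_trans _ _ (B + 1)); first by rewrite lerDl.
  by rewrite -[X in X <= _]expr1 ler_weXn2l// ?muln_gt0 ?k0// lerDr ltW.
- by apply/measurable_EFinP; exact: measurable_funX.
- by move=> w _; rewrite lee_fin exprM exprn_ge0// sqr_ge0.
- by rewrite lee_fin invr_ge0 exprn_ge0 ?(ltW C0).
Qed.

End BrownianIncrements.

(** * Centering and correlations of Brownian increments *)

Section ConditionalCentering.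
Context (R : realType) (d : measure_display) (Omega : measurableType d)
  (P : probability Omega R).
Implicit Types (f g : Omega -> R) (q a b c l t : R) (k j : nat).

Local Notation bnd := (@bnd R d Omega P).
Local Notation eb := (@eb R d Omega P).
Local Notation process := (@process R d Omega).

Definition rv_in (G : set (set Omega)) (g : Omega -> R) :=
  forall B : set R, measurable B -> G (g @^-1` B).

(* On the level sets of a discretization of [g] the product is a multiple of [D]. *)
Lemma orthogonal_of_null (G : set (set Omega)) (D g : Omega -> R) c a :
  sigma_algebra setT G -> G `<=` measurable -> bnd 2 D c -> bnd 2 g a -> rv_in G g ->
  (forall A, G A -> (\int[P]_(w in A) (D w)%:E = 0)%E) -> eb (fun w => g w * D w) 0.
Proof.
move=> sG Gm Dc ga Gg D0; have mD := bnd_meas Dc; have mg := bnd_meas ga.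
have q2 : 1 <= 2 :> R by rewrite ler1n.
have h21 (f : Omega -> R) b : bnd 2 f b -> bnd (2 * 1) f b by rewrite mulr1.
have igD : P.-integrable setT (EFin \o (fun w => g w * D w)).
  exact: bnd_integrable (lexx 1) (bndM ltr01 (h21 _ _ ga) (h21 _ _ Dc)).
have idom : P.-integrable setT (EFin \o (fun w => (`|g w| + 1) * `|D w|)).
  have b1 : bnd 2 (fun _ : Omega => 1 : R) 1 by apply: bnd_bounded => // w; rewrite normr1.
  apply: (bnd_integrable (lexx 1)); apply: (bndM ltr01).
    by apply: h21; apply: (bndD q2 _ b1); exact: bnd_norm ga.
  by apply: h21; exact: bnd_norm Dc.
pose B k (z : int) : set R := `[z%:~R / k.+1%:R, (z + 1)%:~R / k.+1%:R[%classic.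
have BE k z x : B k z x <-> Num.floor (k.+1%:R * x) = z.
  have k0 : (0 : R) < k.+1%:R by [].
  rewrite /B /= in_itv /= ler_pdivrMr// ltr_pdivlMr// mulrC.
  by split=> [/floor_def|<-//]; rewrite ?floor_itv.
(* Level sets of the rounded [g], enumerated by natural numbers. With [pickle_inv] each integer has
   a single code, so that the sets are disjoint; other codes give the empty set. *)
pose E k (j : nat) : set Omega := if (pickle_inv j : option int) is Some z then g @^-1` (B k z) else set0.
have GE k j : G (E k j).
  by rewrite /E; case: pickle_inv => [z|]; [by apply: Gg; exact: measurable_itv|by case: sG].
have UE k : \bigcup_j E k j = setT.
  rewrite -subTset => w _; exists (pickle (Num.floor (k.+1%:R * g w))); first exact: Logic.I.
  by rewrite /E pickleK_inv /=; apply/BE.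
pose h k w := (Num.floor (k.+1%:R * g w))%:~R / k.+1%:R * D w.
have mh k : measurable_fun setT (h k).
  apply: measurable_funM => //; apply: measurable_funM => //.
  rewrite -(UE k); apply/measurable_fun_bigcup => [j|j]; first exact: Gm.
  pose r : R := if (pickle_inv j : option int) is Some z then z%:~R else 0.
  apply: (@eq_measurable_fun _ _ _ _ (E k j) (fun=> r)); last exact: measurable_cst.
  by move=> w; rewrite inE /E /r; case: pickle_inv => // z /= /BE ->.
have flb k w := floor_approx k (g w).
have hdom k w : `|h k w| <= (`|g w| + 1) * `|D w|.
  rewrite normrM ler_wpM2r//.
  have -> : (Num.floor (k.+1%:R * g w))%:~R / k.+1%:R =
     g w - (g w - (Num.floor (k.+1%:R * g w))%:~R / k.+1%:R) by rewrite subKr.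
  apply: le_trans (ler_normB _ _) _; rewrite lerD2l (le_trans (flb k w))//.
  by rewrite invf_le1// ler1n.
have ih k : P.-integrable setT (EFin \o h k).
  apply: le_integrable idom => //; first exact/measurable_EFinP.
  by move=> w _ /=; rewrite lee_fin; apply: le_trans (hdom k w) _; exact: ler_norm.
have h0 k : (\int[P]_w (h k w)%:E = 0)%E.
  have TE : trivIset setT (E k).
    move=> i j _ _; rewrite /E => -[w []].
    case Ei : (pickle_inv i : option int) => [z|]//; case Ej : (pickle_inv j : option int) => [z'|]// /BE zE /BE z'E.
    have zz' : z = z' by rewrite -zE -z'E.
    have := @pickle_invK int i; have := @pickle_invK int j.
    by rewrite Ei Ej /= zz' => -> .
  rewrite -(UE k) (integral_bigcup TE); [|by move=> j; apply/Gm/GE|by rewrite UE; exact: ih].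
  rewrite eseries0// => j _ _.
  have := D0 _ (GE k j); have := Gm _ (GE k j); rewrite /E.
  case: pickle_inv => [z|] mE; last by rewrite integral_set0.
  have iD : P.-integrable (g @^-1` B k z) (EFin \o D).
    by apply: integrableS (bnd_integrable q2 Dc).
  move=> DE0; transitivity (\int[P]_(w in g @^-1` B k z) ((z%:~R / k.+1%:R)%:E * (D w)%:E))%E.
    by apply: eq_integral => w; rewrite inE /= => /BE zE; rewrite /h zE EFinM.
  by rewrite integralZl// DE0 mule0.
split=> //.
have cv := @dominated_cvg _ _ _ P setT measurableT (fun k w => (h k w)%:E)
  (fun w => (g w * D w)%:E) (fun w => ((`|g w| + 1) * `|D w|)%:E).
have {cv} : (\int[P]_w (h k w)%:E)%E @[k --> \oo] --> (\int[P]_w (g w * D w)%:E)%E.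
  apply: cv => //.
  - by move=> k; exact/measurable_EFinP.
  - move=> w _; apply: cvg_EFin; first exact: nearW.
    apply: cvgMr_tmp; apply/cvgrPdist_le => e e0; near=> k.
    apply: le_trans (flb k w) _; near: k.
    by apply: filterS (near_infty_natSinv_lt (PosNum e0)) => k /= /ltW.
  - by move=> k w _; rewrite lee_fin.
under eq_fun do rewrite h0.
move=> /(@cvg_lim _ (@ereal_hausdorff R)); rewrite lim_cst; last exact: ereal_hausdorff.
by rewrite /Rintegral => <-; rewrite normr0.
Unshelve. all: by end_near. Qed.

(** The approximations [sin (D / N) * N] have integral 0 over [A] and are dominated by [|D|]. *)
Lemma null_of_sin_null (D : Omega -> R) q c A : measurable A -> 1 <= q -> bnd q D c ->
  (forall v, (\int[P]_(w in A) (sin (v * D w))%:E = 0)%E) ->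
  (\int[P]_(w in A) (D w)%:E = 0)%E.
Proof.
move=> mA q1 Dc S0; have mD := bnd_meas Dc.
have iD : P.-integrable A (EFin \o D).
  by apply: integrableS (bnd_integrable q1 Dc).
pose f k w := sin (D w / k.+1%:R) * k.+1%:R.
have msin k := measurable_sin_div k.+1%:R mD.
have mf k : measurable_fun setT (f k) by apply: measurable_funM.
have fD k w : `|f k w| <= `|D w|.
  rewrite /f normrM; apply: le_trans (ler_wpM2r _ (abs_sin_le _)) _ => //.
  by rewrite normrM -mulrA -normrM mulVf// normr1 mulr1.
have f0 k : (\int[P]_(w in A) (f k w)%:E = 0)%E.
  rewrite /f; under eq_integral do rewrite EFinM muleC.
  rewrite integralZl//.
    under eq_integral do rewrite mulrC.
    by rewrite S0 mule0.
  apply: integrableS (@bounded_integrable _ _ _ P (fun w => sin (D w / k.+1%:R)) 1 (msin k) _) => //.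
  by move=> w; rewrite ler_norml sin_geN1 sin_le1.
have cv := @dominated_cvg _ _ _ P A mA (fun k w => (f k w)%:E)
  (fun w => (D w)%:E) (fun w => (`|D w|)%:E).
have {cv} : (\int[P]_(w in A) (f k w)%:E)%E @[k --> \oo] --> (\int[P]_(w in A) (D w)%:E)%E.
  apply: cv => //.
  - by move=> k; apply: measurable_funTS; exact/measurable_EFinP.
  - by move=> w _; apply: cvg_EFin; [exact: nearW|exact: cvg_sin_ratio].
  - exact: integrable_norm iD.
  - by move=> k w _; rewrite lee_fin.
under eq_fun do rewrite f0.
by move=> /(@cvg_lim _ (@ereal_hausdorff R)); rewrite lim_cst; last exact: ereal_hausdorff.
Qed.

Section Increments.
Variables (n : nat) (F : R -> set (set Omega)) (W : R -> Omega -> 'rV[R]_n).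
Hypotheses (filF : filtration F) (bmW : brownian P F W).

Definition incr (i : 'I_n) (s t : R) w := W t w ord0 i - W s w ord0 i.

Lemma rv_meas_in (G : set (set Omega)) (Y : Omega -> 'rV[R]_n) i :
  rv_meas G Y -> rv_in G (fun w => Y w ord0 i).
Proof. by move=> h B mB; exact: h. Qed.

Lemma measurable_rv_in (G : set (set Omega)) (g : Omega -> R) :
  G `<=` measurable -> rv_in G g -> measurable_fun setT g.
Proof. by move=> Gm h _ B mB; rewrite setTI; apply/Gm/h. Qed.

Lemma measurable_brownian t i : 0 <= t -> measurable_fun setT (fun w => W t w ord0 i).
Proof.
move=> t0; case: filF => /(_ t t0) [_ Ft] _; case: bmW => _ [_ [mW _]].
exact: (measurable_rv_in Ft (rv_meas_in _ (mW t t0))).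
Qed.

Lemma measurable_incr i s t : 0 <= s -> s <= t -> measurable_fun setT (incr i s t).
Proof.
by move=> s0 st; apply: measurable_funB; apply: measurable_brownian => //; exact: le_trans st.
Qed.

Lemma dotv_delta (v : R) (i : 'I_n) (x : 'rV[R]_n) :
  dotv (v *: delta_mx ord0 i) x = v * x ord0 i.
Proof.
rewrite /dotv (bigD1 i)//= big1 => [|j ji]; rewrite !mxE ?eqxx ?mulr1 ?addr0//.
by rewrite (negbTE ji) !mulr0 mul0r.
Qed.

Lemma enorm_delta (v : R) (i : 'I_n) : enorm (v *: delta_mx ord0 i : 'rV[R]_n) ^+ 2 = v ^+ 2.
Proof.
by rewrite /enorm dotv_delta !mxE !eqxx mulr1 -expr2 sqrtr_sqr real_normK ?num_real.
Qed.

Lemma incr_law i s t (v : R) : 0 <= s -> s < t ->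
  (\int[P]_w (cos (v * (incr i s t w / Num.sqrt (t - s))))%:E = (expR (- v ^+ 2 / 2))%:E)%E.
Proof.
move=> s0 st; case: bmW => _ [_ [_ /(_ s t setT)]].
have ts : 0 < t - s by rewrite subr_gt0.
have sq0 : 0 < Num.sqrt (t - s) by rewrite sqrtr_gt0.
move=> /(_ ((v / Num.sqrt (t - s)) *: delta_mx ord0 i) s0 (ltW st)) [].
  case: filF => /(_ s s0) [[F0 FC _] _] _.
  by have := FC _ F0; rewrite setD0.
move=> h _; move: h; rewrite enorm_delta.
have -> : - (v / Num.sqrt (t - s)) ^+ 2 * (t - s) / 2 = - v ^+ 2 / 2.
  by rewrite expr_div_n sqr_sqrtr ?ltW//; field; rewrite gt_eqF.
rewrite [X in (X * _)%E](_ : _ = 1%E) ?mul1e; last exact: probability_setT.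
move=> <-; apply: eq_integral => w _; rewrite dotv_delta /incr !mxE.
by congr (cos _)%:E; rewrite mulrAC mulrA.
Qed.

Lemma incr_bnd q : 1 <= q -> exists2 C : R, 0 < C &
  forall s t i, 0 <= s -> s < t -> bnd q (incr i s t) (C * Num.sqrt (t - s)).
Proof.
move=> q1; have q0 : 0 <= q by apply: le_trans q1.
have [C C0 HC] := gaussian_bnd P q1; exists C => // s t i s0 st.
have ts : 0 < t - s by rewrite subr_gt0.
have sq0 : 0 < Num.sqrt (t - s) by rewrite sqrtr_gt0.
have mi := measurable_incr i s0 (ltW st).
have mi' : measurable_fun setT (fun w => incr i s t w / Num.sqrt (t - s)).
  exact: measurable_funM.
have := bndZ q0 (HC _ mi' (fun v => incr_law i v s0 st)) (_ : `|Num.sqrt (t - s)| <= _) sq0.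
rewrite gtr0_norm// mulrC => /(_ (lexx _)); congr bnd.
by apply/funext => w; rewrite mulrC divfK ?gt_eqF.
Qed.

(** The sine part of the conditional characteristic function vanishes on every event of [F s], so
    the increment has integral 0 there and is orthogonal to all square-integrable variables
    measurable for [F s]. *)
Lemma incr_centered i s t (g : Omega -> R) a : 0 <= s -> s <= t ->
  rv_in (F s) g -> bnd 2 g a -> eb (fun w => g w * incr i s t w) 0.
Proof.
move=> s0; rewrite le_eqVlt => /predU1P[<- _ _|st gs ga].
  under eq_fun do rewrite /incr subrr mulr0.
  exact: eb0.
have [sF Fm] := filF.1 s s0.
have q2 : 1 <= 2 :> R by rewrite ler1n.
have [C C0 HC] := incr_bnd q2.
apply: (orthogonal_of_null sF Fm (HC s t i s0 st) ga gs) => A FA.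
apply: (null_of_sin_null (Fm _ FA) q2 (HC s t i s0 st)) => v.
case: bmW => _ [_ [_ /(_ s t A (v *: delta_mx ord0 i) s0 (ltW st) FA) [_ h]]].
rewrite -[RHS]h; apply: eq_integral => w _; rewrite dotv_delta /incr !mxE//.
Qed.

Lemma brownian_bnd2 t i : 0 <= t -> exists a, bnd 2 (fun w => W t w ord0 i) a.
Proof.
have q2 : 1 <= 2 :> R by rewrite ler1n.
have W0 w : W 0 w ord0 i = 0 by case: bmW => -> _; rewrite mxE.
rewrite le_eqVlt => /predU1P[<-|t0].
  by exists 1; apply: bnd_bounded => // [|w]; [exact: measurable_brownian|rewrite W0 normr0].
have [C C0 HC] := incr_bnd q2.
exists (C * Num.sqrt (t - 0)); have := HC 0 t i (lexx 0) t0; congr bnd.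
by apply/funext => w; rewrite /incr W0 subr0.
Qed.

(** The time [r] may lie before, inside or after [[s, t]]. In each case [W_r] times the increment is
    split into centered products and at most one product of increments over a common subinterval,
    which Cauchy-Schwarz bounds by its length. *)
Lemma brownian_incr_corr : exists2 C : R, 0 < C & forall (r s t : R) (i j : 'I_n), 0 <= r -> 0 <= s -> s < t ->
  eb (fun w => W r w ord0 j * incr i s t w) (C * (t - s)).
Proof.
have q2 : 1 <= 2 :> R by rewrite ler1n.
have [C C0 HC] := incr_bnd q2.
exists (C ^+ 2) => [|r s t i j r0 s0 st]; first by rewrite exprn_gt0.
have t0 : 0 <= t by rewrite (le_trans s0)// ltW.
have ts : 0 <= C ^+ 2 * (t - s) by rewrite mulr_ge0 ?sqr_ge0// subr_ge0 ltW.
have FW r' (k : 'I_n) : 0 <= r' -> rv_in (F r') (fun w => W r' w ord0 k).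
  by move=> r'0; case: bmW => _ [_ [/(_ r' r'0) mW _]]; exact: rv_meas_in.
have sq u v : 0 <= u -> u < v -> eb (fun w => incr j u v w * incr i u v w) (C ^+ 2 * (v - u)).
  move=> u0 uv; have h (k' : 'I_n) : bnd (2 * 1) (incr k' u v) (C * Num.sqrt (v - u)).
    by rewrite mulr1; exact: HC.
  apply: eb_le (eb_bnd (lexx 1) (bndM ltr01 (h j) (h i))).
  by rewrite mulrACA -!expr2 sqr_sqrtr// subr_ge0 ltW.
have [aj Waj] := brownian_bnd2 j r0.
have [as_ Was] := brownian_bnd2 j s0.
have [rs|sr] := leP r s.
  apply: (eb_le ts); apply: (incr_centered i s0 (ltW st) _ Waj) => B mB.
  by apply: (filF.2 r s r0 rs); exact: FW.
have [rt|tr] := leP r t.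
  have e1 := incr_centered i r0 rt (FW r j r0) Waj.
  have e2 := incr_centered i s0 (ltW sr) (FW s j s0) Was.
  have := ebD e1 (ebD e2 (sq s r s0 sr)); rewrite !add0r.
  rewrite (_ : (fun w => _) = (fun w => W r w ord0 j * incr i s t w)).
    by apply: eb_le; rewrite ler_wpM2l ?sqr_ge0// lerB.
  by apply/funext => w; rewrite /incr; ring.
have [at_ Wat] := brownian_bnd2 i t0.
have [asi Wasi] := brownian_bnd2 i s0.
have e1 := incr_centered j t0 (ltW tr) (FW t i t0) Wat.
have rvs : rv_in (F t) (fun w => W s w ord0 i).
  by move=> B mB; apply: (filF.2 s t s0 (ltW st)); exact: FW.
have e2 := incr_centered j t0 (ltW tr) rvs Wasi.
have e3 := incr_centered i s0 (ltW st) (FW s j s0) Was.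
have n1 : `|-1 : R| <= 1 by rewrite normrN normr1.
have := ebD (ebD e1 (ebZ e2 n1)) (ebD e3 (sq s t s0 st)); rewrite mulr0 !add0r.
by congr eb; apply/funext => w; rewrite /incr; ring.
Qed.

End Increments.
End ConditionalCentering.

(** * Directional derivatives of smooth functions are linear in the direction *)

Section DirectionalDerivatives.
Variables (R : realType) (V : normedModType R).
Implicit Types (f : V -> R) (a h u v : V).

Lemma iterD_cat (W : normedModType R) (f : V -> W) vs ws :
  iterD ws (iterD vs f) = iterD (ws ++ vs) f.
Proof. by elim: ws => //= w ws ->. Qed.

Lemma smooth_iterD (W : normedModType R) (f : V -> W) vs : smooth f -> smooth (iterD vs f).
Proof. by move=> sf ws; rewrite iterD_cat. Qed.

Lemma smooth_derive (W : normedModType R) (f : V -> W) v :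
  smooth f -> smooth (fun a => 'D_v f a).
Proof. exact: (@smooth_iterD _ f [:: v]). Qed.

Lemma smooth_continuous (W : normedModType R) (f : V -> W) : smooth f -> continuous f.
Proof. by move=> /(_ [::]) []. Qed.

Lemma is_derive_line f a h (r : R) : smooth f ->
  is_derive r 1 (fun r => f (a + r *: h)) ('D_h f (a + r *: h)).
Proof.
move=> sf; have E : (fun s : R => s^-1 *: ((fun r => f (a + r *: h)) (s *: 1 + r) - f (a + r *: h))) =
    (fun s => s^-1 *: (f (s *: h + (a + r *: h)) - f (a + r *: h))).
  apply/funext => s; congr (_ *: (f _ - _)).
  by rewrite scalerDl [s *: 1]mulr1 addrCA.
have [_ df] := sf [::]; have := df h (a + r *: h).
rewrite /derivable /= => dh; apply: DeriveDef; first by rewrite /derivable /= E.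
by rewrite /derive /= E.
Qed.

Lemma MVT_dir f a h : smooth f ->
  exists2 c : R, f (a + h) - f a = 'D_h f (a + c *: h) & `|c| <= 1.
Proof.
move=> sf; have [c] := MVT_line 0 1 (fun r => is_derive_line a h r sf).
rewrite scale1r scale0r addr0 !subr0 mulr1 normr1 => E c1.
by exists c.
Qed.

Lemma derive_dirZ f (k : R) h a : smooth f -> 'D_(k *: h) f a = k * 'D_h f a.
Proof.
move=> sf.
have d1 := is_derive_line a (k *: h) 0 sf; rewrite scale0r addr0 in d1.
have d2 := is_derive_line a h (k * 0) sf; rewrite mulr0 scale0r addr0 in d2.
have d3 : is_derive (0 : R) 1 (fun r : R => k * r) k.
  by apply: is_derive_eq; rewrite /GRing.scale /=; ring.
have d2' : is_derive (k * 0) 1 (fun r : R => f (a + r *: h)) ('D_h f a) by rewrite mulr0.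
have d4 := @is_derive1_comp R (fun r => f (a + r *: h)) (fun r : R => k * r) 0 _ _ d2' d3.
have E : (fun r => f (a + r *: h)) \o (fun r : R => k * r) = (fun r => f (a + r *: (k *: h))).
  by apply/funext => r /=; rewrite scalerA mulrC.
rewrite E in d4; rewrite mulrC.
by rewrite -(@derive_val _ _ _ _ _ _ _ d1) (@derive_val _ _ _ _ _ _ _ d4).
Qed.

(** [smooth] speaks of each direction separately, so additivity needs a proof. The quotient along
    [u + v] is the quotient along [u] at [a] plus the one along [v] at [a + r u]; by the mean value
    theorem the latter is ['D_v f] at a point tending to [a], and this derivative is continuous. *)
Lemma derive_dirD f u v a : smooth f -> 'D_(u + v) f a = 'D_u f a + 'D_v f a.
Proof.
move=> sf; have [_ df] := sf [::].
have c1 : (fun r : R => r^-1 *: (f (r *: u + a) - f a)) @ 0^' --> 'D_u f a by exact: df.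
have c2 : (fun r : R => r^-1 *: (f (r *: (u + v) + a) - f (r *: u + a))) @ 0^' --> 'D_v f a.
  have cD : continuous (fun a => 'D_v f a) by apply: smooth_continuous; exact: smooth_derive.
  apply/cvgrPdist_le => e e0.
  have [d d0 hd] : exists2 d : R, 0 < d & forall y, `|y - a| < d -> `|'D_v f a - 'D_v f y| <= e.
    have /cvgrPdist_le /(_ e e0) /nbhs_normP [d /= d0 hd] := cD a.
    by exists d => // y ya; apply: hd; rewrite /ball_ /= distrC.
  pose m := `|u| + `|v| + 1; have m0 : 0 < m by rewrite ltr_wpDl// addr_ge0.
  have dm : 0 < d / m by rewrite divr_gt0.
  near=> r.
  have r0 : r != 0 by near: r; exact: nbhs_dnbhs_neq.
  have rd : `|r| < d / m.
    near: r; apply: nbhs_dnbhs; have := @nbhsx_ballx R R 0 _ dm; apply: filterS => z.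
    by rewrite /ball /= sub0r normrN.
  have [c E c1'] := MVT_dir (r *: u + a) (r *: v) sf.
  rewrite (_ : r *: (u + v) + a = r *: u + a + r *: v); last by rewrite scalerDr addrAC.
  rewrite E derive_dirZ// [_ *: _]mulrA mulVf// mul1r; apply: hd.
  rewrite addrAC addrK; apply: le_lt_trans (ler_normD _ _) _.
  rewrite !normrZ; apply: (@le_lt_trans _ _ (`|r| * m)); last by rewrite -ltr_pdivlMr.
  rewrite mulrDr mulr1 mulrDr -addrA lerD2l; apply: (@le_trans _ _ (`|r| * `|v|)); last by rewrite lerDl.
  by rewrite ler_piMl// mulr_ge0.
have cc : (fun r : R => r^-1 *: (f (r *: u + a) - f a) +
    r^-1 *: (f (r *: (u + v) + a) - f (r *: u + a))) @ 0^' --> 'D_u f a + 'D_v f a.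
  exact: cvgD c1 c2.
have E : (fun r : R => r^-1 *: (f (r *: u + a) - f a) +
    r^-1 *: (f (r *: (u + v) + a) - f (r *: u + a))) =
    (fun r => r^-1 *: (f (r *: (u + v) + a) - f a)).
  by apply/funext => r; rewrite -scalerDr addrC subrKA.
by rewrite E in cc; rewrite /derive; apply: cvg_lim cc.
Unshelve. all: by end_near. Qed.

Lemma derive_dir0 f a : smooth f -> 'D_0 f a = 0.
Proof. by move=> sf; have := derive_dirZ 0 0 a sf; rewrite scale0r mul0r. Qed.

Lemma derive_dir_sum f a (I : Type) (r : seq I) (h : I -> V) : smooth f ->
  'D_(\sum_(i <- r) h i) f a = \sum_(i <- r) 'D_(h i) f a.
Proof.
move=> sf; elim: r => [|i r IH]; first by rewrite !big_nil derive_dir0.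
by rewrite !big_cons derive_dirD// IH.
Qed.

End DirectionalDerivatives.

(** * Uniform Taylor bounds for periodic functions *)

Section TorusFunctions.
Variables (R : realType) (n : nat).
Notation E := ('rV[R]_n * R)%type.
Implicit Types (f g : E -> R) (z h : E) (t S K : R).

Definition l1 (x : 'rV[R]_n) : R := \sum_j `|x ord0 j|.
Definition dist1 h : R := l1 h.1 + `|h.2|.

Lemma l1_ge0 x : 0 <= l1 x. Proof. exact: sumr_ge0. Qed.
Lemma dist1_ge0 h : 0 <= dist1 h. Proof. by rewrite addr_ge0 ?l1_ge0. Qed.

Lemma l1Z (c : R) x : l1 (c *: x) = `|c| * l1 x.
Proof. by rewrite /l1 mulr_sumr; apply: eq_bigr => j _; rewrite mxE normrM. Qed.

Lemma dist1Z (c : R) h : dist1 (c *: h) = `|c| * dist1 h.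
Proof. by rewrite /dist1 /= l1Z normrM -mulrDr. Qed.

Definition ex (j : 'I_n) : E := (delta_mx ord0 j, 0).
Definition et : E := (0, 1).

Lemma derive_coord f z h : smooth f ->
  'D_h f z = \sum_j h.1 ord0 j * 'D_(ex j) f z + h.2 * 'D_et f z.
Proof.
move=> sf.
have hE : h = \sum_j h.1 ord0 j *: ex j + h.2 *: et.
  have s1 (r : seq 'I_n) : (\sum_(j <- r) h.1 ord0 j *: ex j) =
     (\sum_(j <- r) h.1 ord0 j *: delta_mx ord0 j, 0).
    elim: r => [|j r IH]; first by rewrite !big_nil.
    rewrite !big_cons IH; congr (_, _) => /=.
    by rewrite scaler0 addr0.
  rewrite s1 -row_sum_delta; case: h {s1} => x s /=; congr (_, _) => /=.
    by rewrite scaler0 addr0.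
  by rewrite add0r [s *: 1]mulr1.
rewrite {1}hE derive_dirD// derive_dir_sum// derive_dirZ//.
by congr (_ + _); apply: eq_bigr => j _; rewrite derive_dirZ.
Qed.

Definition periodic1 f := forall y t (k : 'rV[int]_n), f (y + intvec R k, t) = f (y, t).

Lemma periodic1_derive f h : periodic1 f -> periodic1 (fun z => 'D_h f z).
Proof.
move=> pf y t k.
have E : (fun s : R => s^-1 *: (f (s *: h + (y + intvec R k, t)) - f (y + intvec R k, t))) =
         (fun s => s^-1 *: (f (s *: h + (y, t)) - f (y, t))).
  apply/funext => s; rewrite pf; congr (_ *: (_ - _)).
  by rewrite -(pf (s *: h.1 + y) _ k) -addrA.
by rewrite /derive E.
Qed.

(** An integer translation moves the position into the unit cube, and the cube times [[- S, S]] is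
    compact. *)
Lemma periodic1_bounded f S : smooth f -> periodic1 f ->
  exists2 K : R, 0 < K & forall z, `|z.2| <= S -> `|f z| <= K.
Proof.
move=> sf pf; have cf := smooth_continuous sf.
pose A : set E := [set v : 'rV[R]_n | forall i, `[0, 1]%classic (v ord0 i)] `*` `[- S, S]%classic.
have cA : compact A.
  apply: compact_setX; last exact: segment_compact.
  exact: (@rV_compact R n (fun=> [set` `[(0 : R), 1]]) (fun=> @segment_compact R 0 1)).
have /compact_bounded [M [Mr HM]] : compact (f @` A).
  by apply: continuous_compact => //; apply: continuous_subspaceT.
exists (`|M| + 1) => [|[y t] /= tS]; first by rewrite ltr_wpDl.
pose k : 'rV[int]_n := \row_i (- Num.floor (y ord0 i)).
rewrite -(pf y t k); apply: (HM (`|M| + 1)).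
  by rewrite (le_lt_trans (ler_norm _))// ltrDl.
exists (y + intvec R k, t) => //; split => /=.
  move=> i; rewrite !mxE in_itv /= mulrNz.
  have := floor_itv (y ord0 i); rewrite intrD => /andP[h1 h2].
  by rewrite subr_ge0 h1 lerBlDr addrC ltW.
by rewrite in_itv /= -ler_norml.
Qed.

Lemma smooth_lipschitz f S : smooth f -> periodic1 f -> exists2 K : R, 0 < K &
  forall z h, `|z.2| <= S -> `|h.2| <= S -> `|f (z + h) - f z| <= K * dist1 h.
Proof.
move=> sf pf.
have [K1 K10 HK1] : exists2 K1 : R, 0 < K1 &
    (* The segment from [z] to [z + h] may reach times up to [S + S] in absolute value. *)
    forall z j, `|z.2| <= S + S -> `|'D_(ex j) f z| <= K1.
  have hj j : exists K1 : R, 0 < K1 /\ forall z, `|z.2| <= S + S -> `|'D_(ex j) f z| <= K1.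
    have [K K0 HK] := @periodic1_bounded (fun z => 'D_(ex j) f z) (S + S)
      (smooth_derive _ sf) (periodic1_derive _ pf).
    by exists K.
  have [K HK] := choice hj.
  exists (\sum_j K j + 1) => [|z j zS].
    by rewrite ltr_wpDl// sumr_ge0// => j _; apply: ltW; exact: (HK j).1.
  apply: le_trans ((HK j).2 z zS) _; rewrite (bigD1 j)//= -addrA lerDl.
  by rewrite addr_ge0// sumr_ge0// => i _; apply: ltW; exact: (HK i).1.
have [K2 K20 HK2] := @periodic1_bounded (fun z => 'D_et f z) (S + S)
      (smooth_derive _ sf) (periodic1_derive _ pf).
exists (K1 + K2) => [|z h zS hS]; first by rewrite addr_gt0.
have [c -> c1] := MVT_dir z h sf.
have wS : `|(z + c *: h).2| <= S + S.
  apply: le_trans (ler_normD _ _) _; apply: lerD => //=.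
  rewrite normrM; apply: le_trans hS; rewrite -[X in _ <= X]mul1r ler_wpM2r//.
rewrite derive_coord// /dist1 mulrDr; apply: le_trans (ler_normD _ _) _; apply: lerD.
  apply: le_trans (ler_norm_sum _ _ _) _; rewrite /l1 mulr_sumr; apply: ler_sum => j _.
  rewrite normrM mulrC ler_wpM2r//; apply: le_trans (HK1 _ _ wS) _.
  by rewrite lerDl ltW.
rewrite normrM mulrC ler_wpM2r//; apply: le_trans (HK2 _ wS) _.
by rewrite lerDr ltW.
Qed.

(* Unlike [smooth], this is easily seen to be closed under sums and products, which is what
   [corr] below requires. *)
Definition taylor2 (T : R) f (fx : 'I_n -> E -> R) (ft : E -> R) := exists2 K : R, 0 < K &
  (forall z, 0 <= z.2 <= T -> [/\ `|f z| <= K, forall j, `|fx j z| <= K & `|ft z| <= K]) /\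
  (forall z h, 0 <= z.2 <= T -> 0 <= (z + h).2 <= T ->
    `|f (z + h) - f z - (\sum_j h.1 ord0 j * fx j z + h.2 * ft z)| <= K * dist1 h ^+ 2).

(** By the mean value theorem along [h], the remainder is a combination of increments of first
    derivatives, which are Lipschitz. *)
Lemma taylor2_smooth T f : smooth f -> periodic1 f ->
  taylor2 T f (fun j z => 'D_(ex j) f z) (fun z => 'D_et f z).
Proof.
move=> sf pf.
have sj j := smooth_derive (ex j) sf; have st := smooth_derive et sf.
have pj j := periodic1_derive (ex j) pf; have pt := periodic1_derive et pf.
have [K0 K00 HK0] := periodic1_bounded T sf pf.
have [Kt Kt0 HKt] := periodic1_bounded T st pt.
have [Lt Lt0 HLt] := smooth_lipschitz T st pt.
have hj j : exists K : R, [/\ 0 < K, forall z, `|z.2| <= T -> `|'D_(ex j) f z| <= K &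
   forall z h, `|z.2| <= T -> `|h.2| <= T ->
     `|'D_(ex j) f (z + h) - 'D_(ex j) f z| <= K * dist1 h].
  have [K1 K10 HK1] := periodic1_bounded T (sj j) (pj j).
  have [L L0 HL] := smooth_lipschitz T (sj j) (pj j).
  exists (K1 + L); split=> [|z zT|z h zT hT]; first exact: addr_gt0.
    by apply: le_trans (HK1 z zT) _; rewrite lerDl ltW.
  apply: le_trans (HL z h zT hT) _; rewrite ler_wpM2r ?dist1_ge0//.
  by rewrite lerDr ltW.
have [Kj HKj] := choice hj.
have Kjsum j : Kj j <= \sum_i Kj i.
  by rewrite (bigD1 j)//= lerDl sumr_ge0// => i _; apply: ltW; case: (HKj i).
have S0 : 0 <= \sum_i Kj i.
  by apply: sumr_ge0 => i _; apply: ltW; case: (HKj i).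
pose K := K0 + Kt + Lt + \sum_i Kj i.
have KK : [/\ K0 <= K, Kt <= K, Lt <= K & \sum_i Kj i <= K] by split; rewrite /K; lra.
have [k1 k2 k3 k4] := KK.
have absT z : 0 <= z.2 <= T -> `|z.2| <= T by move=> /andP[z0 zT]; rewrite ger0_norm.
exists K; first by apply: lt_le_trans K00 k1.
split=> [z /absT zT|z h zT0 zhT0].
  split=> [|j|]; [exact: le_trans (HK0 z zT) k1| |exact: le_trans (HKt z zT) k2].
  by case: (HKj j) => _ h _; apply: le_trans (h z zT) _; exact: le_trans (Kjsum j) k4.
have zT := absT _ zT0.
have hT : `|h.2| <= T.
  move: zT0 zhT0 => /= /andP[a1 a2] /andP[a3 a4]; rewrite ler_norml; apply/andP; split; lra.
have [c -> c1] := MVT_dir z h sf.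
have chT : `|(c *: h).2| <= T.
  by rewrite /= normrM; apply: le_trans hT; rewrite -[X in _ <= X]mul1r ler_wpM2r.
have dch : dist1 (c *: h) <= dist1 h.
  by rewrite dist1Z -[X in _ <= X]mul1r ler_wpM2r ?dist1_ge0.
rewrite derive_coord//.
have -> : \sum_j h.1 ord0 j * 'D_(ex j) f (z + c *: h) + h.2 * 'D_et f (z + c *: h) -
   (\sum_j h.1 ord0 j * 'D_(ex j) f z + h.2 * 'D_et f z) =
   \sum_j h.1 ord0 j * ('D_(ex j) f (z + c *: h) - 'D_(ex j) f z) +
   h.2 * ('D_et f (z + c *: h) - 'D_et f z).
  rewrite opprD addrACA -sumrB mulrBr; congr (_ + _).
  by apply: eq_bigr => j _; rewrite mulrBr.
apply: le_trans (ler_normD _ _) _.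
rewrite expr2 {1}/dist1 mulrCA mulrDl; apply: lerD.
  apply: le_trans (ler_norm_sum _ _ _) _; rewrite /l1 mulr_suml; apply: ler_sum => j _.
  rewrite normrM ler_wpM2l//; case: (HKj j) => _ _ hL; apply: le_trans (hL z _ zT chT) _.
  apply: ler_pM => //; [by apply: ltW; case: (HKj j)|exact: dist1_ge0|].
  exact: le_trans (Kjsum j) k4.
rewrite normrM ler_wpM2l//; apply: le_trans (HLt z _ zT chT) _.
by apply: ler_pM => //; [exact: ltW|exact: dist1_ge0].
Qed.

(** For [dist1 h <= 1] the quadratic remainder is below the linear term; for larger [h] the bound on
    [f] is enough. Each case costs at most [2 * K]. *)
Lemma taylor2_lipschitz T f fx ft : taylor2 T f fx ft -> exists2 K : R, 0 < K &
  forall z h, 0 <= z.2 <= T -> 0 <= (z + h).2 <= T -> `|f (z + h) - f z| <= K * dist1 h.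
Proof.
move=> [K K0 [hb ht]]; exists (2 * K) => [|z h zT zhT]; first by rewrite mulr_gt0.
have [fz fxz ftz] := hb z zT; have [fzh _ _] := hb _ zhT.
have d0 := dist1_ge0 h.
have [d1|d1] := leP (dist1 h) 1.
  have h1 := ht z h zT zhT.
  have h2 : `|\sum_j h.1 ord0 j * fx j z + h.2 * ft z| <= K * dist1 h.
    apply: le_trans (ler_normD _ _) _; rewrite /dist1 mulrDr; apply: lerD.
      apply: le_trans (ler_norm_sum _ _ _) _; rewrite /l1 mulr_sumr; apply: ler_sum => j _.
      by rewrite normrM mulrC ler_wpM2r.
    by rewrite normrM mulrC ler_wpM2r.
  have h3 : K * dist1 h ^+ 2 <= K * dist1 h.
    by rewrite ler_wpM2l ?(ltW K0)// expr2 -[X in _ <= X]mulr1 ler_wpM2l.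
  rewrite -(subrK (\sum_j h.1 ord0 j * fx j z + h.2 * ft z) (f (z + h) - f z)).
  by apply: le_trans (ler_normD _ _) _; lra.
apply: le_trans (ler_normB _ _) _.
have : K * 1 <= K * dist1 h by rewrite ler_wpM2l ?(ltW K0)// ltW.
lra.
Qed.

Lemma taylor2D T f g fx ft gx gt : taylor2 T f fx ft -> taylor2 T g gx gt ->
  taylor2 T (fun z => f z + g z) (fun j z => fx j z + gx j z) (fun z => ft z + gt z).
Proof.
move=> [K K0 [hb ht]] [L L0 [gb gtt]]; exists (K + L); first by rewrite addr_gt0.
split=> [z zT|z h zT zhT].
  have [a1 a2 a3] := hb z zT; have [b1 b2 b3] := gb z zT.
  by split=> [|j|]; apply: le_trans (ler_normD _ _) _; apply: lerD.
rewrite mulrDl.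
have := le_trans (ler_normD _ _) (lerD (ht z h zT zhT) (gtt z h zT zhT)).
congr (`|_| <= _).
have -> : \sum_j h.1 ord0 j * (fx j z + gx j z) =
  \sum_j h.1 ord0 j * fx j z + \sum_j h.1 ord0 j * gx j z.
  by rewrite -big_split; apply: eq_bigr => j _; rewrite mulrDr.
ring.
Qed.

(** The remainder is [f] times that of [g], plus [g] times that of [f], plus the product of the
    increments, which is quadratic by the Lipschitz bounds. *)
Lemma taylor2M T f g fx ft gx gt : taylor2 T f fx ft -> taylor2 T g gx gt ->
  taylor2 T (fun z => f z * g z) (fun j z => f z * gx j z + g z * fx j z)
    (fun z => f z * gt z + g z * ft z).
Proof.
move=> tf tg; have [Lf Lf0 lf] := taylor2_lipschitz tf; have [Lg Lg0 lg] := taylor2_lipschitz tg.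
have [K K0 [hb ht]] := tf; have [L L0 [gb gtt]] := tg.
have KL := mulr_gt0 K0 L0.
exists (2 * (K * L) + Lf * Lg); first by rewrite addr_gt0 ?mulr_gt0.
have LL := mulr_gt0 Lf0 Lg0.
split=> [z zT|z h zT zhT].
  have [a1 a2 a3] := hb z zT; have [b1 b2 b3] := gb z zT.
  have pm x y u v : `|x| <= u -> `|y| <= v -> `|x * y| <= u * v :> R.
    by move=> xu yv; rewrite normrM ler_pM.
  split=> [|j|].
  - by apply: le_trans (pm _ _ _ _ a1 b1) _; lra.
  - apply: le_trans (ler_normD _ _) _.
    by have := pm _ _ _ _ a1 (b2 j); have := pm _ _ _ _ b1 (a2 j); rewrite [L * K]mulrC; lra.
  - apply: le_trans (ler_normD _ _) _.
    by have := pm _ _ _ _ a1 b3; have := pm _ _ _ _ b1 a3; rewrite [L * K]mulrC; lra.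
have [a1 _ _] := hb z zT; have [b1 _ _] := gb z zT.
have -> : \sum_j h.1 ord0 j * (f z * gx j z + g z * fx j z) =
  f z * \sum_j h.1 ord0 j * gx j z + g z * \sum_j h.1 ord0 j * fx j z.
  by rewrite !mulr_sumr -big_split; apply: eq_bigr => j _ /=; ring.
have e1 := ht z h zT zhT; have e2 := gtt z h zT zhT.
have e3 := lf z h zT zhT; have e4 := lg z h zT zhT.
move: e1 e2 e3 e4; set sf := \sum_j _ * fx j z; set sg := \sum_j _ * gx j z => e1 e2 e3 e4.
have -> : f (z + h) * g (z + h) - f z * g z -
   (f z * sg + g z * sf + h.2 * (f z * gt z + g z * ft z)) =
   f z * (g (z + h) - g z - (sg + h.2 * gt z)) + g z * (f (z + h) - f z - (sf + h.2 * ft z))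
   + (f (z + h) - f z) * (g (z + h) - g z) by ring.
apply: le_trans (ler_normD _ _) _; rewrite [X in _ <= X]mulrDl; apply: lerD.
  apply: le_trans (ler_normD _ _) _; rewrite !normrM.
  have d0 : 0 <= dist1 h ^+ 2 by rewrite exprn_ge0 ?dist1_ge0.
  have m1 := ler_pM (normr_ge0 _) (normr_ge0 _) a1 e2.
  have m2 := ler_pM (normr_ge0 _) (normr_ge0 _) b1 e1.
  by apply: le_trans (lerD m1 m2) _; apply: eq_ler; ring.
rewrite normrM; apply: le_trans (ler_pM (normr_ge0 _) (normr_ge0 _) e3 e4) _.
by apply: eq_ler; ring.
Qed.

Lemma taylor2_0 T : taylor2 T (fun=> 0) (fun _ _ => 0) (fun=> 0).
Proof.
exists 1 => //; split=> [z _|z h _ _]; first by split=> [|j|]; rewrite normr0.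
rewrite big1 ?mulr0 ?addr0 ?subr0 ?normr0 ?mul1r ?exprn_ge0 ?dist1_ge0//.
by move=> j _; rewrite mulr0.
Qed.

Lemma taylor2_sum T (I : Type) (r : seq I) (f : I -> E -> R) fx ft :
  (forall i, taylor2 T (f i) (fx i) (ft i)) ->
  taylor2 T (fun z => \sum_(i <- r) f i z) (fun j z => \sum_(i <- r) fx i j z)
    (fun z => \sum_(i <- r) ft i z).
Proof.
move=> tf; elim: r => [|i r IH].
  have := taylor2_0 T; congr taylor2; do ?[apply/funext => ?]; rewrite ?big_nil//.
have := taylor2D (tf i) IH; congr taylor2; do ?[apply/funext => ?]; rewrite ?big_cons//.
Qed.

Lemma taylor2_family T (I : finType) (f : I -> E -> R) fx ft :
  (forall i, taylor2 T (f i) (fx i) (ft i)) -> exists2 K : R, 0 < K & forall i,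
  [/\ forall z, 0 <= z.2 <= T -> [/\ `|f i z| <= K, forall j, `|fx i j z| <= K & `|ft i z| <= K],
   forall z h, 0 <= z.2 <= T -> 0 <= (z + h).2 <= T -> `|f i (z + h) - f i z| <= K * dist1 h
   & forall z h, 0 <= z.2 <= T -> 0 <= (z + h).2 <= T ->
    `|f i (z + h) - f i z - (\sum_j h.1 ord0 j * fx i j z + h.2 * ft i z)| <= K * dist1 h ^+ 2].
Proof.
move=> tf; have hK i : exists K : R, [/\ 0 < K,
   forall z, 0 <= z.2 <= T -> [/\ `|f i z| <= K, forall j, `|fx i j z| <= K & `|ft i z| <= K],
   forall z h, 0 <= z.2 <= T -> 0 <= (z + h).2 <= T -> `|f i (z + h) - f i z| <= K * dist1 h
   & forall z h, 0 <= z.2 <= T -> 0 <= (z + h).2 <= T ->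
    `|f i (z + h) - f i z - (\sum_j h.1 ord0 j * fx i j z + h.2 * ft i z)| <= K * dist1 h ^+ 2].
  have [L L0 hL] := taylor2_lipschitz (tf i); have [K K0 [hb ht]] := tf i.
  exists (K + L); split=> [|z zT|z h zT zhT|z h zT zhT]; first by rewrite addr_gt0.
  - have [a1 a2 a3] := hb z zT; have KKL : K <= K + L by rewrite lerDl ltW.
    by split=> [|j|]; apply: le_trans KKL.
  - by apply: le_trans (hL z h zT zhT) _; rewrite ler_wpM2r ?dist1_ge0// lerDr ltW.
  - apply: le_trans (ht z h zT zhT) _; rewrite ler_wpM2r ?exprn_ge0 ?dist1_ge0// lerDl ltW//.
have [K HK] := choice hK.
have K0 i : 0 <= K i by apply: ltW; case: (HK i).
have Kle i : K i <= \sum_i K i + 1.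
  by rewrite (bigD1 i)//= -addrA lerDl addr_ge0// sumr_ge0.
exists (\sum_i K i + 1) => [|i]; first by rewrite ltr_wpDl// sumr_ge0.
have [_ h1 h2 h3] := HK i; split=> [z zT|z h zT zhT|z h zT zhT].
- by have [a1 a2 a3] := h1 z zT; split=> [|j|]; apply: le_trans (Kle i).
- by apply: le_trans (h2 z h zT zhT) _; rewrite ler_wpM2r ?dist1_ge0.
- by apply: le_trans (h3 z h zT zhT) _; rewrite ler_wpM2r ?exprn_ge0 ?dist1_ge0.
Qed.

Lemma smooth_coord (b : E -> 'rV[R]_n) i : smooth b -> smooth (fun z => b z ord0 i).
Proof.
move=> sb; have itE vs : iterD vs (fun z => b z ord0 i) = (fun z => iterD vs b z ord0 i).
  elim: vs => //= v vs ->; apply/funext => z.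
  have [_ db] := sb vs; rewrite (derive_mx (db v z)) mxE//.
move=> vs; rewrite itE; have [cb db] := sb vs; split=> [z|v z].
  by apply: (@continuous_comp _ _ _ (iterD vs b) (fun x : 'rV[R]_n => x ord0 i));
    [exact: cb|exact: coord_continuous].
by have /derivable_mxP := db v z; exact.
Qed.

Lemma derive_coordE (b : E -> 'rV[R]_n) i v z : smooth b ->
  ('D_v b z) ord0 i = 'D_v (fun z => b z ord0 i) z.
Proof. by move=> sb; have [_ db] := sb [::]; rewrite (derive_mx (db v z)) mxE. Qed.

Lemma smooth_fst (phi : 'rV[R]_n -> R) : smooth phi -> smooth (fun z : E => phi z.1).
Proof.
move=> sp; have itE vs : iterD vs (fun z : E => phi z.1) = (fun z => iterD (map fst vs) phi z.1).
  by elim: vs => //= v vs ->.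
move=> vs; rewrite itE; have [cp dp] := sp (map fst vs); split=> [z|v z].
  by apply: continuous_comp; [exact: cvg_fst|exact: cp].
exact: dp v.1 z.1.
Qed.

End TorusFunctions.

(** * Orders in powers of [sqrt eps], uniform in all parameters, and Gronwall's lemma *)

Section OrderCalculus.
Context (R : realType) (n : nat) (d : measure_display) (Omega : measurableType d)
  (P : probability Omega R) (T : R).
Local Notation bnd := (@bnd R d Omega P).
Local Notation eb := (@eb R d Omega P).
Local Notation process := (@process R d Omega).

(* A parameter is a scale [eps], a second time [r] and a second index [j]; a family
   depends on a parameter, a time and an index. *)
Local Notation par := (R * R * 'I_n)%type.
Local Notation fam := (par -> R -> 'I_n -> Omega -> R).
Implicit Types (f g Y : fam) (a : par) (q t s c K : R) (k m : nat) (i j : 'I_n).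

(** With [a.1.1 < 1] the powers [sq a ^+ k] decrease in [k], so that a bound of high order implies
    those of lower order. The threshold 1 for [eps] in the theorem comes from here. *)
Definition dom a t := [/\ 0 < a.1.1, a.1.1 < 1, 0 <= a.1.2 <= T & 0 <= t <= T].
Definition sq a : R := Num.sqrt a.1.1.

Lemma dom_le a t s : dom a t -> 0 <= s -> s <= t -> dom a s.
Proof.
by case=> e0 e1 r /andP[t0 tT] s0 st; split; rewrite // s0 (le_trans st).
Qed.

Lemma sq_gt0 a t : dom a t -> 0 < sq a.
Proof. by case=> e0 _ _ _; rewrite sqrtr_gt0. Qed.
Lemma sq_le1 a t : dom a t -> sq a <= 1.
Proof. by case=> e0 e1 _ _; rewrite -sqrtr1 ler_wsqrtr// ltW. Qed.
Lemma sqX_gt0 a t k : dom a t -> 0 < sq a ^+ k.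
Proof. by move=> h; rewrite exprn_gt0// (sq_gt0 h). Qed.
Lemma sqX_le1 a t k : dom a t -> sq a ^+ k <= 1.
Proof. by move=> h; rewrite exprn_ile1// ?(sq_le1 h)// ltW// (sq_gt0 h). Qed.
Lemma sq2 a t : dom a t -> sq a ^+ 2 = a.1.1.
Proof. by case=> e0 _ _ _; rewrite sqr_sqrtr// ltW. Qed.

(* [Ob q k f]: the [L^q] norms of [f] are [O(eps^(k/2))];
   [EO k f]: the expectations of [f] are [O(eps^(k/2))]. *)
Definition Ob q k f := exists2 C : R, 0 < C &
  forall a t i, dom a t -> bnd q (f a t i) (C * sq a ^+ k).
Definition EO k f := exists2 C : R, 0 < C &
  forall a t i, dom a t -> eb (f a t i) (C * sq a ^+ k).
Definition mfam f := forall a t i, dom a t -> measurable_fun setT (f a t i).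
Definition pfam f := forall a i, (exists t, dom a t) -> process (fun s => f a s i).

Lemma Ob_mfam q k f : Ob q k f -> mfam f.
Proof. by move=> [C _ H] a t i h; exact: bnd_meas (H a t i h). Qed.

Lemma pfam_mfam f : pfam f -> mfam f.
Proof. by move=> pf a t i h; have [_] := pf a i (ex_intro _ t h); exact. Qed.

Lemma process_l1 f a : pfam f -> (exists t, dom a t) ->
  process (fun s w => \sum_j `|f a s j w|).
Proof. by move=> pf ha; apply: process_sum => j; apply: process_norm; exact: pf. Qed.

Lemma Ob_ext q k f g : (forall a t i w, dom a t -> f a t i w = g a t i w) ->
  Ob q k f -> Ob q k g.
Proof.
move=> fg [C C0 H]; exists C; [exact: C0|move=> a t i h]; have := H a t i h.
by congr bnd; apply/funext => w; exact: fg.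
Qed.

Lemma EO_ext k f g : (forall a t i w, dom a t -> f a t i w = g a t i w) ->
  EO k f -> EO k g.
Proof.
move=> fg [C C0 H]; exists C; [exact: C0|move=> a t i h]; have := H a t i h.
by congr eb; apply/funext => w; exact: fg.
Qed.

Lemma sqX_anti a t k m : dom a t -> (m <= k)%N -> sq a ^+ k <= sq a ^+ m.
Proof.
move=> h mk; rewrite -(subnK mk) exprD ler_piMl ?(ltW (sqX_gt0 _ h))//.
exact: sqX_le1 h.
Qed.

Lemma Ob_le q k m f : 0 <= q -> (m <= k)%N -> Ob q k f -> Ob q m f.
Proof.
move=> q0 mk [C C0 H]; exists C; [exact: C0|move=> a t i h]; apply: bnd_le (H a t i h) => //.
by rewrite ler_wpM2l ?(ltW C0)// (sqX_anti h).
Qed.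

Lemma EO_le k m f : (m <= k)%N -> EO k f -> EO m f.
Proof.
move=> mk [C C0 H]; exists C; [exact: C0|move=> a t i h]; apply: eb_le (H a t i h) => //.
by rewrite ler_wpM2l ?(ltW C0)// (sqX_anti h).
Qed.

Lemma Ob_exponent q p k f : 0 < q -> q <= p -> Ob p k f -> Ob q k f.
Proof.
by move=> q0 qp [C C0 H]; exists C; [exact: C0|move=> a t i h]; exact: bnd_exponent (H a t i h).
Qed.

Lemma EO_Ob q k f : 1 <= q -> Ob q k f -> EO k f.
Proof. by move=> q1 [C C0 H]; exists C; [exact: C0|move=> a t i h]; exact: eb_bnd (H a t i h). Qed.

Lemma Ob_dom q k f g K : 0 <= q -> 0 < K -> mfam g -> Ob q k f ->
  (forall a t i w, dom a t -> `|g a t i w| <= K * `|f a t i w|) -> Ob q k g.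
Proof.
move=> q0 K0 mg [C C0 H] gf; exists (K * C) => [|a t i h]; first exact: mulr_gt0.
have b := H a t i h; have c0 := bnd_gt0 b.
rewrite -mulrA; set c := C * _ in b c0 *; apply: (bnd_dom q0 b) => [||w].
- exact: mg.
- exact: mulr_gt0.
- rewrite ler_pdivrMr; last exact: mulr_gt0.
  by rewrite mulrCA divfK ?gt_eqF//; exact: gf.
Qed.

Lemma Ob_det q k (h : par -> R -> 'I_n -> R) K : 0 <= q -> 0 < K ->
  (forall a t i, dom a t -> `|h a t i| <= K * sq a ^+ k) -> Ob q k (fun a t i _ => h a t i).
Proof.
move=> q0 K0 H; exists K => // a t i ha; apply: bnd_bounded => //.
  by rewrite mulr_gt0// (sqX_gt0 _ ha).
by move=> w; exact: H.
Qed.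

Lemma Ob_bounded q f K : 0 <= q -> 0 < K -> mfam f ->
  (forall a t i w, dom a t -> `|f a t i w| <= K) -> Ob q 0 f.
Proof.
move=> q0 K0 mf H; exists K => // a t i ha; rewrite expr0 mulr1.
by apply: bnd_bounded => // [|w]; [exact: mf|exact: H].
Qed.

Lemma ObD q k f g : 1 <= q -> Ob q k f -> Ob q k g ->
  Ob q k (fun a t i w => f a t i w + g a t i w).
Proof.
move=> q1 [C C0 H] [C' C'0 H']; exists (C + C') => [|a t i h]; first by rewrite addr_gt0.
by rewrite mulrDl; apply: bndD => //; [exact: H|exact: H'].
Qed.

Lemma EOD k f g : EO k f -> EO k g -> EO k (fun a t i w => f a t i w + g a t i w).
Proof.
move=> [C C0 H] [C' C'0 H']; exists (C + C') => [|a t i h]; first by rewrite addr_gt0.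
by rewrite mulrDl; apply: ebD; [exact: H|exact: H'].
Qed.

Lemma ObZ q k m f (h : par -> R -> 'I_n -> R) K : 0 <= q -> 0 < K ->
  (forall a t i, dom a t -> `|h a t i| <= K * sq a ^+ m) -> Ob q k f ->
  Ob q (m + k) (fun a t i w => h a t i * f a t i w).
Proof.
move=> q0 K0 hK [C C0 H]; exists (K * C) => [|a t i ha]; first exact: mulr_gt0.
have := bndZ q0 (H a t i ha) (hK a t i ha) (mulr_gt0 K0 (sqX_gt0 m ha)).
by congr bnd; rewrite exprD mulrACA.
Qed.

Lemma EOZ k m f (h : par -> R -> 'I_n -> R) K : 0 < K ->
  (forall a t i, dom a t -> `|h a t i| <= K * sq a ^+ m) -> EO k f ->
  EO (m + k) (fun a t i w => h a t i * f a t i w).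
Proof.
move=> K0 hK [C C0 H]; exists (K * C) => [|a t i ha]; first exact: mulr_gt0.
have := ebZ (H a t i ha) (hK a t i ha).
by congr eb; rewrite exprD mulrACA.
Qed.

Lemma ObN q k f : 0 <= q -> Ob q k f -> Ob q k (fun a t i w => - f a t i w).
Proof.
move=> q0 fk; apply: (@Ob_dom q k f _ 1 q0 ltr01 _ fk) => [a t i h|a t i w _].
  by apply: measurableT_comp => //; exact: Ob_mfam fk a t i h.
by rewrite normrN mul1r.
Qed.

Lemma ObB q k f g : 1 <= q -> Ob q k f -> Ob q k g ->
  Ob q k (fun a t i w => f a t i w - g a t i w).
Proof.
move=> q1 fk gk; apply: (ObD q1 fk); apply: ObN gk.
by apply: le_trans q1.
Qed.

Lemma EON k f : EO k f -> EO k (fun a t i w => - f a t i w).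
Proof.
move=> fk; have := @EOZ k 0 f (fun _ _ _ => -1) 1 ltr01 _ fk.
by rewrite add0n => h; apply: EO_ext (h _) => [a t i w _|a t i _]; rewrite ?mulN1r// normrN expr0 mulr1 normr1.
Qed.

Lemma EOB k f g : EO k f -> EO k g -> EO k (fun a t i w => f a t i w - g a t i w).
Proof. by move=> fk gk; apply: EOD => //; exact: EON. Qed.

Lemma ObM q k m f g : 0 < q -> Ob (2 * q) k f -> Ob (2 * q) m g ->
  Ob q (k + m) (fun a t i w => f a t i w * g a t i w).
Proof.
move=> q0 [C C0 H] [C' C'0 H']; exists (C * C') => [|a t i h]; first exact: mulr_gt0.
by rewrite exprD mulrACA; apply: bndM => //; [exact: H|exact: H'].
Qed.

Lemma Ob_norm q k f : 0 <= q -> Ob q k f -> Ob q k (fun a t i w => `|f a t i w|).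
Proof. by move=> q0 [C C0 H]; exists C; [exact: C0|move=> a t i h]; apply: bnd_norm (H a t i h). Qed.

Lemma Ob_sum q k (I : Type) (r : seq I) (f : I -> fam) : 1 <= q -> (forall x, Ob q k (f x)) ->
  Ob q k (fun a t i w => \sum_(x <- r) f x a t i w).
Proof.
move=> q1 H; elim: r => [|x r IH].
  apply: (@Ob_ext q k (fun _ _ _ _ => 0)) => [a t i w _|]; first by rewrite big_nil.
  apply: (@Ob_det q k (fun _ _ _ => 0) 1) => // [|a t i h]; first exact: le_trans q1.
  by rewrite normr0 mul1r ltW// (sqX_gt0 _ h).
apply: (@Ob_ext q k (fun a t i w => f x a t i w + \sum_(x <- r) f x a t i w)).
  by move=> a t i w _; rewrite big_cons.
exact: (ObD q1 (H x) IH).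
Qed.

Lemma EO0 k : EO k (fun _ _ _ _ => 0).
Proof.
exists 1 => // a t i h; apply: eb0; rewrite mul1r ltW// (sqX_gt0 _ h)//.
Qed.

Lemma EO_sum k (I : Type) (r : seq I) (f : I -> fam) : (forall x, EO k (f x)) ->
  EO k (fun a t i w => \sum_(x <- r) f x a t i w).
Proof.
move=> H; elim: r => [|x r IH].
  apply: (@EO_ext k (fun _ _ _ _ => 0)) => [a t i w _|]; first by rewrite big_nil.
  exact: EO0.
apply: (@EO_ext k (fun a t i w => f x a t i w + \sum_(x <- r) f x a t i w)).
  by move=> a t i w _; rewrite big_cons.
exact: (EOD (H x) IH).
Qed.

Lemma Ob_index q k f j : Ob q k f -> Ob q k (fun a t _ => f a t j).
Proof. by move=> [C C0 H]; exists C; [exact: C0|move=> a t i]; exact: H. Qed.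

Lemma EO_index k f j : EO k f -> EO k (fun a t _ => f a t j).
Proof. by move=> [C C0 H]; exists C; [exact: C0|move=> a t i]; exact: H. Qed.

(** Parameter, time and index may be renamed as long as the scale stays: this exchanges the two
    times of a product or sets them equal. *)
Lemma EO_reindex k f (u : par -> R -> 'I_n -> par) (v : par -> R -> 'I_n -> R)
    (x : par -> R -> 'I_n -> 'I_n) :
  (forall a t i, dom a t -> dom (u a t i) (v a t i) /\ (u a t i).1.1 = a.1.1) ->
  EO k f -> EO k (fun a t i => f (u a t i) (v a t i) (x a t i)).
Proof.
move=> H [C C0 HC]; exists C; [exact: C0|move=> a t i h]; have [h1 h2] := H a t i h.
by have := HC _ _ (x a t i) h1; rewrite /sq h2.
Qed.

Lemma Ob_tint q k f : 1 <= q -> 0 < T -> pfam f -> Ob q k f ->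
  Ob q k (fun a t i w => tint 0 t (fun s => f a s i w)).
Proof.
move=> q1 T0 pf [C C0 H]; exists (C * (T + 1)) => [|a t i h].
  by rewrite mulr_gt0// addr_gt0.
have h0 := sqX_gt0 k h; have [_ _ _ /andP[t0 tT]] := h.
apply: (@bnd_tint _ _ _ P q (fun s => f a s i) (fun=> C * sq a ^+ k));
  [exact: q1|exact: (pf a i (ex_intro _ t h))|exact: cont_cst|by move=> _; rewrite mulr_gt0| | |].
- by move=> s s0 st; apply: H; exact: dom_le h s0 st.
- by rewrite !mulr_gt0// addr_gt0.
- rewrite tint_cst// subr0 mulrAC ler_wpM2r ?(ltW h0)// ler_wpM2l ?(ltW C0)//.
  by apply: le_trans tT _; rewrite lerDl.
Qed.

Lemma EO_tint k f : 0 < T -> pfam f -> Ob 1 0 f -> EO k f ->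
  EO k (fun a t i w => tint 0 t (fun s => f a s i w)).
Proof.
move=> T0 pf [M M0 HM] [C C0 H]; exists (C * T) => [|a t i h]; first by rewrite mulr_gt0.
have h0 := sqX_gt0 k h; have [_ _ _ /andP[t0 tT]] := h.
apply: (@eb_tint _ _ _ P (fun s => f a s i) (fun=> C * sq a ^+ k) _ _ _ M);
  [exact: (pf a i (ex_intro _ t h))|exact: t0|exact: cont_cst| | |].
- by move=> s s0 st; have := HM a s i (dom_le h s0 st); rewrite expr0 mulr1.
- by move=> s s0 st; apply: H; exact: dom_le h s0 st.
- by rewrite tint_cst// subr0 mulrAC ler_wpM2r ?(ltW h0)// ler_wpM2l ?(ltW C0).
Qed.

(** The bounds have the form [M * expR (l * t)]; inserting one into the integral inequality yields
    the same form with [c + M / 2] in place of [M]. The hypothesis [Ob q 0 Y] starts the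
    iteration. *)
Lemma Ob_gronwall q k Y g K : 1 <= q -> 0 < K -> pfam Y -> Ob q 0 Y -> Ob q k g ->
  (forall a t i w, dom a t ->
    `|Y a t i w| <= K * tint 0 t (fun s => \sum_j `|Y a s j w|) + `|g a t i w|) ->
  Ob q k Y.
Proof.
move=> q1 K0 pY [M0 M00 HM0] [C C0 HC] HY; have q0 : 0 <= q by apply: le_trans q1.
pose N : R := (size (index_enum 'I_n)).+1%:R; have N0 : 0 < N by [].
(* At this rate, [K] times the integral of [N * M * expR (l * s)] is at most
   [M / 2 * expR (l * t)]. *)
pose l := 2 * K * N; have l0 : 0 < l by rewrite !mulr_gt0.
have lE : l = 2 * K * N by []; clearbody l.
exists (3 * C * expR (l * T)) => [|a t i h]; first by rewrite !mulr_gt0 ?expR_gt0.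
pose c := C * sq a ^+ k; have c0 : 0 < c by rewrite mulr_gt0// (sqX_gt0 _ h).
pose B M := forall t i, dom a t -> bnd q (Y a t i) (M * expR (l * t)).
have el s : dom a s -> 1 <= expR (l * s).
  by case=> _ _ _ /andP[s0 _]; rewrite -expR0 ler_expR mulr_ge0// ltW.
suff : B (3 * c).
  move=> /(_ t i h); apply: bnd_le => //.
  rewrite /c -!mulrA ler_wpM2l// ler_wpM2l ?(ltW C0)// mulrC ler_wpM2r ?(ltW (sqX_gt0 _ h))//.
  rewrite ler_expR ler_pM2l; last exact: l0.
  by case: h => _ _ _ /andP[].
apply: (@iterate_to_fixpoint R B c M0); [exact: c0| | |].
- move=> M BM {}t {}i {}h.
  have M1 : 0 < M by have := bnd_gt0 (BM t i h); rewrite pmulr_lgt0 ?expR_gt0.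
  have [_ _ _ /andP[t0 tT]] := h.
  have pS := process_l1 pY (ex_intro _ t h).
  have b1 : bnd q (fun w => tint 0 t (fun s => \sum_j `|Y a s j w|)) (N * M / l * expR (l * t)).
    apply: (@bnd_tint _ _ _ P q _ (fun s => N * M * expR (l * s)));
      [exact: q1|exact: pS| | | | |].
    + by apply: contM; [exact: cont_cst|exact: continuous_expRM].
    + by move=> s; rewrite !mulr_gt0 ?expR_gt0.
    + move=> s s0 st; rewrite -mulrA; apply: bnd_sum => // [|j].
        by rewrite mulr_gt0 ?expR_gt0.
      by apply: bnd_norm => //; apply: BM; exact: dom_le h s0 st.
    + by rewrite !mulr_gt0 ?expR_gt0 ?invr_gt0.
    + rewrite tintZ; last exact: continuous_expRM.
      rewrite tint_expR ?gt_eqF//.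
      rewrite (_ : N * M * _ = N * M / l * expR (l * t) - N * M / l).
        by rewrite gerBl; apply: ltW; rewrite divr_gt0// mulr_gt0.
      by field; rewrite gt_eqF.
  have b2 := bndZ q0 b1 (_ : `|K| <= K) K0.
  have {b2} b2 := b2 (ltac:(rewrite gtr0_norm//)).
  have b3 := bndD q1 b2 (bnd_norm q0 (HC a t i h)).
  apply: (bnd_dom q0 b3) => [||w].
  + by have [_] := pY a i (ex_intro _ t h); exact.
  + by rewrite mulr_gt0 ?expR_gt0// addr_gt0// divr_gt0.
  + have T1 : 0 <= K * tint 0 t (fun s => \sum_j `|Y a s j w|) + `|g a t i w|.
      by apply: le_trans (HY a t i w h).
    rewrite (ger0_norm T1) -/c.
    have ceq : K * (N * M / l * expR (l * t)) = M / 2 * expR (l * t).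
      by rewrite lE; field; rewrite !gt_eqF.
    rewrite ceq; apply: ler_pM => //; [by rewrite invr_ge0 mulr_ge0 ?expR_ge0// addr_ge0 ?divr_ge0 ?ltW|exact: HY|].
    rewrite lef_pV2 ?posrE.
    * by rewrite mulrDl addrC lerD2r -[X in X <= _]mulr1 ler_wpM2l ?(ltW c0)// el.
    * by rewrite mulr_gt0 ?expR_gt0// addr_gt0// divr_gt0.
    * by rewrite addr_gt0// mulr_gt0 ?expR_gt0// divr_gt0.
- move=> M M' MM BM {}t {}i {}h; apply: bnd_le (BM t i h) => //.
  by rewrite ler_wpM2r ?expR_ge0.
- move=> {}t {}i {}h; apply: bnd_le (HM0 a t i h) => //.
  by rewrite expr0 ler_wpM2l ?(ltW M00)// el.
Qed.

(** Here no absolute value enters the expectation: [f] has to be linear in [Y] with deterministic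
    coefficients, up to a term that is small in expectation only. The iteration is that of
    [Ob_gronwall]. *)
Lemma EO_gronwall k Y f g (c : par -> R -> 'I_n -> 'I_n -> R) K : 0 < T -> 0 < K ->
  pfam f -> Ob 1 0 f -> EO 0 Y -> EO k g ->
  (forall a t i j, dom a t -> `|c a t i j| <= K) ->
  EO k (fun a t i w => f a t i w - \sum_j c a t i j * Y a t j w) ->
  (forall a t i w, dom a t -> Y a t i w = tint 0 t (fun s => f a s i w) + g a t i w) ->
  EO k Y.
Proof.
move=> T0 K0 pf [Mf Mf0 HMf] [M0 M00 HM0] [Cg Cg0 HCg] cK [C C0 HC] HY.
pose N : R := (size (index_enum 'I_n))%:R + 1; have N0 : 0 < N by rewrite ltr_wpDl.
have NN : (size (index_enum 'I_n))%:R <= N by rewrite lerDl.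
pose l := 2 * K * N; have l0 : 0 < l by rewrite !mulr_gt0.
have lE : l = 2 * K * N by []; clearbody l.
have CT : 0 < C * T + Cg by rewrite addr_gt0// mulr_gt0.
exists (3 * (C * T + Cg) * expR (l * T)) => [|a t i h]; first by rewrite !mulr_gt0 ?expR_gt0.
pose e := sq a ^+ k; have e0 : 0 < e by rewrite (sqX_gt0 _ h).
pose c0 := (C * T + Cg) * e; have c00 : 0 < c0 by rewrite mulr_gt0.
pose B M := 0 <= M /\ forall t i, dom a t -> eb (Y a t i) (M * expR (l * t)).
have el s : dom a s -> 1 <= expR (l * s).
  by case=> _ _ _ /andP[s0 _]; rewrite -expR0 ler_expR mulr_ge0// ltW.
suff : B (3 * c0).
  move=> [_ /(_ t i h)]; apply: eb_le => //.
  rewrite /c0 -!mulrA ler_wpM2l// ler_wpM2l ?(ltW CT)// mulrC ler_wpM2r ?(ltW e0)//.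
  rewrite ler_expR ler_pM2l; last exact: l0.
  by case: h => _ _ _ /andP[].
apply: (@iterate_to_fixpoint R B c0 M0); [exact: c00| | |].
- move=> M [M1 BM]; split=> [|{}t {}i {}h]; first by rewrite addr_ge0 ?(ltW c00)// divr_ge0.
  have [_ _ _ /andP[t0 tT]] := h.
  have e1 : eb (fun w => tint 0 t (fun s => f a s i w)) (C * e * T + M / 2 * expR (l * t)).
    apply: (@eb_tint _ _ _ P (fun s => f a s i) (fun s => C * e + K * N * M * expR (l * s)) _ _ _ Mf);
      [by apply: pf; exists t|exact: t0| | | |].
    + by apply: contD; [exact: cont_cst|apply: contM; [exact: cont_cst|exact: continuous_expRM]].
    + by move=> s s0 st; have := HMf a s i (dom_le h s0 st); rewrite expr0 mulr1.
    + move=> s s0 st; have hs := dom_le h s0 st.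
      have s1 : eb (fun w => \sum_j c a s i j * Y a s j w) (K * N * M * expR (l * s)).
        apply: eb_le (@eb_sum _ _ _ P 'I_n (index_enum 'I_n) (fun j w => c a s i j * Y a s j w)
           (K * (M * expR (l * s))) _ _).
        * rewrite (_ : K * N * M * _ = N * (K * (M * expR (l * s)))); last by ring.
          by apply: ler_wpM2r => //; rewrite mulr_ge0 ?(ltW K0)// mulr_ge0 ?expR_ge0.
        * by rewrite mulr_ge0 ?(ltW K0)// mulr_ge0 ?expR_ge0.
        * by move=> j; apply: ebZ; [exact: BM|exact: cK].
      have := ebD (HC a s i hs) s1; congr eb.
      by apply/funext => w; rewrite subrK.
    + have cexp : continuous (fun s => K * N * M * expR (l * s)).
        by apply: contM; [exact: cont_cst|exact: continuous_expRM].
      rewrite tintD//; last exact: cont_cst.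
      rewrite tint_cst// subr0 tintZ; last exact: continuous_expRM.
      rewrite tint_expR ?gt_eqF//; apply: lerD.
        by rewrite ler_wpM2l// mulr_ge0 ?(ltW C0) ?(ltW e0).
      have -> : K * N * M * ((expR (l * t) - 1) / l) = M / 2 * (expR (l * t) - 1).
        by rewrite lE; field; rewrite !gt_eqF.
      by rewrite ler_wpM2l ?divr_ge0// gerBl.
  have := ebD e1 (HCg a t i h).
  have -> : (fun w => tint 0 t (fun s => f a s i w) + g a t i w) = Y a t i.
    by apply/funext => w; rewrite HY.
  apply: eb_le; rewrite -/e [X in _ <= X]mulrDl /c0.
  have -> : C * e * T + M / 2 * expR (l * t) + Cg * e =
    (C * T + Cg) * e + M / 2 * expR (l * t) by ring.
  by rewrite lerD2r -[X in X <= _]mulr1 ler_wpM2l ?(ltW c00)// el.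
- move=> M M' MM [M1 BM]; split=> [|{}t {}i {}h]; first exact: le_trans MM.
  by apply: eb_le (BM t i h); rewrite ler_wpM2r ?expR_ge0.
- split=> [|{}t {}i {}h]; first exact: ltW.
  apply: eb_le (HM0 a t i h).
  by rewrite expr0 ler_wpM2l ?(ltW M00)// el.
Qed.

End OrderCalculus.

(** * Taylor bounds in space, uniform over the time interval *)

Section SlabRegularity.
Variables (R : realType) (n : nat) (T : R).
Notation E := ('rV[R]_n * R)%type.
Local Notation vfun := ('I_n -> E -> R).
Implicit Types (t K : R) (x : 'rV[R]_n).

(** Only increments in space at one time appear: [X], [Z] and the flow are always compared at equal
    times. *)
Definition slab1 K (h : vfun) (h1 : 'I_n -> vfun) := forall i t x x', 0 <= t <= T ->
  [/\ `|h i (x, t)| <= K, forall j, `|h1 i j (x, t)| <= K,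
     `|h i (x', t) - h i (x, t)| <= K * l1 (x' - x)
   & `|h i (x', t) - h i (x, t) - \sum_j (x' - x) ord0 j * h1 i j (x, t)|
       <= K * l1 (x' - x) ^+ 2].

Definition slab2 K (h : vfun) h1 (h2 : 'I_n -> 'I_n -> vfun) :=
  slab1 K h h1 /\ forall j, slab1 K (fun i => h1 i j) (fun i => h2 i j).

Lemma slab1_le K K' (h : vfun) h1 : K <= K' -> slab1 K h h1 -> slab1 K' h h1.
Proof.
move=> KK H i t x x' tT; have [a1 a2 a3 a4] := H i t x x' tT; split.
- exact: le_trans KK.
- by move=> j; exact: le_trans KK.
- by apply: le_trans a3 _; rewrite ler_wpM2r ?l1_ge0.
- by apply: le_trans a4 _; rewrite ler_wpM2r ?exprn_ge0 ?l1_ge0.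
Qed.

Lemma slab1_taylor2 (h : vfun) h1 (ht : vfun) :
  (forall i, taylor2 T (h i) (h1 i) (ht i)) -> exists2 K, 0 < K & slab1 K h h1.
Proof.
move=> H; have [K K0 HK] := taylor2_family H; exists K => // i t x x' tT.
have [a1 a2 a3] := HK i; have [b1 b2 _] := a1 (x, t) tT.
have zE : (x, t) + (x' - x, 0) = (x', t) by congr (_, _) => /=; rewrite ?addr0// addrC subrK.
have c1 := a2 (x, t) (x' - x, 0) tT; have c2 := a3 (x, t) (x' - x, 0) tT.
rewrite zE /= /dist1 /= normr0 addr0 mul0r addr0 in c1 c2.
by split=> //; [exact: c1|exact: c2].
Qed.

Lemma slab2_smooth (h : vfun) : (forall i, smooth (h i)) -> (forall i, periodic1 (h i)) ->
  exists2 K, 0 < K &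
    exists h2, slab2 K h (fun i j z => 'D_(ex R j) (h i) z) h2.
Proof.
move=> sh ph.
have [K K0 HK] := slab1_taylor2 (fun i => taylor2_smooth T (sh i) (ph i)).
pose h1 i j z := 'D_(ex R j) (h i) z.
have H2 j : exists L : R, 0 < L /\ slab1 L (fun i => h1 i j)
    (fun i k z => 'D_(ex R k) (h1 i j) z).
  have [L L0 HL] := slab1_taylor2 (fun i => taylor2_smooth T
     (smooth_derive (ex R j) (sh i)) (periodic1_derive (ex R j) (ph i))).
  by exists L.
have [L HL] := choice H2.
have L0 j : 0 <= L j by apply: ltW; exact: (HL j).1.
exists (K + \sum_j L j); first by rewrite ltr_wpDr// sumr_ge0.
exists (fun i j k z => 'D_(ex R k) (h1 i j) z); split.
  by apply: slab1_le HK; rewrite lerDl sumr_ge0.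
move=> j; apply: slab1_le (HL j).2; rewrite (bigD1 j)//= addrCA lerDl.
by rewrite addr_ge0 ?(ltW K0)// sumr_ge0.
Qed.

End SlabRegularity.

(** * Processes obtained along continuous random paths *)

Section Paths.
Context (R : realType) (n : nat) (d : measure_display) (Omega : measurableType d).
Implicit Types (s t : R).

Lemma continuous_reflect (U : topologicalType) (g : R -> U) :
  {within [set t | 0 <= t], continuous g} -> continuous (fun t => g `|t|).
Proof.
move=> /subspace_continuousP cg t.
apply: (@cvg_comp _ _ _ (fun t => `|t|) g _ (within [set t | 0 <= t] (nbhs `|t|))); last first.
  by apply: cg => /=.
move=> A /= hA.
have hA' : \forall s \near t, 0 <= `|s| -> A `|s| := @norm_continuous R R t _ hA.
change (\forall s \near t, A `|s|).
by apply: filterS hA' => s; apply.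
Qed.

(* Time is reflected at 0, so that processes are continuous on the whole line. *)
Lemma process_along (Q : R -> Omega -> 'rV[R]_n) (f : 'rV[R]_n * R -> R) :
  continuous f ->
  (forall w, {within [set t | 0 <= t], continuous (fun t => Q t w)}) ->
  (forall t, 0 <= t -> rv_meas measurable (Q t)) ->
  process (fun t w => f (Q `|t| w, `|t|)).
Proof.
move=> cf cQ mQ; split=> [w|t].
  move=> t; apply: (@continuous_comp _ _ _ (fun t => (Q `|t| w, `|t|)) f); last exact: cf.
  exact: (cvg_pair (continuous_reflect (cQ w) (x := t)) (@norm_continuous R R t)).
apply: (@measurable_caratheodory R n _ Omega (fun v _ => f (v, `|t|)) (fun w => Q `|t| w)).
- move=> w v; apply: (@continuous_comp _ _ _ (fun v => (v, `|t|)) f); last exact: cf.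
  have c1 : (fun v' : 'rV[R]_n => v') @ nbhs v --> v by apply: cvg_id.
  have c2 : (fun _ : 'rV[R]_n => `|t|) @ nbhs v --> `|t| by apply: cvg_cst.
  exact: (cvg_pair c1 c2).
- by move=> v; exact: measurable_cst.
- by move=> i _ B mB; rewrite setTI; apply: mQ.
Qed.

Lemma vintE (f : R -> 'rV[R]_n) t i : vint f t ord0 i = tint 0 t (fun s => f s ord0 i).
Proof. by rewrite /vint mxE /tint; congr Rintegral; apply/seteqP; split=> s /=; rewrite in_itv. Qed.

End Paths.

(** * Coordinates of the equations and the exact decomposition of [X - Z] *)

Section LangevinLimit.
Context (R : realType) (n : nat) (d : measure_display) (Omega : measurableType d)
  (P : probability Omega R).
Local Notation bnd := (@bnd R d Omega P).
Local Notation eb := (@eb R d Omega P).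
Local Notation process := (@process R d Omega).
Local Notation E := ('rV[R]_n * R)%type.
Local Notation par := (R * R * 'I_n)%type.
Local Notation fam := (par -> R -> 'I_n -> Omega -> R).
Variables (F : R -> set (set Omega)) (W : R -> Omega -> 'rV[R]_n)
  (b : E -> 'rV[R]_n) (p : R) (x0 : 'rV[R]_n) (X V Z : R -> R -> Omega -> 'rV[R]_n) (T : R).
Hypotheses (p4 : 4 <= p) (sb : smooth b) (pb : periodic_x b)
  (filF : filtration F) (bmW : brownian P F W)
  (solX : forall eps, 0 < eps -> langevin_sol b eps x0 W (X eps) (V eps))
  (solZ : forall eps, 0 < eps -> sde_sol (Fcorr b eps) eps x0 W (Z eps))
  (rvV : forall eps, 0 < eps -> rv_meas (F 0) (V eps 0))
  (EV : forall eps, 0 < eps -> forall i : 'I_n,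
     (\int[P]_w ((V eps 0 w - b (x0, 0)) ord0 i)%:E = 0)%E)
  (MV : exists M : R, forall eps, 0 < eps ->
     (\int[P]_w (powR (enorm (V eps 0 w - b (x0, 0))) p)%:E <= M%:E)%E)
  (T0 : 0 < T).
Local Notation dom := (@dom R n T).
Local Notation Ob := (@Ob R n d Omega P T).
Local Notation EO := (@EO R n d Omega P T).
Local Notation mfam := (@mfam R n d Omega T).
Local Notation pfam := (@pfam R n d Omega T).
Implicit Types (a : par) (q s t : R) (k : nat) (i j : 'I_n) (w : Omega).

Definition drift i (z : E) : R := b z ord0 i.
(** A coordinate of [d_t b + (D_x b) b], the time derivative of [b(y_t, t)] along a solution of
    [y' = b(y, t)]. *)
Definition corr i (z : E) : R :=
  'D_(et R n) (drift i) z + \sum_j drift j z * 'D_(ex R j) (drift i) z.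

Lemma smooth_drift i : smooth (drift i). Proof. exact: smooth_coord. Qed.
Lemma periodic_drift i : periodic1 (drift i).
Proof. by move=> y t k; rewrite /drift pb. Qed.

Lemma FcorrE eps z i : Fcorr b eps z ord0 i = drift i z - eps * corr i z.
Proof.
rewrite /Fcorr !mxE !derive_coordE// /corr; congr (_ - _ * (_ + _)).
rewrite (derive_coord _ _ (smooth_drift i)) /= mul0r addr0.
by apply: eq_bigr.
Qed.

Lemma taylor2_corr i : exists gx gt, taylor2 T (corr i) gx gt.
Proof.
do 2 eexists; rewrite /corr; apply: taylor2D.
  exact: (taylor2_smooth T (smooth_derive _ (smooth_drift i)) (periodic1_derive _ (periodic_drift i))).
apply: taylor2_sum => j; apply: taylor2M.
  exact: (taylor2_smooth T (smooth_drift j) (periodic_drift j)).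
exact: (taylor2_smooth T (smooth_derive _ (smooth_drift i)) (periodic1_derive _ (periodic_drift i))).
Qed.

Lemma continuous_drift i : continuous (drift i).
Proof. exact: smooth_continuous (smooth_drift i). Qed.

Lemma continuous_corr i : continuous (corr i).
Proof.
move=> z; rewrite /corr; apply: cvgD.
  exact: (smooth_continuous (smooth_derive _ (smooth_drift i))).
apply: (continuous_big (@add_continuous R)) => j _ {}z; apply: cvgM; first exact: continuous_drift.
exact: (smooth_continuous (smooth_derive _ (smooth_drift i))).
Qed.

Definition cX : fam := fun a t i w => X a.1.1 `|t| w ord0 i.
Definition cV : fam := fun a t i w => V a.1.1 `|t| w ord0 i.
Definition cZ : fam := fun a t i w => Z a.1.1 `|t| w ord0 i.
Definition cW : fam := fun a t i w => W `|t| w ord0 i.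
Definition alongX (h : 'I_n -> E -> R) : fam := fun a t i w => h i (X a.1.1 `|t| w, `|t|).
Definition alongZ (h : 'I_n -> E -> R) : fam := fun a t i w => h i (Z a.1.1 `|t| w, `|t|).

Lemma pfam_alongX h : (forall i, continuous (h i)) -> pfam (alongX h).
Proof.
move=> ch a i [t [e0 _ _ _]]; have [m [c _]] := solX e0.
apply: (process_along (ch i)) => [w|s s0]; first exact: (c w).1.
exact: (m s s0).1.
Qed.

Lemma pfam_alongZ h : (forall i, continuous (h i)) -> pfam (alongZ h).
Proof.
move=> ch a i [t [e0 _ _ _]]; have [m [c _]] := solZ e0.
exact: (process_along (ch i)).
Qed.

Lemma continuous_proj i : continuous (fun z : E => z.1 ord0 i).
Proof.
move=> z; apply: (@continuous_comp _ _ _ fst (fun x : 'rV[R]_n => x ord0 i)).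
  exact: cvg_fst.
exact: coord_continuous.
Qed.

Lemma pfam_X : pfam cX. Proof. exact: (pfam_alongX (h := fun i z => z.1 ord0 i) continuous_proj). Qed.
Lemma pfam_Z : pfam cZ. Proof. exact: (pfam_alongZ (h := fun i z => z.1 ord0 i) continuous_proj). Qed.

Lemma pfam_V : pfam cV.
Proof.
move=> a i [t [e0 _ _ _]]; have [m [c _]] := solX e0.
have pr := @process_along R n d Omega (V a.1.1) (fun z => z.1 ord0 i) (@continuous_proj i)
  (fun w => (c w).2) (fun s (hs : 0 <= s) => (m s hs).2).
exact: pr.
Qed.

Lemma process_cW i : process (fun t w => W `|t| w ord0 i).
Proof.
case: (bmW) => _ [c [m _]].
have mW s : 0 <= s -> rv_meas measurable (W s).
  by move=> s0 j B mB; apply: (filF.1 s s0).2; exact: m.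
have pr := @process_along R n d Omega W (fun z => z.1 ord0 i) (@continuous_proj i) c mW.
exact: pr.
Qed.

Lemma pfam_W : pfam cW. Proof. by move=> a i _; exact: process_cW. Qed.

Lemma cW0 a i w : cW a 0 i w = 0.
Proof. by rewrite /cW normr0; case: bmW => -> _; rewrite mxE. Qed.

Lemma ZE a t i w : dom a t -> cZ a t i w = x0 ord0 i + tint 0 t (fun s => alongZ drift a s i w)
  - a.1.1 * tint 0 t (fun s => alongZ corr a s i w) + Num.sqrt (2 * a.1.1) * cW a t i w.
Proof.
move=> h; have [e0 _ _ /andP[t0 _]] := h; have [_ [_ eqZ]] := solZ e0.
have pd := (pfam_alongZ continuous_drift i (ex_intro _ t h)).1 w.
have pc := (pfam_alongZ continuous_corr i (ex_intro _ t h)).1 w.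
rewrite /cZ /cW (ger0_norm t0) (eqZ w t t0) mxE [X in X + _]mxE [X in _ + X]mxE vintE.
congr (_ + _); rewrite -addrA; congr (_ + _); rewrite -tintZ// -tintB//; last first.
  by apply: contM => //; exact: cont_cst.
by apply: eq_tint => s s0 _; rewrite FcorrE /alongZ (ger0_norm s0).
Qed.

(* [devV] is the deviation of the initial velocity, [U] the stationary fluctuation of the
   velocity around the drift and [lag] the delay of the velocity behind the drift. *)
Definition devV : fam := fun a t i w => V a.1.1 0 w ord0 i - drift i (x0, 0).
Definition U : fam := fun a t i w => expR (- (a.1.1^-1 * t)) * devV a t i w +
  Num.sqrt (2 / a.1.1) * relax a.1.1^-1 (fun s => cW a s i w) t.
Definition lag : fam := fun a t i w => relax a.1.1^-1 (fun s => alongX drift a s i w) t.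

Lemma XE a t i w : dom a t -> cX a t i w = x0 ord0 i + tint 0 t (fun s => cV a s i w).
Proof.
move=> h; have [e0 _ _ /andP[t0 _]] := h; have [_ [_ eqX]] := solX e0.
rewrite /cX (ger0_norm t0) (eqX w t t0).1 mxE vintE; congr (_ + _).
by apply: eq_tint => s s0 _; rewrite /cV (ger0_norm s0).
Qed.

Lemma X0 a i w : 0 < a.1.1 -> X a.1.1 0 w = x0.
Proof.
move=> e0; have [_ [_ eqX]] := solX e0; rewrite (eqX w 0 (lexx 0)).1.
by apply/rowP => j; rewrite mxE vintE tint_refl addr0.
Qed.

Lemma VE0 a t i w : 0 < a.1.1 -> 0 <= t -> cV a t i w = cV a 0 i w +
   a.1.1^-1 * tint 0 t (fun s => alongX drift a s i w - cV a s i w) +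
   Num.sqrt (2 / a.1.1) * cW a t i w.
Proof.
move=> e0 t0; have [_ [_ eqX]] := solX e0.
rewrite /cV /cW normr0 (ger0_norm t0) (eqX w t t0).2 mxE [X in X + _]mxE.
rewrite [X in _ + X + _]mxE [X in _ + X]mxE vintE; congr (_ + _ * _ + _).
by apply: eq_tint => s s0 _; rewrite /alongX /cV (ger0_norm s0) !mxE.
Qed.

Lemma relaxZ l (k : R) (q : R -> R) t : continuous q ->
  relax l (fun s => k * q s) t = k * relax l q t.
Proof.
move=> cq; rewrite /relax.
have -> : tint 0 t (fun s => expR (l * s) * (k * q t - k * q s)) =
   k * tint 0 t (fun s => expR (l * s) * (q t - q s)).
  rewrite -tintZ; first by apply: eq_tint => s _ _; ring.
  by apply: contM; [exact: continuous_expRM|apply: contB => //; exact: cont_cst].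
ring.
Qed.

(** [relaxation] with rate [1 / eps] and driving path [sqrt (2 / eps) W], whose relaxation is part
    of [U]. *)
Lemma VE a t i w : dom a t ->
  cV a t i w = alongX drift a t i w + U a t i w - lag a t i w.
Proof.
move=> h; have [e0 _ _ /andP[t0 _]] := h; have ht := ex_intro (dom a) t h.
have cv := (pfam_V i ht).1 w; have cb := (pfam_alongX continuous_drift i ht).1 w.
have cw := (pfam_W i ht).1 w.
have csw : continuous (fun s => Num.sqrt (2 / a.1.1) * cW a s i w).
  by apply: contM => //; exact: cont_cst.
have l0 : 0 < a.1.1^-1 by rewrite invr_gt0.
have H s : 0 <= s -> cV a s i w = cV a 0 i w + a.1.1^-1 *
    tint 0 s (fun s => alongX drift a s i w - cV a s i w) +
    (Num.sqrt (2 / a.1.1) * cW a s i w - Num.sqrt (2 / a.1.1) * cW a 0 i w).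
  by move=> s0; rewrite cW0 mulr0 subr0; exact: VE0.
rewrite (relaxation l0 cv cb csw H t0) relaxZ// /U /lag /devV addrA; congr (_ + _ * _ + _ - _).
by rewrite /cV /alongX normr0 X0.
Qed.

(* [remY] collects the terms of [X - Z] that carry a factor [eps]. *)
Definition cY : fam := fun a t i w => cX a t i w - cZ a t i w.
Definition dA : fam := fun a t i w => tint 0 t (fun s => alongZ corr a s i w) -
  (alongX drift a t i w - drift i (x0, 0)).
Definition remY : fam := fun a t i w =>
  a.1.1 * (dA a t i w - U a t i w + lag a t i w + devV a t i w).

(** The velocity equation times [eps] expresses the integral of [b(X) - V] through [eps (V_t - V_0)]
    and the noise. Since [eps * sqrt (2 / eps) = sqrt (2 * eps)], the noise of [X] cancels that of
    [Z] exactly. *)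
Lemma YE a t i w : dom a t ->
  cY a t i w = tint 0 t (fun s => alongX drift a s i w - alongZ drift a s i w) + remY a t i w.
Proof.
move=> h; have [e0 _ _ /andP[t0 _]] := h; have ht := ex_intro (dom a) t h.
have cv := (pfam_V i ht).1 w; have cb := (pfam_alongX continuous_drift i ht).1 w.
have cz := (pfam_alongZ continuous_drift i ht).1 w.
have e1 := VE0 i w e0 t0; have e2 := VE i w h.
rewrite tintB// in e1; rewrite tintB//.
have e3 : tint 0 t (fun s => cV a s i w) = cX a t i w - x0 ord0 i.
  by rewrite XE// addrC addKr.
rewrite e3 in e1.
rewrite /cY ZE// /remY /dA.
have sE : a.1.1 * Num.sqrt (2 / a.1.1) = Num.sqrt (2 * a.1.1).
  rewrite -{1}(sqr_sqrtr (ltW e0)) expr2 -mulrA -sqrtrM ?(ltW e0)//.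
  have -> : a.1.1 * (2 / a.1.1) = 2 by field; rewrite gt_eqF.
  by rewrite sqrtrM// mulrC.
have V0 : cV a 0 i w = devV a t i w + drift i (x0, 0) by rewrite /devV subrK /cV normr0.
rewrite -sE.
move: e1; rewrite V0 e2 => /(congr1 ( *%R a.1.1)).
set B := tint 0 t _ - (_ - _).
rewrite [X in _ = X -> _](_ : _ = a.1.1 * (devV a t i w + drift i (x0, 0)) + B +
  a.1.1 * Num.sqrt (2 / a.1.1) * cW a t i w); last by field; rewrite gt_eqF.
rewrite /B; lra.
Qed.

(** * Sizes of all terms and the strong estimate *)

Lemma p_ge1 : 1 <= p. Proof. by apply: le_trans p4; rewrite ler1n. Qed.
Lemma p_ge0 : 0 <= p. Proof. exact: le_trans p_ge1. Qed.

Lemma dom_abs a t : dom a t -> 0 <= `|t| <= T.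
Proof. by case=> _ _ _ /andP[t0 tT]; rewrite ger0_norm// t0. Qed.

Lemma sqrt_weight a t s : dom a t -> s <= t ->
  Num.sqrt (t - s) <= sq a * expR (a.1.1^-1 * (t - s) / 2).
Proof.
move=> [e0 _ _ _] st; have ts : 0 <= t - s by rewrite subr_ge0.
have [y <- ->] : exists2 y, a.1.1 * y = t - s & a.1.1^-1 * (t - s) = y.
  by exists (a.1.1^-1 * (t - s)) => //; rewrite mulrA divff ?gt_eqF// mul1r.
by rewrite sqrtrM ?(ltW e0)// ler_wpM2l ?sqrtr_ge0//; exact: sqrt_le_expR.
Qed.

Lemma linear_weight a t s : dom a t -> s <= t ->
  t - s <= 2 * a.1.1 * expR (a.1.1^-1 * (t - s) / 2).
Proof.
move=> [e0 _ _ _] st.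
have [y <- ->] : exists2 y, a.1.1 * y = t - s & a.1.1^-1 * (t - s) = y.
  by exists (a.1.1^-1 * (t - s)) => //; rewrite mulrA divff ?gt_eqF// mul1r.
rewrite [2 * _]mulrC -mulrA ler_wpM2l ?(ltW e0)//; exact: le_expR_half.
Qed.

Lemma cW_incr a s t i w : 0 <= s -> s <= t -> cW a t i w - cW a s i w = incr W i s t w.
Proof. by move=> s0 st; rewrite /cW /incr !ger0_norm// (le_trans s0). Qed.

Lemma Ob_W : Ob p 0 cW.
Proof.
have [C C0 HC] := incr_bnd filF bmW p_ge1.
exists (C * Num.sqrt T + 1) => [|a t i h]; first by rewrite ltr_wpDl// mulr_ge0 ?sqrtr_ge0// ltW.
have [_ _ _ /andP[t0 tT]] := h; rewrite expr0 mulr1.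
have [->|tn0] := eqVneq t 0.
  apply: bnd_bounded => [|||w]; first exact: p_ge0.
  - by rewrite ltr_wpDl// mulr_ge0 ?sqrtr_ge0// ltW.
  - by have [_] := process_cW i; exact.
  - by rewrite cW0 normr0 addr_ge0// mulr_ge0 ?sqrtr_ge0// ltW.
have tpos : 0 < t by rewrite lt_def tn0.
have := HC 0 t i (lexx 0) tpos.
have -> : incr W i 0 t = cW a t i.
  by apply/funext => w; rewrite -(cW_incr a i w (lexx 0) t0) cW0 subr0.
apply: bnd_le; first exact: p_ge0.
rewrite subr0 ler_wpDr// ler_wpM2l ?(ltW C0)// ler_wsqrtr//.
Qed.

(** Brownian increments over [t - s] have size [sqrt (t - s)], which relaxation at rate [1 / eps]
    averages to [sqrt eps]. *)
Lemma Ob_relaxW : Ob p 1 (fun a t i w => relax a.1.1^-1 (fun s => cW a s i w) t).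
Proof.
have [C C0 HC] := incr_bnd filF bmW p_ge1.
exists (3 * C) => [|a t i h]; first by rewrite mulr_gt0.
have [e0 _ _ /andP[t0 tT]] := h; have s0 := sq_gt0 h; rewrite expr1 -mulrA.
apply: (@bnd_relax R d Omega P p a.1.1^-1 (fun s => cW a s i) t (C * sq a));
  [exact: p_ge1|by rewrite invr_gt0|exact: t0|exact: mulr_gt0|exact: process_cW|].
move=> r r0 rt.
rewrite (_ : (fun w => _) = incr W i r t); last by apply/funext => w; rewrite cW_incr// ltW.
apply: bnd_le (HC r t i r0 rt); first exact: p_ge0.
by rewrite -mulrA ler_wpM2l ?(ltW C0)//; exact: sqrt_weight h (ltW rt).
Qed.

Lemma sqrt_fluct a t : dom a t -> Num.sqrt (2 / a.1.1) * sq a = Num.sqrt 2.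
Proof.
move=> [e0 _ _ _]; rewrite /sq -sqrtrM ?divr_ge0// ?ltW//.
by rewrite divfK// gt_eqF.
Qed.

(** The factor [sqrt (2 / eps)] costs one half power of [eps]. *)
Lemma Ob_fluct q k (f : fam) : 0 <= q -> Ob q k.+1 f ->
  Ob q k (fun a t i w => Num.sqrt (2 / a.1.1) * f a t i w).
Proof.
move=> q0 [C C0 HC]; exists (Num.sqrt 2 * C) => [|a t i h]; first by rewrite mulr_gt0 ?sqrtr_gt0.
have e0 : 0 < Num.sqrt (2 / a.1.1) by case: h => e0 _ _ _; rewrite sqrtr_gt0 divr_gt0.
have := bndZ q0 (HC a t i h) (_ : `|Num.sqrt (2 / a.1.1)| <= _) e0.
rewrite gtr0_norm// => /(_ (lexx _)); congr bnd.
by rewrite exprS -(sqrt_fluct h); ring.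
Qed.

Lemma EO_fluct k (f : fam) : EO k.+1 f ->
  EO k (fun a t i w => Num.sqrt (2 / a.1.1) * f a t i w).
Proof.
move=> [C C0 HC]; exists (Num.sqrt 2 * C) => [|a t i h]; first by rewrite mulr_gt0 ?sqrtr_gt0.
have e0 : 0 < Num.sqrt (2 / a.1.1) by case: h => e0 _ _ _; rewrite sqrtr_gt0 divr_gt0.
have := ebZ (HC a t i h) (_ : `|Num.sqrt (2 / a.1.1)| <= Num.sqrt (2 / a.1.1)).
rewrite gtr0_norm// => /(_ (lexx _)); congr eb.
by rewrite exprS -(sqrt_fluct h); ring.
Qed.

Lemma coord_le_enorm (u : 'rV[R]_n) i : `|u ord0 i| <= enorm u.
Proof.
rewrite -sqrtr_sqr /enorm ler_wsqrtr// /dotv (bigD1 i)//= expr2 lerDl.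
by apply: sumr_ge0 => j _; rewrite -expr2 sqr_ge0.
Qed.

Lemma enorm_le_l1 (u : 'rV[R]_n) : enorm u <= l1 u.
Proof.
rewrite -(ger0_norm (l1_ge0 u)) -sqrtr_sqr /enorm ler_wsqrtr// expr2 {1}/l1 mulr_suml.
apply: ler_sum => j _; rewrite -expr2 -(real_normK (num_real (u ord0 j))) expr2 ler_wpM2l//.
by rewrite /l1 (bigD1 j)//= lerDl sumr_ge0.
Qed.

Lemma measurable_enorm (Q : Omega -> 'rV[R]_n) :
  (forall i, measurable_fun setT (fun w => Q w ord0 i)) -> measurable_fun setT (fun w => enorm (Q w)).
Proof.
move=> mQ; rewrite /enorm; apply: (@measurableT_comp _ _ _ _ _ _ (@Num.sqrt R)).
  by apply: continuous_measurable_fun; exact: sqrt_continuous.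
by apply: measurable_sum => j; apply: measurable_funM.
Qed.

Lemma measurable_V0 eps i : 0 < eps -> measurable_fun setT (fun w => V eps 0 w ord0 i).
Proof.
move=> e0 _ B mB; rewrite setTI; apply: (filF.1 0 (lexx 0)).2.
exact: rvV.
Qed.

Lemma Ob_devV : Ob p 0 devV.
Proof.
(* Since [C >= 1], one has [C^-p <= C^-1], and [C] bounds the [L^p] norm without a [p]-th root of
   [M]. *)
have [M HM] := MV; pose C := `|M| + 1.
have C0 : 0 < C by rewrite ltr_wpDl.
have C1 : 1 <= C by rewrite lerDr.
exists C => // a t i h; rewrite expr0 mulr1; have [e0 _ _ _] := h.
have mc j : measurable_fun setT (fun w => (V a.1.1 0 w - b (x0, 0)) ord0 j).
  under eq_fun do rewrite mxE.
  by apply: measurable_funD; [exact: measurable_V0|rewrite mxE].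
have E w : devV a t i w = (V a.1.1 0 w - b (x0, 0)) ord0 i by rewrite /devV /drift !mxE.
have mE : measurable_fun setT (devV a t i).
  by rewrite (_ : devV a t i = (fun w => (V a.1.1 0 w - b (x0, 0)) ord0 i)) //; apply/funext.
split; [exact: C0|exact: mE|].
have mp : measurable_fun setT (fun w => (powR (enorm (V a.1.1 0 w - b (x0, 0))) p)%:E).
  apply/measurable_EFinP; apply: (@measurableT_comp _ _ _ _ _ _ (fun x : R => powR x p)).
    exact: measurable_powR.
  exact: measurable_enorm.
apply: (@le_trans _ _ (\int[P]_w ((C^-1)%:E * (powR (enorm (V a.1.1 0 w - b (x0, 0))) p)%:E))%E).
  apply: ge0_le_integral => //.
  - by move=> w _; rewrite lee_fin powR_ge0.
  - exact: measurable_powR_norm.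
  - exact: measurable_funeM.
  - move=> w _; rewrite -EFinM lee_fin E mulrC powRM ?invr_ge0 ?(ltW C0)//.
    apply: ler_pM; rewrite ?powR_ge0//.
      by apply: ge1r_powR => //; [rewrite invr_gt0 C0 invf_le1|exact: p_ge1].
    by apply: ge0_ler_powR; rewrite ?p_ge0 ?nnegrE ?sqrtr_ge0//; exact: coord_le_enorm.
rewrite ge0_integralZl//; last 2 first.
- by move=> w _; rewrite lee_fin powR_ge0.
- by rewrite lee_fin invr_ge0 ltW.
apply: (@le_trans _ _ ((C^-1)%:E * M%:E)%E).
  by apply: lee_wpmul2l; [rewrite lee_fin invr_ge0 ltW|exact: HM].
by rewrite -EFinM lee_fin mulrC ler_pdivrMr// mul1r (le_trans (ler_norm M))// lerDl.
Qed.

Lemma expRN_le1 a t i : dom a t -> `|expR (- (a.1.1^-1 * t))| <= 1 * sq a ^+ 0.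
Proof.
move=> [e0 _ _ /andP[t0 _]]; rewrite expr0 mulr1 ger0_norm ?expR_ge0// -expR0 ler_expR.
by rewrite oppr_le0 mulr_ge0// invr_ge0 ltW.
Qed.

Lemma Ob_U : Ob p 0 U.
Proof.
apply: ObD; first exact: p_ge1.
  exact: (@ObZ R n d Omega P T p 0 0 devV (fun a t _ => expR (- (a.1.1^-1 * t))) 1 p_ge0 ltr01
    expRN_le1 Ob_devV).
exact: Ob_fluct p_ge0 Ob_relaxW.
Qed.

Definition grad i j (z : E) : R := 'D_(ex R j) (drift i) z.

Lemma drift_slab : exists2 K : R, 0 < K & exists h2, slab2 T K drift grad h2.
Proof. exact: slab2_smooth smooth_drift periodic_drift. Qed.

Lemma corr_slab : exists2 K : R, 0 < K & exists gx, slab1 T K corr gx.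
Proof.
have [gx Hgx] := choice taylor2_corr; have [gt Hgt] := choice Hgx.
have [K K0 HK] := slab1_taylor2 Hgt.
by exists K => //; exists gx.
Qed.

Lemma bounded_alongX K h h1 a t i w : slab1 T K h h1 -> dom a t -> `|alongX h a t i w| <= K.
Proof. by move=> H ht; have [] := H i `|t| (X a.1.1 `|t| w) 0 (dom_abs ht). Qed.

Lemma bounded_alongZ K h h1 a t i w : slab1 T K h h1 -> dom a t -> `|alongZ h a t i w| <= K.
Proof. by move=> H ht; have [] := H i `|t| (Z a.1.1 `|t| w) 0 (dom_abs ht). Qed.

Lemma Ob_alongX K h h1 : 0 < K -> (forall i, continuous (h i)) -> slab1 T K h h1 ->
  Ob p 0 (alongX h).
Proof.
move=> K0 ch H; apply: (Ob_bounded P p_ge0 K0); first exact: pfam_mfam (pfam_alongX ch).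
by move=> a t i w ht; exact: bounded_alongX H ht.
Qed.

Lemma Ob_alongZ K h h1 : 0 < K -> (forall i, continuous (h i)) -> slab1 T K h h1 ->
  Ob p 0 (alongZ h).
Proof.
move=> K0 ch H; apply: (Ob_bounded P p_ge0 K0); first exact: pfam_mfam (pfam_alongZ ch).
by move=> a t i w ht; exact: bounded_alongZ H ht.
Qed.

Lemma Ob_drift_X : Ob p 0 (alongX drift).
Proof. by have [K K0 [h2 [H _]]] := drift_slab; exact: Ob_alongX K0 continuous_drift H. Qed.
Lemma Ob_drift_Z : Ob p 0 (alongZ drift).
Proof. by have [K K0 [h2 [H _]]] := drift_slab; exact: Ob_alongZ K0 continuous_drift H. Qed.
Lemma Ob_corr_Z : Ob p 0 (alongZ corr).
Proof. by have [K K0 [h2 H]] := corr_slab; exact: Ob_alongZ K0 continuous_corr H. Qed.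

(** A crude bound from the boundedness of [b]. It opens a bootstrap: the velocity is bounded in
    [L^p], hence [X] is Lipschitz in time in [L^p], hence [lag] is of order [eps] in [Ob_lag]. *)
Lemma Ob_lag0 : Ob p 0 lag.
Proof.
have [K K0 [h2 [H _]]] := drift_slab.
exists (3 * (2 * K)) => [|a t i h]; first by rewrite !mulr_gt0.
have [e0 _ _ /andP[t0 tT]] := h; rewrite expr0 mulr1.
have pX := pfam_alongX continuous_drift i (ex_intro _ t h).
apply: (@bnd_relax R d Omega P p a.1.1^-1 (fun s => alongX drift a s i) t (2 * K));
  [exact: p_ge1|by rewrite invr_gt0|exact: t0|exact: mulr_gt0|exact: pX|].
move=> r r0 rt; apply: bnd_bounded.
- exact: p_ge0.
- by rewrite !mulr_gt0 ?expR_gt0.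
- by apply: measurable_funB; exact: pX.2.
- move=> w; apply: (@le_trans _ _ (2 * K)).
    apply: le_trans (ler_normB _ _) _.
    have := bounded_alongX i w H h; have := bounded_alongX i w H (dom_le h r0 (ltW rt)); lra.
  rewrite -[X in X <= _]mulr1 ler_wpM2l ?mulr_ge0 ?(ltW K0)// -expR0 ler_expR.
  by rewrite divr_ge0// mulr_ge0 ?invr_ge0 ?(ltW e0)// subr_ge0 ltW.
Qed.

Lemma Ob_V : Ob p 0 cV.
Proof.
apply: (Ob_ext (f := fun a t i w => alongX drift a t i w + U a t i w - lag a t i w)).
  by move=> a t i w h; rewrite VE.
by apply: (ObB p_ge1 _ Ob_lag0); exact: (ObD p_ge1 Ob_drift_X Ob_U).
Qed.

Lemma incr_X : exists2 C : R, 0 < C & forall a t s i, dom a t -> 0 <= s -> s < t ->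
  bnd p (fun w => cX a t i w - cX a s i w) (C * (t - s)).
Proof.
have [C C0 HC] := Ob_V; exists C => // a t s i h s0 st.
have ts : 0 < t - s by rewrite subr_gt0.
have pV := pfam_V i (ex_intro _ t h).
rewrite (_ : (fun w => _) = (fun w => tint s t (fun r => cV a r i w))); last first.
  apply/funext => w; rewrite !XE//; last exact: dom_le h s0 (ltW st).
  rewrite (tint_split (pV.1 w) s0 (ltW st)); ring.
apply: (@bnd_tint R d Omega P p (fun r => cV a r i) (fun=> C));
  [exact: p_ge1|exact: pV|exact: cont_cst|by []| |by rewrite mulr_gt0|].
- move=> r sr rt; have := HC a r i (dom_le h (le_trans s0 sr) rt).
  by rewrite expr0 mulr1.
- by rewrite tint_cst// ltW.
Qed.

Lemma incr_drift_X : exists2 C : R, 0 < C & forall a t s i, dom a t -> 0 <= s -> s < t ->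
  bnd p (fun w => alongX drift a t i w - alongX drift a s i w) (C * (t - s)).
Proof.
have [C C0 HC] := incr_X.
have [K K0 HK] := taylor2_family (fun i => taylor2_smooth T (smooth_drift i) (periodic_drift i)).
pose N : R := (size (index_enum 'I_n)).+1%:R.
exists (K * (N * C + 1)) => [|a t s i h s0 st]; first by rewrite mulr_gt0// addr_gt0// mulr_gt0.
have ts : 0 < t - s by rewrite subr_gt0.
have b1 : bnd p (fun w => \sum_j `|cX a t j w - cX a s j w|) (N * (C * (t - s))).
  apply: bnd_sum; [exact: p_ge1|exact: mulr_gt0|move=> j].
  by apply: bnd_norm; [exact: p_ge0|exact: HC].
have b2 : bnd p (fun _ : Omega => t - s) (t - s).
  apply: bnd_bounded => //; [exact: p_ge0|by move=> w; rewrite gtr0_norm].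
have b3 := bndZ p_ge0 (bndD p_ge1 b1 b2) (_ : `|K| <= K) K0.
have {}b3 := b3 (ltac:(rewrite gtr0_norm//)).
rewrite (_ : K * (N * C + 1) * (t - s) = K * (N * (C * (t - s)) + (t - s))); last by ring.
have pX := pfam_alongX continuous_drift i (ex_intro _ t h).
apply: (bnd_abs_le p_ge0 b3); first by apply: measurable_funB; exact: pX.2.
move=> w; have hs := dom_le h s0 (ltW st).
have S0 : 0 <= \sum_j `|cX a t j w - cX a s j w| by exact: sumr_ge0.
rewrite [X in _ <= X]ger0_norm; last by rewrite mulr_ge0 ?(ltW K0)// addr_ge0// ltW.
have [_ H2 _] := HK i.
have t0 : 0 <= t by exact: le_trans (ltW st).
have zE : (X a.1.1 `|s| w, `|s|) + (X a.1.1 `|t| w - X a.1.1 `|s| w, `|t| - `|s|) =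
  (X a.1.1 `|t| w, `|t|) by congr (_, _) => /=; rewrite addrC subrK.
have := H2 (X a.1.1 `|s| w, `|s|) (X a.1.1 `|t| w - X a.1.1 `|s| w, `|t| - `|s|) (dom_abs hs).
rewrite zE => /(_ (dom_abs h)); rewrite /alongX => /le_trans; apply.
rewrite ler_wpM2l ?(ltW K0)// /dist1 /= (ger0_norm t0) (ger0_norm s0) (gtr0_norm ts).
rewrite lerD2r; apply: eq_ler; apply: eq_bigr => j _.
by rewrite !mxE /cX (ger0_norm t0) (ger0_norm s0).
Qed.

(** Increments of [b(X, t)] are of size [t - s], and relaxation turns this into [eps], that is two
    half powers. *)
Lemma Ob_lag : Ob p 2 lag.
Proof.
have [C C0 HC] := incr_drift_X.
exists (3 * (2 * C)) => [|a t i h]; first by rewrite !mulr_gt0.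
have [e0 _ _ /andP[t0 tT]] := h; rewrite (sq2 h).
rewrite (_ : 3 * (2 * C) * a.1.1 = 3 * (C * (2 * a.1.1))); last by ring.
have pX := pfam_alongX continuous_drift i (ex_intro _ t h).
have k0 : 0 < C * (2 * a.1.1) by rewrite !mulr_gt0.
apply: (@bnd_relax R d Omega P p a.1.1^-1 (fun s => alongX drift a s i) t (C * (2 * a.1.1)));
  [exact: p_ge1|by rewrite invr_gt0|exact: t0|exact: k0|exact: pX|].
move=> r r0 rt.
apply: bnd_le (HC a t r i h r0 rt); first exact: p_ge0.
by rewrite -mulrA ler_wpM2l ?(ltW C0)//; exact: linear_weight h (ltW rt).
Qed.

Lemma Ob_dA : Ob p 0 dA.
Proof.
have pZ := pfam_alongZ continuous_corr.
apply: (ObB p_ge1 (Ob_tint p_ge1 T0 pZ Ob_corr_Z)); apply: (ObB p_ge1 Ob_drift_X).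
have [K K0 [h2 [H _]]] := drift_slab.
apply: (Ob_det P p_ge0 K0) => a t i _; rewrite expr0 mulr1.
by have [] := H i 0 x0 x0 (ltac:(rewrite lexx ltW)).
Qed.

Lemma eps_order a t i : dom a t -> `|a.1.1| <= 1 * sq a ^+ 2.
Proof. by move=> h; rewrite (sq2 h) mul1r gtr0_norm//; case: h. Qed.

Lemma Ob_eps k (f : fam) : Ob p k f -> Ob p (2 + k) (fun a t i w => a.1.1 * f a t i w).
Proof. exact: (ObZ p_ge0 ltr01 eps_order). Qed.

Lemma EO_eps k (f : fam) : EO k f -> EO (2 + k) (fun a t i w => a.1.1 * f a t i w).
Proof. exact: (EOZ ltr01 eps_order). Qed.

Lemma Ob_remY : Ob p 2 remY.
Proof.
apply: (Ob_eps (k := 0)).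
apply: (ObD p_ge1 _ Ob_devV).
apply: (ObD p_ge1 _ Ob_lag0).
exact: (ObB p_ge1 Ob_dA Ob_U).
Qed.

Lemma pfam_Y : pfam cY.
Proof. by move=> a i h; apply: processB; [exact: pfam_X|exact: pfam_Z]. Qed.

Lemma pfam_diff h : (forall i, continuous (h i)) ->
  pfam (fun a t i w => alongX h a t i w - alongZ h a t i w).
Proof.
by move=> ch a i ha; apply: processB; [exact: pfam_alongX|exact: pfam_alongZ].
Qed.

Lemma diff_le K h h1 a t i w : slab1 T K h h1 -> dom a t ->
  `|alongX h a t i w - alongZ h a t i w| <= K * \sum_j `|cY a t j w|.
Proof.
move=> H ht; have [_ _ + _] := H i `|t| (Z a.1.1 `|t| w) (X a.1.1 `|t| w) (dom_abs ht).
congr (_ <= _ * _); apply: eq_bigr => j _; by rewrite !mxE.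
Qed.

(** The strong estimate: the a priori bound of order 0 comes from the boundedness of [b], and
    Gronwall's lemma raises it to the order of [remY]. *)
Lemma Ob_Y : Ob p 2 cY.
Proof.
have [K K0 [h2 [H _]]] := drift_slab.
have pD := pfam_diff continuous_drift.
apply: (Ob_gronwall p_ge1 K0 pfam_Y _ Ob_remY).
  apply: (Ob_ext (f := fun a t i w =>
    tint 0 t (fun s => alongX drift a s i w - alongZ drift a s i w) + remY a t i w)).
    by move=> a t i w h; rewrite YE.
  apply: (ObD p_ge1 _ (Ob_le p_ge0 (leq0n 2) Ob_remY)).
  exact: (Ob_tint p_ge1 T0 pD (ObB p_ge1 Ob_drift_X Ob_drift_Z)).
move=> a t i w h; have [_ _ _ /andP[t0 _]] := h.
rewrite YE//; apply: le_trans (ler_normD _ _) _; rewrite lerD2r.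
have cD := (pD a i (ex_intro _ t h)).1 w.
apply: le_trans (tint_norm _ _ cD) _.
have cS := (process_l1 pfam_Y (ex_intro _ t h)).1 w.
rewrite -tintZ//; apply: tint_le.
- exact: continuous_norm_comp.
- by apply: contM => //; exact: cont_cst.
- by move=> s s0 st; apply: (diff_le i w H); exact: dom_le h s0 st.
Qed.

(** * An approximate solution of the limit equation *)

Lemma sample_point : exists w0 : Omega, True.
Proof.
have [w0 _] : [set: Omega] !=set0; last by exists w0.
apply/set0P/negP => /eqP E; have := @probability_setT _ _ _ P.
by rewrite E measure0 => /eqP; rewrite eq_sym onee_eq0.
Qed.

(* An approximate solution of the limit equation [y' = b(y, t)]: a path of the SDE at a
   much smaller noise level, with the noise subtracted. *)
Lemma approximate_flow : exists (y : R -> R -> 'rV[R]_n) (beta : R -> 'I_n -> R -> R) (C : R),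
  0 < C /\ forall a, (exists t, dom a t) ->
  [/\ continuous (y a.1.1), forall i, continuous (beta a.1.1 i),
    forall t i, dom a t -> y a.1.1 t ord0 i = x0 ord0 i + tint 0 t (beta a.1.1 i)
  & forall t i, dom a t -> `|beta a.1.1 i t - drift i (y a.1.1 t, `|t|)| <= C * a.1.1].
Proof.
have [w0 _] := sample_point.
have cWw : continuous (fun t => W `|t| w0).
  by case: bmW => _ [c _]; exact: (continuous_reflect (c w0)).
have [M M0 HM] : exists2 M : R, 0 < M & forall t, 0 <= t <= T -> l1 (W `|t| w0) <= M.
  have cl : continuous (fun t => \sum_j `|W `|t| w0 ord0 j|).
    have ps : process (fun t w => \sum_j `|W `|t| w ord0 j|).
      by apply: process_sum => j; apply: process_norm; exact: process_cW.
    exact: ps.1.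
  have [c _ Hc] := EVT_max (ltW T0) (@continuous_subspaceT _ _ `[0, T] _ cl).
  exists (`|\sum_j `|W `|c| w0 ord0 j| | + 1) => [|t tT]; first by rewrite ltr_wpDl.
  apply: le_trans (Hc t _) _; first by rewrite in_itv.
  by apply: le_trans (ler_norm _) _; rewrite lerDl.
pose M1 := M + 1; have M10 : 0 < M1 by rewrite addr_gt0.
(* Chosen so that [sqrt (2 * eta e) = e / M1]: since [M1] bounds the sampled Brownian path on
   [[0, T]], its noise is at most [e]. As [M1 >= 1], also [eta e <= e]. *)
pose eta (e : R) := e ^+ 2 / (2 * M1 ^+ 2).
have eta0 e : 0 < e -> 0 < eta e by move=> e0; rewrite divr_gt0 ?exprn_gt0// mulr_gt0// exprn_gt0.
have etaS e : 0 < e -> Num.sqrt (2 * eta e) = e / M1.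
  move=> e0; have -> : 2 * eta e = (e / M1) ^+ 2.
    by rewrite /eta; field; rewrite gt_eqF.
  by rewrite sqrtr_sqr ger0_norm// divr_ge0 ?ltW.
have etaL e : 0 < e -> e < 1 -> eta e <= e.
  move=> e0 e1; rewrite /eta ler_pdivrMr ?mulr_gt0 ?exprn_gt0// expr2 ler_wpM2l ?(ltW e0)//.
  have : 1 <= M1 ^+ 2 by rewrite expr_ge1// ?lerDr ?(ltW M0)// ltW.
  lra.
pose y e t := Z (eta e) `|t| w0 - Num.sqrt (2 * eta e) *: W `|t| w0.
(* The exact derivative of [y]. It differs from the drift at [y] by the Lipschitz effect of the
   subtracted noise and by [eta e] times the correction, each of order [e]. *)
pose beta e i t := drift i (Z (eta e) `|t| w0, `|t|) - eta e * corr i (Z (eta e) `|t| w0, `|t|).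
have [K K0 [h2 [Hd _]]] := drift_slab; have [L L0 [gx Hc]] := corr_slab.
exists y, beta, (K + L); split; first by rewrite addr_gt0.
move=> a [t1 h1]; have [e0 e1 r0 _] := h1; set e := a.1.1 in e0 e1 *.
have ha : forall t, dom a t -> dom (eta e, a.1.2, a.2) t.
  move=> t [_ _ r tT]; split=> //=; first exact: eta0.
  by apply: le_lt_trans (etaL e e0 e1) _.
have cz : continuous (fun t => Z (eta e) `|t| w0).
  by have [_ [c _]] := solZ (eta0 e e0); exact: (continuous_reflect (c w0)).
have czf (f : E -> R) : continuous f -> continuous (fun t => f (Z (eta e) `|t| w0, `|t|)).
  move=> cf t; apply: (@continuous_comp _ _ _ (fun t => (Z (eta e) `|t| w0, `|t|)) f); last exact: cf.
  exact: (cvg_pair (cz t) (@norm_continuous R R t)).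
split.
- move=> t; apply: cvgB; first exact: cz.
  exact: (cvgZ (cvg_cst _) (cWw t)).
- move=> i; apply: (@contB _ (fun t => drift i (Z (eta e) `|t| w0, `|t|))).
    exact: (czf _ (@continuous_drift i)).
  by apply: contM; [exact: cont_cst|exact: (czf _ (@continuous_corr i))].
- move=> t i h; have := ZE i w0 (ha t h); rewrite /cZ /cW /= => zE.
  rewrite /y !mxE zE addrK -addrA; congr (_ + _).
  rewrite -tintZ; last exact: (czf _ (@continuous_corr i)).
  rewrite -tintB//; first exact: (czf _ (@continuous_drift i)).
  by apply: contM; [exact: cont_cst|exact: (czf _ (@continuous_corr i))].
- move=> t i h; have [_ _ _ tT] := h; rewrite /beta.
  have [_ _ b1 _] := Hd i `|t| (y e t) (Z (eta e) `|t| w0) (dom_abs h).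
  have [b2 _ _ _] := Hc i `|t| (Z (eta e) `|t| w0) 0 (dom_abs h).
  rewrite addrAC; apply: le_trans (ler_normB _ _) _; rewrite mulrDl; apply: lerD.
    apply: le_trans b1 _; rewrite ler_wpM2l ?(ltW K0)//.
    rewrite /y subKr l1Z (ger0_norm (sqrtr_ge0 _)) etaS//.
    rewrite -mulrA -[X in _ <= X]mulr1 ler_wpM2l ?(ltW e0)// mulrC ler_pdivrMr// mul1r.
    by apply: le_trans (HM t tT) _; rewrite lerDl.
  rewrite normrM (gtr0_norm (eta0 e e0)) [L * e]mulrC; apply: ler_pM.
  - exact/ltW/eta0.
  - exact: normr_ge0.
  - exact: etaL.
  - exact: b2.
Qed.

(** Over [N] equal steps the quadratic terms add up to [C * t ^+ 2 / N], which is below any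
    tolerance, and the linear ones to [C * e * t]. This replaces a derivative bound on [g]. *)
Lemma telescoping (g : R -> R) (C e : R) : 0 <= C ->
  (forall s t, 0 <= s -> s <= t -> t <= T ->
     `|g t - g s| <= C * ((t - s) ^+ 2 + e * (t - s))) ->
  forall t, 0 <= t -> t <= T -> `|g t - g 0| <= C * e * t.
Proof.
move=> C0 H t t0 tT; apply/ler_addgt0Pr => dl dl0.
pose N := (Num.bound (C * t ^+ 2 / dl)).+1.
have N0 : (0 : R) < N%:R by [].
pose u (k : nat) := k%:R * (t / N%:R).
have uS k : u k.+1 - u k = t / N%:R by rewrite /u -natr1; ring.
have tN : 0 <= t / N%:R by rewrite divr_ge0.
have uT k : (k <= N)%N -> u k <= T.
  move=> kN; apply: le_trans tT; rewrite /u mulrCA -[X in _ <= X]mulr1 ler_wpM2l//.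
  by rewrite ler_pdivrMr// mul1r ler_nat.
have step k : (k <= N)%N -> `|g (u k) - g 0| <= k%:R * (C * ((t / N%:R) ^+ 2 + e * (t / N%:R))).
  elim: k => [_|k IH kN]; first by rewrite /u mul0r subrr normr0 mul0r.
  have -> : g (u k.+1) - g 0 = (g (u k.+1) - g (u k)) + (g (u k) - g 0) by ring.
  apply: le_trans (ler_normD _ _) _; rewrite -natr1 mulrDl mul1r addrC; apply: lerD.
    exact: IH (ltnW kN).
  by rewrite -(uS k); apply: H; [rewrite mulr_ge0|rewrite -subr_ge0 uS|exact: uT].
have := step N (leqnn N); rewrite (_ : u N = t); last by rewrite /u mulrC divfK ?gt_eqF.
move=> /le_trans; apply.
rewrite (_ : N%:R * _ = C * t ^+ 2 / N%:R + C * e * t); last by field; rewrite gt_eqF.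
rewrite addrC lerD2l ler_pdivrMr// [dl * _]mulrC -ler_pdivrMr//.
apply: le_trans (ltW (archi_boundP _)) _; last by rewrite ler_nat.
by rewrite divr_ge0 ?(ltW dl0)// mulr_ge0 ?sqr_ge0.
Qed.

(** * Comparison with the deterministic flow *)

Section Flow.
Variables (y : R -> R -> 'rV[R]_n) (beta : R -> 'I_n -> R -> R) (Cy : R).
Hypotheses (Cy0 : 0 < Cy)
  (yP : forall a, (exists t, dom a t) ->
  [/\ continuous (y a.1.1), forall i, continuous (beta a.1.1 i),
    forall t i, dom a t -> y a.1.1 t ord0 i = x0 ord0 i + tint 0 t (beta a.1.1 i)
  & forall t i, dom a t -> `|beta a.1.1 i t - drift i (y a.1.1 t, `|t|)| <= Cy * a.1.1]).

Definition alongy (h : 'I_n -> E -> R) a t i : R := h i (y a.1.1 t, `|t|).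
Definition cD : fam := fun a t i w => cZ a t i w - y a.1.1 t ord0 i.
Definition lD : fam := fun a t i w => \sum_j `|cD a t j w|.
Definition lY : fam := fun a t i w => \sum_j `|cY a t j w|.

Lemma continuous_alongy h a i : (exists t, dom a t) -> continuous (h i) ->
  continuous (fun t => alongy h a t i).
Proof.
move=> ha ch t; have [cy _ _ _] := yP ha.
apply: (@continuous_comp _ _ _ (fun t => (y a.1.1 t, `|t|)) (h i)); last exact: ch.
exact: (cvg_pair (cy t) (@norm_continuous R R t)).
Qed.

Lemma continuous_y a i : (exists t, dom a t) -> continuous (fun t => y a.1.1 t ord0 i).
Proof. by move=> ha; exact: (@continuous_alongy (fun i z => z.1 ord0 i) a i ha (@continuous_proj i)). Qed.

Lemma pfam_D : pfam cD.
Proof.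
move=> a i ha; apply: processB; first exact: pfam_Z.
by apply: process_path; exact: continuous_y.
Qed.

Definition noise : fam := fun a t i w =>
  Num.sqrt (2 * a.1.1) * cW a t i w -
  a.1.1 * tint 0 t (fun s => alongZ corr a s i w).

Lemma DE a t i w : dom a t -> cD a t i w =
  tint 0 t (fun s => alongZ drift a s i w - beta a.1.1 i s) +
  noise a t i w.
Proof.
move=> h; have ha := ex_intro (dom a) t h; have [cy cb yE _] := yP ha.
have cz := (pfam_alongZ continuous_drift i ha).1 w.
by rewrite /cD /noise ZE// yE// tintB//; ring.
Qed.

Lemma sqrt2_order a t i : dom a t -> `|Num.sqrt (2 * a.1.1)| <= Num.sqrt 2 * sq a ^+ 1.
Proof. by move=> h; rewrite ger0_norm ?sqrtr_ge0// expr1 /sq sqrtrM. Qed.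

Lemma Ob_noise : Ob p 1 noise.
Proof.
rewrite /noise.
have s20 : 0 < Num.sqrt 2 :> R by rewrite sqrtr_gt0.
apply: (ObB p_ge1).
  exact: (@ObZ R n d Omega P T p 0 1 cW (fun a _ _ => Num.sqrt (2 * a.1.1)) _ p_ge0 s20
    sqrt2_order Ob_W).
apply: (Ob_le p_ge0 (isT : (1 <= 2)%N)).
apply: (Ob_eps (k := 0)).
exact: (Ob_tint p_ge1 T0 (pfam_alongZ continuous_corr) Ob_corr_Z).
Qed.

Lemma beta_order a t i : dom a t -> `|beta a.1.1 i t - alongy drift a t i| <= Cy * sq a ^+ 2.
Proof. by move=> h; have [_ _ _] := yP (ex_intro _ t h); rewrite (sq2 h); exact. Qed.

Lemma Zy_le K h h1 a t i w : slab1 T K h h1 -> dom a t ->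
  `|alongZ h a t i w - alongy h a t i| <= K * lD a t i w.
Proof.
move=> H ht; have [_ _ + _] := H i `|t| (y a.1.1 t) (Z a.1.1 `|t| w) (dom_abs ht).
by congr (_ <= _ * _); apply: eq_bigr => j _; rewrite !mxE.
Qed.

Lemma Zy_expansion K h h1 a t i w : slab1 T K h h1 -> dom a t ->
  `|alongZ h a t i w - alongy h a t i - \sum_j alongy (h1^~ j) a t i * cD a t j w|
    <= K * lD a t i w ^+ 2.
Proof.
move=> H ht; have [_ _ _] := H i `|t| (y a.1.1 t) (Z a.1.1 `|t| w) (dom_abs ht).
have -> : l1 (Z a.1.1 `|t| w - y a.1.1 t) = lD a t i w.
  by apply: eq_bigr => j _; rewrite !mxE.
congr (`| _ - _| <= _); apply: eq_bigr => j _; by rewrite !mxE mulrC.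
Qed.

(** Taylor's formula at [Z] leaves random gradients. Moving them to [y] costs [lD * lY], the first
    claim; expanding them once more isolates the products of [D] and [Y] with deterministic
    coefficients and leaves [lD ^+ 2 * lY], the second claim. *)
Lemma XZ_expansion K h h1 h2 a t i w : slab2 T K h h1 h2 -> dom a t ->
  `|alongX h a t i w - alongZ h a t i w - \sum_j alongy (h1^~ j) a t i * cY a t j w|
    <= K * lY a t i w ^+ 2 + K * (lD a t i w * lY a t i w) /\
  `|alongX h a t i w - alongZ h a t i w - \sum_j alongy (h1^~ j) a t i * cY a t j w
     - \sum_j \sum_k alongy (fun i => h2 i j k) a t i * (cD a t k w * cY a t j w)|
    <= K * lY a t i w ^+ 2 + K * (lD a t i w ^+ 2 * lY a t i w).
Proof.
move=> [H H2] ht.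
have [_ _ _ e1] := H i `|t| (Z a.1.1 `|t| w) (X a.1.1 `|t| w) (dom_abs ht).
have lYE : l1 (X a.1.1 `|t| w - Z a.1.1 `|t| w) = lY a t i w.
  by apply: eq_bigr => j _; rewrite !mxE.
rewrite lYE in e1.
have sE : \sum_j (X a.1.1 `|t| w - Z a.1.1 `|t| w) ord0 j * h1 i j (Z a.1.1 `|t| w, `|t|) =
   \sum_j alongZ (h1^~ j) a t i w * cY a t j w.
  by apply: eq_bigr => j _; rewrite !mxE mulrC.
rewrite sE -/(alongX h a t i w) -/(alongZ h a t i w) in e1.
split.
- rewrite -(subrK (\sum_j alongZ (h1^~ j) a t i w * cY a t j w) (alongX h a t i w - _)) -addrA.
  apply: le_trans (ler_normD _ _) (lerD e1 _).
  rewrite -sumrB; apply: le_trans (ler_norm_sum _ _ _) _.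
  rewrite mulrA [X in _ <= _ * X]/lY mulr_sumr; apply: ler_sum => j _.
  by rewrite -mulrBl normrM ler_wpM2r//; exact: (Zy_le i w (H2 j) ht).
- pose S0 := \sum_j alongZ (h1^~ j) a t i w * cY a t j w.
  pose S1 := \sum_j alongy (h1^~ j) a t i * cY a t j w.
  pose S2 := \sum_j \sum_k alongy (fun i => h2 i j k) a t i * (cD a t k w * cY a t j w).
  rewrite (_ : _ - S1 - S2 = (alongX h a t i w - alongZ h a t i w - S0) + (S0 - (S1 + S2))); last by ring.
  apply: le_trans (ler_normD _ _) (lerD e1 _).
  rewrite /S0 /S1 /S2 -big_split -sumrB; apply: le_trans (ler_norm_sum _ _ _) _.
  rewrite mulrA [X in _ <= _ * X]/lY mulr_sumr; apply: ler_sum => j _ /=.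
  have -> : alongZ (h1^~ j) a t i w * cY a t j w - (alongy (h1^~ j) a t i * cY a t j w +
     \sum_k alongy (fun i => h2 i j k) a t i * (cD a t k w * cY a t j w)) =
     (alongZ (h1^~ j) a t i w - alongy (h1^~ j) a t i -
      \sum_k alongy (fun i => h2 i j k) a t i * cD a t k w) * cY a t j w.
    rewrite mulrBl mulrBl mulr_suml opprD addrA; congr (_ - _).
    by apply: eq_bigr => k _; rewrite mulrA.
  by rewrite normrM ler_wpM2r//; exact: (Zy_expansion i w (H2 j) ht).
Qed.

Lemma pfam_drift_beta : pfam (fun a t i w => alongZ drift a t i w - beta a.1.1 i t).
Proof.
move=> a i ha; apply: processB; first exact: (pfam_alongZ continuous_drift i ha).
by apply: process_path; have [_ cb _ _] := yP ha.
Qed.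

Lemma Ob_drift_beta : Ob p 0 (fun a t i w => alongZ drift a t i w - beta a.1.1 i t).
Proof.
have [K K0 [h2 [H _]]] := drift_slab.
apply: (ObB p_ge1 Ob_drift_Z).
apply: (Ob_det P p_ge0 (addr_gt0 K0 Cy0)) => a t i h; rewrite expr0 mulr1.
have := beta_order i h; have := sqX_le1 2 h.
have [hy _ _ _] := H i `|t| (y a.1.1 t) 0 (dom_abs h).
rewrite -(subrK (alongy drift a t i) (beta a.1.1 i t)) => s1 bO.
apply: le_trans (ler_normD _ _) _; rewrite addrC; apply: lerD => //.
rewrite subrK in bO; apply: le_trans bO _.
by rewrite -[X in _ <= X]mulr1 ler_wpM2l ?(ltW Cy0).
Qed.

(** The noise of [Z] has order [sqrt eps], the defect of the approximate flow only order [eps]. *)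
Lemma Ob_D : Ob p 1 cD.
Proof.
have [K K0 [h2 [H _]]] := drift_slab.
have bZ := Ob_noise.
have CT0 : 0 < Cy * T by rewrite mulr_gt0.
pose g : fam := fun a t i w => Cy * a.1.1 * T + `|noise a t i w|.
have gO : Ob p 1 g.
  apply: (ObD p_ge1 _ (Ob_norm p_ge0 bZ)).
  apply: (Ob_det P p_ge0 CT0) => a t i h; rewrite -(sq2 h) mulrAC normrM gtr0_norm//.
  rewrite ler_wpM2l ?(ltW CT0)// ger0_norm ?exprn_ge0 ?(ltW (sq_gt0 h))//.
  exact: (sqX_anti h).
have pB := pfam_drift_beta.
apply: (Ob_gronwall p_ge1 K0 pfam_D _ gO).
  apply: (Ob_ext (f := fun a t i w => tint 0 t (fun s => alongZ drift a s i w - beta a.1.1 i s) +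
    noise a t i w)).
    by move=> a t i w h; rewrite DE.
  apply: (ObD p_ge1 _ (Ob_le p_ge0 (leq0n 1) bZ)).
  exact: (Ob_tint p_ge1 T0 pB Ob_drift_beta).
move=> a t i w h; have [e0 _ _ /andP[t0 tT]] := h; have ha := ex_intro (dom a) t h.
have cD' := (pB a i ha).1 w.
have cS := (process_l1 pfam_D ha).1 w.
rewrite DE//; apply: le_trans (ler_normD _ _) _.
rewrite [X in _ <= _ + X]ger0_norm; last first.
  by rewrite addr_ge0// mulr_ge0 ?(ltW T0)// mulr_ge0 ?(ltW Cy0)// ltW.
rewrite /g addrA lerD2r; apply: le_trans (tint_norm _ _ cD') _.
apply: (@le_trans _ _ (tint 0 t (fun s => K * (\sum_j `|cD a s j w|) + Cy * a.1.1))).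
  apply: tint_le.
  - exact: continuous_norm_comp.
  - by apply: contD; [apply: contM => //|]; exact: cont_cst.
  - move=> s s0 st; have hs := dom_le h s0 st.
    have -> : alongZ drift a s i w - beta a.1.1 i s = (alongZ drift a s i w - alongy drift a s i)
       - (beta a.1.1 i s - alongy drift a s i) by ring.
    apply: le_trans (ler_normB _ _) (lerD (Zy_le i w H hs) _).
    by have := beta_order i hs; rewrite (sq2 hs).
rewrite tintD; [|by apply: contM => //; exact: cont_cst|exact: cont_cst].
rewrite tintZ// tint_cst// subr0 lerD2l ler_wpM2l//.
by rewrite mulr_ge0 ?(ltW Cy0)// ltW.
Qed.

Lemma Ob_l1 q k (f : fam) : 1 <= q -> q <= p -> Ob p k f ->
  Ob q k (fun a t _ w => \sum_j `|f a t j w|).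
Proof.
move=> q1 qp fk; have q0 : 0 < q by apply: lt_le_trans q1.
apply: (Ob_sum _ q1 (f := fun j a t _ w => `|f a t j w|)) => j.
by apply: Ob_norm (ltW q0) _; apply: (Ob_exponent q0 qp); exact: Ob_index.
Qed.

Lemma Ob_lD q : 1 <= q -> q <= p -> Ob q 1 lD.
Proof. by move=> q1 qp; exact: Ob_l1 Ob_D. Qed.

Lemma Ob_lY q : 1 <= q -> q <= p -> Ob q 2 lY.
Proof. by move=> q1 qp; exact: Ob_l1 Ob_Y. Qed.

Lemma two_le_p : 2 <= p. Proof. by apply: le_trans p4; rewrite ler_nat. Qed.
Lemma four_le_p : 2 * 2 <= p. Proof. by rewrite -natrM. Qed.

Lemma Ob_two k (f : fam) : Ob p k f -> Ob (2 * 1) k f.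
Proof. by rewrite mulr1; apply: Ob_exponent => //; exact: two_le_p. Qed.

Lemma EO_mul k m (f g : fam) : Ob (2 * 1) k f -> Ob (2 * 1) m g ->
  EO (k + m) (fun a t i w => f a t i w * g a t i w).
Proof. by move=> fk gm; apply: (EO_Ob (lexx 1)); exact: ObM ltr01 fk gm. Qed.

(** The remainder is quadratic in [D]; its [L^2] norm takes fourth moments of [D], whence [4 <= p].
    It is measured in [L^2] so that it can be multiplied by a square-integrable weight. *)
Lemma Ob_Zy_expansion K h h1 : 0 < K -> (forall i, continuous (h i)) -> slab1 T K h h1 ->
  Ob 2 2 (fun a t i w => alongZ h a t i w - alongy h a t i -
    \sum_j alongy (h1^~ j) a t i * cD a t j w).
Proof.
move=> K0 ch H; have p20 : (0 : R) <= 2 by [].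
have lD2 : Ob (2 * 2) 1 lD by apply: Ob_lD four_le_p; rewrite -natrM ler1n.
apply: (Ob_dom p20 K0 _ (ObM (ltr0n R 2) lD2 lD2)).
- move=> a t i ht; have ha := ex_intro (dom a) t ht.
  apply: measurable_funB.
    by apply: measurable_funB; [exact: (pfam_alongZ ch i ha).2|exact: measurable_cst].
  have ps : process (fun (_ : R) w => \sum_j alongy (h1^~ j) a t i * cD a t j w).
    apply: process_sum => j; apply: process_const_time; apply: measurable_funM.
      exact: measurable_cst.
    exact: (pfam_D j ha).2.
  exact: (ps.2 0).
- move=> a t i w ht; apply: le_trans (Zy_expansion i w H ht) _.
  by rewrite -expr2 ger0_norm ?exprn_even_ge0.
Qed.

Lemma alongy_grad_le K h h1 a t i j : slab1 T K h h1 -> dom a t ->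
  `|alongy (h1^~ j) a t i| <= K.
Proof. by move=> H ht; have [_ + _ _] := H i `|t| (y a.1.1 t) 0 (dom_abs ht); exact. Qed.

Lemma EO_grad K h h1 k (f : fam) : 0 < K -> slab1 T K h h1 -> EO k f ->
  EO k (fun a t i w => \sum_j alongy (h1^~ j) a t i * f a t j w).
Proof.
move=> K0 H fk; apply: EO_sum => j.
apply: (@EOZ R n d Omega P T k 0 _ (fun a t i => alongy (h1^~ j) a t i) K K0 _ (EO_index j fk)).
by move=> a t i ht; rewrite expr0 mulr1; exact: alongy_grad_le H ht.
Qed.

Lemma EO_alongZ K h h1 : 0 < K -> (forall i, continuous (h i)) -> slab1 T K h h1 ->
  EO 2 cD -> EO 2 (fun a t i w => alongZ h a t i w - alongy h a t i).
Proof.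
move=> K0 ch H D2.
apply: (EO_ext (f := fun a t i w => (alongZ h a t i w - alongy h a t i -
    \sum_j alongy (h1^~ j) a t i * cD a t j w) + \sum_j alongy (h1^~ j) a t i * cD a t j w)).
  by move=> a t i w _; rewrite subrK.
apply: EOD; first exact: (EO_Ob (ler1n R 2) (Ob_Zy_expansion K0 ch H)).
exact: EO_grad K0 H D2.
Qed.

(** The weight [g] does not depend on the running time, so the equation of [D] may be multiplied by
    it before Gronwall's lemma. The only term of order [sqrt eps] is [g] times the noise, and the
    correlation hypothesis supplies its missing half power. It is used with [g] equal to 1, [devV]
    and [U_r]. *)
Lemma EO_mul_D (g : par -> Omega -> R) : Ob (2 * 1) 0 (fun a _ _ w => g a w) ->
  EO 1 (fun a t i w => g a w * cW a t i w) -> EO 2 (fun a t i w => g a w * cD a t i w).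
Proof.
move=> gO gW; have [K K0 [h2 [H _]]] := drift_slab.
have s20 : 0 < Num.sqrt 2 :> R by rewrite sqrtr_gt0.
have mg a : (exists t, dom a t) -> measurable_fun setT (g a).
  by move=> [t h]; exact: Ob_mfam gO a t a.2 h.
apply: (@EO_gronwall R n d Omega P T 2 _
  (fun a t i w => g a w * (alongZ drift a t i w - beta a.1.1 i t))
  (fun a t i w => Num.sqrt (2 * a.1.1) * (g a w * cW a t i w) -
     a.1.1 * (g a w * tint 0 t (fun s => alongZ corr a s i w)))
  (fun a t i j => alongy (grad^~ j) a t i) K T0 K0).
- move=> a i ha; apply: processM; last exact: pfam_drift_beta.
  by apply: process_const_time; exact: mg.
- exact: (ObM ltr01 gO (Ob_two Ob_drift_beta)).
- apply: (EO_le (leq0n 1)); exact: (EO_mul gO (Ob_two Ob_D)).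
- apply: EOB.
    exact: (@EOZ R n d Omega P T 1 1 _ (fun a _ _ => Num.sqrt (2 * a.1.1)) _ s20 sqrt2_order gW).
  apply: (EO_eps (k := 0)).
  apply: (EO_mul gO (Ob_two _)).
  exact: (Ob_tint p_ge1 T0 (pfam_alongZ continuous_corr) Ob_corr_Z).
- by move=> a t i j; exact: alongy_grad_le H.
- apply: (EO_ext (f := fun a t i w => g a w * (alongZ drift a t i w - alongy drift a t i -
    \sum_j alongy (grad^~ j) a t i * cD a t j w) - g a w * (beta a.1.1 i t - alongy drift a t i))).
    move=> a t i w _.
    have -> : \sum_j alongy (grad^~ j) a t i * (g a w * cD a t j w) =
      g a w * \sum_j alongy (grad^~ j) a t i * cD a t j w.
      by rewrite mulr_sumr; apply: eq_bigr => j _; rewrite mulrCA.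
    ring.
  apply: EOB.
    have Z2 := Ob_Zy_expansion K0 continuous_drift H; rewrite -[2]mulr1 in Z2.
    exact: (EO_mul gO Z2).
  apply: (EO_mul (m := 2) gO); apply: Ob_two.
  exact: (Ob_det P p_ge0 Cy0 beta_order).
- move=> a t i w h; have ha := ex_intro (dom a) t h.
  rewrite tintZ; last exact: ((pfam_drift_beta i ha).1 w).
  by rewrite DE// /noise; ring.
Qed.

(** A weight known at time 0 is exactly uncorrelated with [W_t]. *)
Lemma EO_mul_W (g : par -> Omega -> R) : Ob (2 * 1) 0 (fun a _ _ w => g a w) ->
  (forall a, (exists t, dom a t) -> rv_in (F 0) (g a)) ->
  EO 1 (fun a t i w => g a w * cW a t i w).
Proof.
move=> [C C0 HC] gF; exists 1 => // a t i h; have [_ _ _ /andP[t0 _]] := h.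
have -> : (fun w => g a w * cW a t i w) = (fun w => g a w * incr W i 0 t w).
  by apply/funext => w; rewrite -(cW_incr a i w (lexx 0) t0) cW0 subr0.
have := HC a t i h; rewrite mulr1 => gC.
apply: (@eb_le _ _ _ _ _ 0); first by rewrite mul1r ltW// (sqX_gt0 _ h).
exact: (incr_centered filF bmW i (lexx 0) t0 (gF a (ex_intro _ t h)) gC).
Qed.

Lemma rv_in_cst s (c : R) : 0 <= s -> rv_in (F s) (fun _ : Omega => c).
Proof.
move=> s0 B mB; have [[F0 FC _] _] := filF.1 s s0.
rewrite preimage_cst; case: ifP => _; last exact: F0.
by have := FC _ F0; rewrite setD0.
Qed.

Lemma rv_in_devV a t i : dom a t -> rv_in (F 0) (devV a t i).
Proof.
move=> [e0 _ _ _] B mB.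
have mf : measurable_fun setT (fun x : R => x - drift i (x0, 0)) by exact: measurable_funB.
by have := rvV e0 i (mf measurableT _ mB); rewrite setTI.
Qed.

Lemma Ob_one : Ob (2 * 1) 0 (fun (_ : par) _ _ _ => 1).
Proof.
apply: (@Ob_det R n d Omega P T _ 0 (fun _ _ _ => 1) 1) => [||a t i _].
- by rewrite mulr_ge0.
- exact: ltr01.
- by rewrite normr1 expr0 mulr1.
Qed.

Lemma EO_D : EO 2 cD.
Proof.
apply: (EO_ext (f := fun a t i w => 1 * cD a t i w)); first by move=> *; rewrite mul1r.
apply: (EO_mul_D (g := fun _ _ => 1)); first exact: Ob_one.
by apply: EO_mul_W; [exact: Ob_one|move=> *; exact: rv_in_cst (lexx 0)].
Qed.

Lemma dom_second a t : dom a t -> dom a a.1.2.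
Proof. by case. Qed.

Lemma Ob_second k (f : fam) : Ob p k f -> Ob p k (fun a _ _ w => f a a.1.2 a.2 w).
Proof.
by move=> [C C0 H]; exists C; [exact: C0|move=> a t i /dom_second]; exact: H.
Qed.

Lemma EO_devV_W : EO 1 (fun a t i w => devV a a.1.2 a.2 w * cW a t i w).
Proof.
apply: (EO_mul_W (g := fun a w => devV a a.1.2 a.2 w)).
  exact: (Ob_two (Ob_second Ob_devV)).
by move=> a [t h]; exact: rv_in_devV h.
Qed.

(** The decorrelation step. By [brownian_incr_corr], the expectation of [W_t] times [W_r - W_s] is
    of size [r - s] rather than [sqrt (r - s)], so relaxation yields [eps] instead of [sqrt eps]. *)
Lemma EO_W_relax : EO 2 (fun a t i w =>
  cW a t i w * relax a.1.1^-1 (fun s => cW a s a.2 w) a.1.2).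
Proof.
have [C C0 HC] := brownian_incr_corr filF bmW.
have [L L0 HL] := Ob_two Ob_W.
exists (3 * (2 * C)) => [|a t i h]; first by rewrite !mulr_gt0.
have [e0 _ /andP[r0 rT] /andP[t0 tT]] := h.
have hr := dom_second h.
rewrite (sq2 h) (_ : 3 * (2 * C) * a.1.1 = 3 * (C * (2 * a.1.1))); last by ring.
apply: (@eb_relax R d Omega P a.1.1^-1 (cW a t i) (fun s => cW a s a.2) a.1.2
   (C * (2 * a.1.1)) (L * sq a ^+ 0 * (L * sq a ^+ 0 + L * sq a ^+ 0))).
- by rewrite invr_gt0.
- exact: r0.
- by rewrite ltW// !mulr_gt0.
- exact: process_cW.
- by have [_] := process_cW i; exact.
- move=> s s0 sr; apply: (bndM ltr01 (HL a t i h)).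
  have b1 := HL a a.1.2 a.2 hr; have b2 := HL a s a.2 (dom_le hr s0 sr).
  have q1 : 1 <= 2 * 1 :> R by rewrite mulr1 ler1n.
  exact: bndB q1 b1 b2.
- move=> s s0 sr; have [sr'|rs] := ltP s a.1.2; last first.
    have -> : s = a.1.2 by apply/le_anti; rewrite sr rs.
    under eq_fun do rewrite subrr mulr0.
    by apply: eb0; rewrite mulr_ge0 ?expR_ge0// ltW// !mulr_gt0.
  have := HC t s a.1.2 a.2 i t0 s0 sr'.
  rewrite (_ : (fun w => cW a t i w * _) = (fun w => W t w ord0 i * incr W a.2 s a.1.2 w)).
    by apply: eb_le; rewrite -mulrA ler_wpM2l ?(ltW C0)//; exact: linear_weight hr sr.
  by apply/funext => w; rewrite cW_incr// /cW (ger0_norm t0).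
Qed.

(** The factor [sqrt (2 / eps)] in [U] takes one half power from [EO_W_relax]; the contribution of
    the initial velocity is exactly centered. *)
Lemma EO_U_W : EO 1 (fun a t i w => U a a.1.2 a.2 w * cW a t i w).
Proof.
apply: (EO_ext (f := fun a t i w => expR (- (a.1.1^-1 * a.1.2)) *
   (devV a a.1.2 a.2 w * cW a t i w) + Num.sqrt (2 / a.1.1) *
   (cW a t i w * relax a.1.1^-1 (fun s => cW a s a.2 w) a.1.2))).
  by move=> a t i w _; rewrite /U; ring.
apply: EOD; last exact: (EO_fluct EO_W_relax).
exact: (@EOZ R n d Omega P T 1 0 _ (fun a _ _ => expR (- (a.1.1^-1 * a.1.2))) 1 ltr01
  (fun a t i h => expRN_le1 i (dom_second h)) EO_devV_W).
Qed.

Lemma EO_U_D : EO 2 (fun a t i w => U a a.1.2 a.2 w * cD a t i w).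
Proof. exact: (EO_mul_D (g := fun a w => U a a.1.2 a.2 w) (Ob_two (Ob_second Ob_U)) EO_U_W). Qed.

Lemma EO_devV_D : EO 2 (fun a t i w => devV a a.1.2 a.2 w * cD a t i w).
Proof.
exact: (EO_mul_D (g := fun a w => devV a a.1.2 a.2 w) (Ob_two (Ob_second Ob_devV)) EO_devV_W).
Qed.

(** * Expectations of the remainder terms and of [X - Z] *)

Lemma flow_lipschitz : exists2 L : R, 0 < L & forall a s t, dom a t -> 0 <= s -> s <= t ->
  dist1 ((y a.1.1 t, `|t|) - (y a.1.1 s, `|s|)) <= L * (t - s).
Proof.
have [K K0 [h2 [H _]]] := drift_slab.
pose N : R := (size (index_enum 'I_n))%:R.
exists (N * (K + Cy) + 1) => [|a s t h s0 st].
  by rewrite ltr_wpDl// mulr_ge0// addr_ge0 ?(ltW K0) ?(ltW Cy0).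
have ha := ex_intro (dom a) t h; have [_ cb yE _] := yP ha.
have [e0 e1 _ _] := h; have t0 := le_trans s0 st.
rewrite /dist1 /= (ger0_norm s0) (ger0_norm t0) (ger0_norm (_ : 0 <= t - s)) ?subr_ge0//.
rewrite mulrDl mul1r lerD2r /l1.
apply: (@le_trans _ _ (\sum_(j <- index_enum 'I_n) (K + Cy) * (t - s))); last first.
  by rewrite big_const_seq count_predT iter_addr_0 -mulrA -mulr_natl.
apply: ler_sum => j _.
rewrite !mxE (yE t j h) (yE s j (dom_le h s0 st)) (tint_split (cb j) s0 st).
rewrite (_ : _ - _ = tint s t (beta a.1.1 j)); last by ring.
apply: tint_le_cst => // r sr rt; have hr := dom_le h (le_trans s0 sr) rt.
rewrite -(subrK (alongy drift a r j) (beta a.1.1 j r)) addrC.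
apply: le_trans (ler_normD _ _) (lerD _ _).
  by have [+ _ _ _] := H j `|r| (y a.1.1 r) 0 (dom_abs hr); exact.
apply: le_trans (beta_order j hr) _; rewrite -[X in _ <= X]mulr1 ler_wpM2l ?(ltW Cy0)//.
exact: sqX_le1 hr.
Qed.

(** Along an exact solution [corr] is the derivative of [b(y_t, t)] and the difference would vanish;
    [y] satisfies the equation up to [eps]. *)
Lemma flow_order : exists2 C : R, 0 < C & forall a t i, dom a t ->
  `|tint 0 t (fun s => alongy corr a s i) - (alongy drift a t i - drift i (x0, 0))|
    <= C * sq a ^+ 2.
Proof.
have [K K0 HK] := taylor2_family (fun i => taylor2_smooth T (smooth_drift i) (periodic_drift i)).
have [gx Hgx] := choice taylor2_corr; have [gt Hgt] := choice Hgx.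
have [K' K'0 HK'] := taylor2_family Hgt.
have [L L0 HL] := flow_lipschitz.
pose N : R := (size (index_enum 'I_n))%:R; have N0 : 0 <= N by [].
(* The summands bound, in this order, the variation of [corr] over a step, the defect of the flow
   equation, the variation of the drift over a step, and the Taylor remainder of the drift. *)
pose C1 := K' * L + N * K * Cy + N * (K * K * L) + K * L ^+ 2.
have KL := mulr_gt0 K'0 L0; have NKC : 0 <= N * K * Cy.
  by rewrite !mulr_ge0 ?(ltW K0) ?(ltW Cy0).
have NKL : 0 <= N * (K * K * L) by rewrite !mulr_ge0 ?(ltW K0) ?(ltW L0).
have KL2 : 0 <= K * L ^+ 2 by rewrite mulr_ge0 ?(ltW K0) ?sqr_ge0.
have C10 : 0 < C1 by rewrite /C1 -!addrA ltr_wpDr// !addr_ge0.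
exists (C1 * T) => [|a t i h]; first exact: mulr_gt0.
have ha := ex_intro (dom a) t h; have [_ cb yE _] := yP ha.
have [e0 e1 hr /andP[t0 tT]] := h.
have hd r : 0 <= r -> r <= T -> dom a r by move=> r0 rT; split=> //; rewrite r0.
have cc : continuous (fun s => alongy corr a s i) := continuous_alongy ha (@continuous_corr i).
pose g s := tint 0 s (fun s => alongy corr a s i) - alongy drift a s i.
have g0 : g 0 = - drift i (x0, 0).
  rewrite /g tint_refl add0r /alongy normr0; congr (- drift i (_, _)).
  by apply/rowP => j; rewrite yE ?tint_refl ?addr0//; apply: dom_le h _ _.
have -> : tint 0 t (fun s => alongy corr a s i) - (alongy drift a t i - drift i (x0, 0)) = g t - g 0.
  by rewrite g0 /g; ring.
rewrite (sq2 h); suff /le_trans : `|g t - g 0| <= C1 * a.1.1 * t.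
  by apply; rewrite mulrAC -[X in _ <= X]mulrA [T * _]mulrC mulrA mulrAC ler_wpM2l// mulr_ge0 ?ltW.
apply: telescoping => // [|r u r0 ru uT]; first exact: ltW.
have hu := hd u (le_trans r0 ru) uT; have hr' := dom_le hu r0 ru.
pose zr : E := (y a.1.1 r, `|r|); pose dz : E := (y a.1.1 u, `|u|) - zr.
have zE : zr + dz = (y a.1.1 u, `|u|) by rewrite addrC subrK.
have lz := HL a r u hu r0 ru; rewrite -/zr -/dz in lz.
pose dl := u - r; have dl0 : 0 <= dl by rewrite subr_ge0.
have d2 : dz.2 = dl.
  by rewrite /dz /= (ger0_norm r0) (ger0_norm (le_trans r0 ru)).
pose A := tint r u (fun v => alongy corr a v i - corr i zr).
pose B j := tint r u (fun v => beta a.1.1 j v - drift j zr).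
have eA : tint r u (fun v => alongy corr a v i) = A + corr i zr * dl.
  by rewrite /A tintB//; [rewrite tint_cst// subrK|exact: cont_cst].
have eB j : dz.1 ord0 j = B j + drift j zr * dl.
  rewrite /B tintB//; last exact: cont_cst.
  rewrite tint_cst// subrK /dz /= !mxE (yE u j hu) (yE r j hr') (tint_split (cb j) r0 ru); ring.
pose rem := drift i (zr + dz) - drift i zr -
  (\sum_j dz.1 ord0 j * grad i j zr + dz.2 * 'D_(et R n) (drift i) zr).
(* The terms linear in the step length cancel by the definition of [corr]; [A], [B] and [rem] are of
   second order in [dl] except for the defect in [B], which contributes [eps * dl]. *)
have gE : g u - g r = A - \sum_j grad i j zr * B j - rem.
  rewrite /rem zE d2 /g (tint_split cc r0 ru) eA /corr.
  have -> : \sum_j dz.1 ord0 j * grad i j zr =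
     \sum_j grad i j zr * B j + dl * \sum_j drift j zr * grad i j zr.
    rewrite mulr_sumr -big_split; apply: eq_bigr => j _ /=; rewrite eB; ring.
  rewrite -/zr /alongy -/zr; ring.
have [_ c2 c3] := HK i.
have remB : `|rem| <= K * L ^+ 2 * dl ^+ 2.
  apply: le_trans (c3 zr dz (dom_abs hr') _) _; first by rewrite zE; exact: dom_abs hu.
  rewrite -mulrA -exprMn ler_wpM2l ?(ltW K0)// lerXn2r ?nnegrE ?dist1_ge0//.
  by rewrite mulr_ge0// ltW.
have zrE v : zr + ((y a.1.1 v, `|v|) - zr) = (y a.1.1 v, `|v|) by rewrite addrC subrK.
have lz' v : r <= v -> v <= u -> dist1 ((y a.1.1 v, `|v|) - zr) <= L * dl.
  move=> rv vu; have hv := dom_le hu (le_trans r0 rv) vu.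
  by apply: le_trans (HL a r v hv r0 rv) _; rewrite ler_wpM2l ?(ltW L0)// lerD2r.
have AB : `|A| <= K' * L * dl * dl.
  apply: tint_le_cst => // [|v rv vu]; first by apply: contB => //; exact: cont_cst.
  have hv := dom_le hu (le_trans r0 rv) vu; have [_ b2 _] := HK' i.
  have := b2 zr ((y a.1.1 v, `|v|) - zr) (dom_abs hr'); rewrite zrE.
  move=> /(_ (dom_abs hv)) /le_trans; apply; rewrite -mulrA ler_wpM2l ?(ltW K'0)//.
  exact: lz'.
have BB j : `|B j| <= (Cy * a.1.1 + K * L * dl) * dl.
  apply: tint_le_cst => // [|v rv vu]; first by apply: contB => //; exact: cont_cst.
  have hv := dom_le hu (le_trans r0 rv) vu; have [_ b2 _] := HK j.
  rewrite -(subrK (alongy drift a v j) (beta a.1.1 j v)) -addrA.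
  apply: le_trans (ler_normD _ _) (lerD _ _).
    by have := beta_order j hv; rewrite (sq2 hv).
  have := b2 zr ((y a.1.1 v, `|v|) - zr) (dom_abs hr'); rewrite zrE.
  move=> /(_ (dom_abs hv)) /le_trans; apply; rewrite -mulrA ler_wpM2l ?(ltW K0)//.
  exact: lz'.
have SB : `|\sum_j grad i j zr * B j| <= N * (K * ((Cy * a.1.1 + K * L * dl) * dl)).
  apply: le_trans (ler_norm_sum _ _ _) _.
  apply: (@le_trans _ _ (\sum_(j <- index_enum 'I_n) K * ((Cy * a.1.1 + K * L * dl) * dl))).
    apply: ler_sum => j _; rewrite normrM; apply: ler_pM => //.
    by have [c1 _ _] := HK i; have [_ + _] := c1 zr (dom_abs hr'); exact.
  by rewrite big_const_seq count_predT iter_addr_0 -mulr_natl.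
rewrite gE -/dl; apply: le_trans (ler_normB _ _) _.
apply: le_trans (lerD (ler_normB _ _) remB) _.
apply: le_trans (lerD (lerD AB SB) (lexx _)) _.
have ed : 0 <= a.1.1 * dl by rewrite mulr_ge0 ?(ltW e0).
have m1 := mulr_ge0 (ltW KL) ed; have m2 := mulr_ge0 NKC (sqr_ge0 dl).
have m3 := mulr_ge0 NKL ed; have m4 := mulr_ge0 KL2 ed.
rewrite /C1; lra.
Qed.

Lemma pfam_Zy h : (forall i, continuous (h i)) ->
  pfam (fun a t i w => alongZ h a t i w - alongy h a t i).
Proof.
move=> ch a i ha; apply: processB; first exact: (pfam_alongZ ch i ha).
by apply: process_path; exact: continuous_alongy ha (ch i).
Qed.

Lemma Ob_Zy K h h1 : 0 < K -> (forall i, continuous (h i)) -> slab1 T K h h1 ->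
  Ob p 1 (fun a t i w => alongZ h a t i w - alongy h a t i).
Proof.
move=> K0 ch H.
apply: (Ob_dom p_ge0 K0 (pfam_mfam (pfam_Zy ch)) (Ob_lD p_ge1 (lexx p))) => a t i w ht.
by apply: le_trans (Zy_le i w H ht) _; rewrite ler_wpM2l ?(ltW K0)//; exact: ler_norm.
Qed.

Lemma Ob_diff K h h1 : 0 < K -> (forall i, continuous (h i)) -> slab1 T K h h1 ->
  Ob p 2 (fun a t i w => alongX h a t i w - alongZ h a t i w).
Proof.
move=> K0 ch H.
apply: (Ob_dom p_ge0 K0 (pfam_mfam (pfam_diff ch)) (Ob_lY p_ge1 (lexx p))) => a t i w ht.
by apply: le_trans (diff_le i w H ht) _; rewrite ler_wpM2l ?(ltW K0)//; exact: ler_norm.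
Qed.

(** Every random quantity is compared with its value on the flow; what is left in the middle is the
    deterministic quantity of [flow_order]. *)
Lemma dA_split a t i w : dom a t ->
  tint 0 t (fun s => alongZ corr a s i w - alongy corr a s i) +
  (tint 0 t (fun s => alongy corr a s i) - (alongy drift a t i - drift i (x0, 0))) -
  ((alongX drift a t i w - alongZ drift a t i w) + (alongZ drift a t i w - alongy drift a t i)) =
  dA a t i w.
Proof.
move=> h; have ha := ex_intro (dom a) t h; rewrite /dA tintB.
- have r (c1 c2 c3 c4 c5 c6 : R) : c1 - c2 + (c2 - (c3 - c6)) - (c4 - c5 + (c5 - c3)) = c1 - (c4 - c6).
    by ring.
  exact: r.
- exact: ((pfam_alongZ continuous_corr i ha).1 w).
- exact: (continuous_alongy ha (@continuous_corr i)).
Qed.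

(** In [L^p] the order is that of [D], namely [sqrt eps]; the full order [eps] in [EO_dA] holds only
    for the expectation. *)
Lemma Ob_dA1 : Ob p 1 dA.
Proof.
have [K K0 [h2 [H _]]] := drift_slab; have [L L0 [gx Hc]] := corr_slab.
have [C C0 HC] := flow_order.
apply: (Ob_ext dA_split); apply: (ObB p_ge1); last first.
  apply: (ObD p_ge1 _ (Ob_Zy K0 continuous_drift H)).
  exact: (Ob_le p_ge0 (isT : (1 <= 2)%N) (Ob_diff K0 continuous_drift H)).
apply: (ObD p_ge1).
  exact: (Ob_tint p_ge1 T0 (pfam_Zy continuous_corr) (Ob_Zy L0 continuous_corr Hc)).
exact: (Ob_le p_ge0 (isT : (1 <= 2)%N) (Ob_det P p_ge0 C0 HC)).
Qed.

Lemma EO_dA : EO 2 dA.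
Proof.
have [K K0 [h2 [H _]]] := drift_slab; have [L L0 [gx Hc]] := corr_slab.
have [C C0 HC] := flow_order.
apply: (EO_ext dA_split); apply: EOB; last first.
  apply: (EOD _ (EO_alongZ K0 continuous_drift H EO_D)).
  exact: (EO_Ob p_ge1 (Ob_diff K0 continuous_drift H)).
apply: EOD; last exact: (EO_Ob p_ge1 (Ob_det P p_ge0 C0 HC)).
apply: (EO_tint T0 (pfam_Zy continuous_corr)); last exact: (EO_alongZ L0 continuous_corr Hc EO_D).
apply: (Ob_le ler01 (leq0n 1)).
exact: (Ob_exponent ltr01 p_ge1 (Ob_Zy L0 continuous_corr Hc)).
Qed.

(** Any order [k] is possible because the expectation is exactly 0. *)
Lemma EO_devV k : EO k devV.
Proof.
have [C C0 HC] := Ob_devV.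
exists 1 => // a t i h; have [e0 _ _ _] := h.
apply: (@eb_le _ _ _ _ _ 0); first by rewrite mul1r ltW// (sqX_gt0 _ h).
split; first exact: bnd_integrable p_ge1 (HC a t i h).
rewrite /Rintegral (_ : (\int[P]_x (devV a t i x)%:E = 0)%E) ?normr0//.
by rewrite -(EV e0 i); apply: eq_integral => w _; rewrite /devV /drift !mxE.
Qed.

(** Brownian increments are centered, so [eb_relax] applies with the constant weight 1 and
    [k = 0]. *)
Lemma EO_relaxW k : EO k (fun a t i w => relax a.1.1^-1 (fun s => cW a s i w) t).
Proof.
have [L L0 HL] := Ob_W; have q1 : 1 <= 2 :> R by rewrite ler1n.
exists 1 => // a t i h; have [e0 _ _ /andP[t0 tT]] := h.
apply: (@eb_le _ _ _ _ _ 0); first by rewrite mul1r ltW// (sqX_gt0 _ h).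
suff : eb (fun w => 1 * relax a.1.1^-1 (fun s => cW a s i w) t) (3 * 0).
  by rewrite mulr0; congr eb; apply/funext => w; rewrite mul1r.
apply: (@eb_relax R d Omega P a.1.1^-1 (fun=> 1) (fun s => cW a s i) t 0
   (L * sq a ^+ 0 + L * sq a ^+ 0)).
- by rewrite invr_gt0.
- exact: t0.
- exact: lexx.
- exact: process_cW.
- exact: measurable_cst.
- move=> s s0 st; apply: (bnd_exponent ltr01 p_ge1).
  have := bndB p_ge1 (HL a t i h) (HL a s i (dom_le h s0 st)).
  by congr bnd; apply/funext => w; rewrite mul1r.
- move=> s s0 st; rewrite mul0r.
  have b1 : bnd 2 (fun _ : Omega => 1) 1.
    by apply: bnd_bounded => // w; rewrite normr1.
  have := incr_centered filF bmW i s0 st (rv_in_cst 1 s0) b1.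
  by congr eb; apply/funext => w; rewrite cW_incr.
Qed.

Lemma EO_U k : EO k U.
Proof.
apply: EOD; last exact: (EO_fluct (EO_relaxW k.+1)).
exact: (@EOZ R n d Omega P T k 0 _ (fun a t _ => expR (- (a.1.1^-1 * t))) 1 ltr01
  expRN_le1 (EO_devV k)).
Qed.

(** Two half powers come from the explicit factor [eps], and two from each term of the bracket: in
    expectation for [dA], [U] and [devV], in [L^p] for [lag]. *)
Lemma EO_remY : EO 4 remY.
Proof.
apply: (EO_eps (k := 2)).
apply: (EOD _ (EO_devV 2)); apply: (EOD _ (EO_Ob p_ge1 Ob_lag)).
exact: (EOB EO_dA (EO_U 2)).
Qed.

(** Order 3 is that of [lD * lY]; another factor [D] brings it to 4, which is what [EO_DY] asks
    for. *)
Lemma Ob_XZ_expansion K h h1 h2 : 0 < K -> (forall i, continuous (h i)) -> slab2 T K h h1 h2 ->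
  Ob 2 3 (fun a t i w => alongX h a t i w - alongZ h a t i w -
    \sum_j alongy (h1^~ j) a t i * cY a t j w).
Proof.
move=> K0 ch H; have p20 : (0 : R) <= 2 by []; have p21 : (1 : R) <= 2 by rewrite ler1n.
have q1 : (1 : R) <= 2 * 2 by rewrite -natrM ler1n.
have lD2 := Ob_lD q1 four_le_p; have lY2 := Ob_lY q1 four_le_p.
have l34 := Ob_le p20 (isT : (3 <= 4)%N) (ObM (ltr0n R 2) lY2 lY2).
apply: (Ob_dom p20 K0 _ (ObD p21 l34 (ObM (ltr0n R 2) lD2 lY2))).
- move=> a t i ht; have ha := ex_intro (dom a) t ht.
  apply: measurable_funB; first exact: (pfam_diff ch i ha).2.
  have ps : process (fun (_ : R) w => \sum_j alongy (h1^~ j) a t i * cY a t j w).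
    apply: process_sum => j; apply: process_const_time; apply: measurable_funM.
      exact: measurable_cst.
    exact: (pfam_Y j ha).2.
  exact: (ps.2 0).
- move=> a t i w ht; apply: le_trans (XZ_expansion i w H ht).1 _.
  rewrite -mulrDr -expr2 ler_wpM2l ?(ltW K0)//; exact: ler_norm.
Qed.

(** Gronwall's lemma in [t] with the fixed weight [D_r]; size alone gives order 3. In the source
    [eps * D_r * (...)] the products with [dA] and [lag] are small by size, while those with [U] and
    [devV] need [EO_U_D] and [EO_devV_D]. *)
Lemma EO_DY : EO 4 (fun a t i w => cD a a.1.2 a.2 w * cY a t i w).
Proof.
have [K K0 [h2 H]] := drift_slab.
have bD := Ob_two (Ob_second Ob_D).
have bdiff := Ob_two (Ob_diff K0 continuous_drift H.1).
apply: (@EO_gronwall R n d Omega P T 4 _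
  (fun a t i w => cD a a.1.2 a.2 w * (alongX drift a t i w - alongZ drift a t i w))
  (fun a t i w => cD a a.1.2 a.2 w * remY a t i w)
  (fun a t i j => alongy (grad^~ j) a t i) K T0 K0).
- move=> a i ha; apply: processM; last exact: (pfam_diff continuous_drift).
  by apply: process_const_time; exact: (pfam_D a.2 ha).2.
- exact: (Ob_le ler01 (leq0n 3) (ObM ltr01 bD bdiff)).
- exact: (EO_le (leq0n 3) (EO_mul bD (Ob_two Ob_Y))).
- apply: (EO_ext (f := fun a t i w => a.1.1 * (cD a a.1.2 a.2 w * dA a t i w -
    U a t i w * cD a a.1.2 a.2 w + cD a a.1.2 a.2 w * lag a t i w +
    devV a t i w * cD a a.1.2 a.2 w))).
    by move=> a t i w _; rewrite /remY; ring.
  apply: (EO_eps (k := 2)).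
  (* The correlation lemmas take [D] at the running time and the other factor at the second time;
     here the roles are opposite. The condition on [f] says that it depends on the parameter through
     the scale only. *)
  have swap (f : fam) : (forall a b t i, a.1.1 = b.1.1 -> f a t i = f b t i) ->
     EO 2 (fun a t i w => f a a.1.2 a.2 w * cD a t i w) ->
     EO 2 (fun a t i w => f a t i w * cD a a.1.2 a.2 w).
    move=> fE fD; have := @EO_reindex R n d Omega P T 2 _ (fun a t i => (a.1.1, t, i))
      (fun a _ _ => a.1.2) (fun a _ _ => a.2) _ fD.
    have hdom a t i : dom a t -> dom (a.1.1, t, i) a.1.2 /\ (a.1.1, t, i).1.1 = a.1.1.
      by case.
    move=> /(_ hdom); apply: EO_ext => a t i w _ /=.
    by rewrite (fE (a.1.1, t, i) a).
  apply: EOD; last by apply: swap EO_devV_D => a b' t i e; rewrite /devV e.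
  apply: EOD; last exact: (EO_le (isT : (2 <= 3)%N) (EO_mul bD (Ob_two Ob_lag))).
  apply: EOB; first exact: (EO_mul bD (Ob_two Ob_dA1)).
  by apply: swap EO_U_D => a b' t i e; rewrite /U /devV e.
- by move=> a t i j; exact: alongy_grad_le H.1.
- apply: (EO_ext (f := fun a t i w => cD a a.1.2 a.2 w * (alongX drift a t i w -
    alongZ drift a t i w - \sum_j alongy (grad^~ j) a t i * cY a t j w))).
    move=> a t i w _; rewrite mulrBr; congr (_ - _).
    by rewrite mulr_sumr; apply: eq_bigr => j _; rewrite mulrCA.
  have e2 := Ob_XZ_expansion K0 continuous_drift H; rewrite -[2]mulr1 in e2.
  exact: (EO_mul bD e2).
- move=> a t i w h; have ha := ex_intro (dom a) t h.
  rewrite tintZ; last exact: ((pfam_diff continuous_drift i ha).1 w).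
  by rewrite YE//; ring.
Qed.

(** Both [lY ^+ 2] and [lD ^+ 2 * lY] have order 4 in [L^1], the latter through fourth moments of
    [D]. The products of [D] and [Y] at equal times are [EO_DY] with the second time set to [t]. *)
Lemma EO_XZ_expansion K h h1 h2 : 0 < K -> (forall i, continuous (h i)) -> slab2 T K h h1 h2 ->
  EO 4 (fun a t i w => alongX h a t i w - alongZ h a t i w -
    \sum_j alongy (h1^~ j) a t i * cY a t j w).
Proof.
move=> K0 ch H; have p20 : (0 : R) <= 2 by []; have p21 : (1 : R) <= 2 by rewrite ler1n.
have q1 : (1 : R) <= 2 * 2 by rewrite -natrM ler1n.
have lD2 := Ob_lD q1 four_le_p; have lY2 := Ob_lY q1 four_le_p.
pose DY : fam := fun a t i w =>
  \sum_j \sum_k alongy (fun i => h2 i j k) a t i * (cD a t k w * cY a t j w).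
apply: (EO_ext (f := fun a t i w => (alongX h a t i w - alongZ h a t i w -
    \sum_j alongy (h1^~ j) a t i * cY a t j w - DY a t i w) + DY a t i w)).
  by move=> a t i w _; rewrite subrK.
apply: EOD; last first.
  apply: EO_sum => j.
  apply: (EO_grad K0 (H.2 j) (f := fun a t i w => cD a t i w * cY a t j w)).
  have hdom a t (k : 'I_n) : dom a t -> dom (a.1.1, t, k) t /\ (a.1.1, t, k).1.1 = a.1.1 by case.
  exact: (@EO_reindex R n d Omega P T 4 _ (fun a t i => (a.1.1, t, i)) (fun _ t _ => t)
    (fun _ _ _ => j) hdom EO_DY).
apply: (EO_Ob (lexx 1)).
have lY1 : Ob (2 * 1) 2 lY by apply: Ob_lY; rewrite mulr1 ?ler1n ?two_le_p.
have lDD : Ob (2 * 1) 2 (fun a t i w => lD a t i w * lD a t i w).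
  by rewrite mulr1; exact: (ObM (ltr0n R 2) lD2 lD2).
apply: (Ob_dom ler01 K0 _ (ObD (lexx 1) (ObM ltr01 lY1 lY1) (ObM ltr01 lDD lY1))).
- move=> a t i ht; have ha := ex_intro (dom a) t ht.
  apply: measurable_funB; first exact: Ob_mfam (Ob_XZ_expansion K0 ch H) a t i ht.
  have ps : process (fun (_ : R) w => DY a t i w).
    apply: process_sum => j; apply: process_sum => k.
    apply: process_const_time; apply: measurable_funM; first exact: measurable_cst.
    by apply: measurable_funM; [exact: (pfam_D k ha).2|exact: (pfam_Y j ha).2].
  exact: (ps.2 0).
- move=> a t i w ht; apply: le_trans (XZ_expansion i w H ht).2 _.
  rewrite -mulrDr -!expr2 ler_wpM2l ?(ltW K0)//; exact: ler_norm.
Qed.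

Lemma EO_Y : EO 4 cY.
Proof.
have [K K0 [h2 H]] := drift_slab.
apply: (@EO_gronwall R n d Omega P T 4 _
  (fun a t i w => alongX drift a t i w - alongZ drift a t i w) remY
  (fun a t i j => alongy (grad^~ j) a t i) K T0 K0).
- exact: pfam_diff continuous_drift.
- apply: (Ob_le ler01 (leq0n 2)).
  exact: (Ob_exponent ltr01 p_ge1 (Ob_diff K0 continuous_drift H.1)).
- exact: (EO_le (leq0n 2) (EO_Ob p_ge1 Ob_Y)).
- exact: EO_remY.
- by move=> a t i j; exact: alongy_grad_le H.1.
- exact: EO_XZ_expansion K0 continuous_drift H.
- by move=> a t i w h; exact: YE.
Qed.

Lemma EO_alongX_alongZ K h h1 h2 : 0 < K -> (forall i, continuous (h i)) -> slab2 T K h h1 h2 ->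
  EO 4 (fun a t i w => alongX h a t i w - alongZ h a t i w).
Proof.
move=> K0 ch H.
apply: (EO_ext (f := fun a t i w => (alongX h a t i w - alongZ h a t i w -
    \sum_j alongy (h1^~ j) a t i * cY a t j w) + \sum_j alongy (h1^~ j) a t i * cY a t j w)).
  by move=> a t i w _; rewrite subrK.
apply: EOD; first exact: EO_XZ_expansion K0 ch H.
exact: EO_grad K0 H.1 EO_Y.
Qed.

End Flow.

(** * The two error estimates in their final form *)

Lemma sq4 a t : dom a t -> sq a ^+ 4 = a.1.1 ^+ 2.
Proof. by move=> h; rewrite -(sq2 h) -exprM. Qed.

Lemma strong_error (i : 'I_n) : exists2 C : R, 0 < C & forall eps t, 0 < eps -> eps < 1 ->
  0 <= t -> t <= T ->
  (\int[P]_w (powR (enorm (X eps t w - Z eps t w)) p)%:E <= (C * (1 + T) * powR eps p)%:E)%E.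
Proof.
have [C C0 HC] := Ob_lY p_ge1 (lexx p).
exists (powR C p) => [|eps t e0 e1 t0 tT]; first by rewrite powR_gt0.
(* The estimated quantity involves neither a second time nor a second index, so any admissible
   values may fill these slots. *)
pose a : par := (eps, 0, i).
have h : dom a t by split; rewrite //= ?lexx ?(ltW T0) ?t0.
have [k0 ml hk] := HC a t i h; rewrite (sq2 h) /= in k0 hk.
have md j : measurable_fun setT (fun w => (X eps t w - Z eps t w) ord0 j).
  have [_ m] := pfam_Y j (ex_intro _ t h); have := m t.
  rewrite /cY /cX /cZ (ger0_norm t0) /=.
  by congr measurable_fun; apply/funext => w; rewrite !mxE.
apply: (@le_trans _ _ (\int[P]_w ((powR (C * eps) p)%:E * (powR (`|lY a t i w| / (C * eps)) p)%:E))%E).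
  apply: ge0_le_integral => //.
  - by move=> w _; rewrite lee_fin powR_ge0.
  - apply/measurable_EFinP; apply: (@measurableT_comp _ _ _ _ _ _ (fun x : R => powR x p)).
      exact: measurable_powR.
    exact: measurable_enorm.
  - by apply: measurable_funeM; exact: measurable_powR_norm.
  - move=> w _; rewrite -EFinM lee_fin -powRM ?(ltW k0)//; last first.
      by rewrite divr_ge0// ltW.
    apply: ge0_ler_powR; rewrite ?nnegrE ?p_ge0 ?sqrtr_ge0//.
      by rewrite mulr_ge0 ?(ltW k0)// divr_ge0// ltW.
    rewrite mulrC divfK ?gt_eqF//; apply: le_trans (enorm_le_l1 _) _.
    apply: le_trans (ler_norm _); apply: eq_ler.
    by apply: eq_bigr => j _; rewrite /cY /cX /cZ (ger0_norm t0) !mxE.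
rewrite ge0_integralZl//.
- apply: (@le_trans _ _ ((powR (C * eps) p)%:E * 1)%E).
    by apply: lee_wpmul2l; rewrite ?lee_fin ?powR_ge0.
  rewrite mule1 lee_fin powRM ?(ltW C0) ?(ltW e0)// ler_wpM2r ?powR_ge0//.
  by rewrite -[X in X <= _]mulr1 ler_wpM2l ?powR_ge0// lerDl ltW.
- exact: measurable_powR_norm.
- by move=> w _; rewrite lee_fin powR_ge0.
- by rewrite lee_fin powR_ge0.
Qed.

Lemma weak_error (i : 'I_n) (phi : 'rV[R]_n -> R) : smooth phi -> periodic_fn phi ->
  exists C : R, forall eps t, 0 < eps -> eps < 1 -> 0 <= t -> t <= T ->
  (`| \int[P]_w (phi (X eps t w))%:E - \int[P]_w (phi (Z eps t w))%:E | <= (C * eps ^+ 2)%:E)%E.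
Proof.
move=> sphi pphi; have [y [beta [Cy [Cy0 yP]]]] := approximate_flow.
(* The test function enters as a family constant in time and index, to which the expansion made for
   the drift applies. *)
pose h (_ : 'I_n) (z : E) := phi z.1.
have sh j : smooth (h j) by exact: smooth_fst.
have ph j : periodic1 (h j) by move=> x t k; exact: pphi.
have ch j : continuous (h j) by exact: smooth_continuous.
have [K K0 [h2 H]] := slab2_smooth T sh ph.
have [C C0 HC] := EO_alongX_alongZ Cy0 yP K0 ch H.
exists C => eps t e0 e1 t0 tT; pose a : par := (eps, 0, i).
have hd : dom a t by split; rewrite //= ?lexx ?(ltW T0) ?t0.
have [XO_C _ HX] := Ob_alongX K0 ch H.1; have [ZO_C _ HZ] := Ob_alongZ K0 ch H.1.
have iX := bnd_integrable p_ge1 (HX a t i hd).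
have iZ := bnd_integrable p_ge1 (HZ a t i hd).
have [iD] := HC a t i hd; rewrite (sq4 hd) /= => bD.
have -> : (\int[P]_w (phi (X eps t w))%:E = \int[P]_w (alongX h a t i w)%:E)%E.
  by apply: eq_integral => w _; rewrite /alongX /h /= (ger0_norm t0).
have -> : (\int[P]_w (phi (Z eps t w))%:E = \int[P]_w (alongZ h a t i w)%:E)%E.
  by apply: eq_integral => w _; rewrite /alongZ /h /= (ger0_norm t0).
rewrite -integralB_EFin// -(fineK (integrable_fin_num measurableT iD)) abse_EFin lee_fin.
exact: bD.
Qed.
End LangevinLimit.
Unset Implicit Arguments.
Theorem theorem1p1 (R : realType) (n : nat) (d : measure_display)
  (Omega : measurableType d) (P : probability Omega R)
  (F : R -> set (set Omega)) (W : R -> Omega -> 'rV[R]_n)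
  (b : ('rV[R]_n * R)%type -> 'rV[R]_n) (p : R) (x0 : 'rV[R]_n)
  (X V Z : R -> R -> Omega -> 'rV[R]_n) :
  (1 <= n)%N -> 4 <= p ->
  smooth b -> periodic_x b ->
  filtration F -> brownian P F W ->
  (forall eps, 0 < eps -> langevin_sol b eps x0 W (X eps) (V eps)) ->
  (forall eps, 0 < eps -> sde_sol (Fcorr b eps) eps x0 W (Z eps)) ->
  (forall eps, 0 < eps -> rv_meas (F 0) (V eps 0)) ->
  (forall eps, 0 < eps -> forall i : 'I_n,
     (\int[P]_w ((V eps 0 w - b (x0, 0)) ord0 i)%:E = 0)%E) ->
  (exists M : R, forall eps, 0 < eps ->
     (\int[P]_w (powR (enorm (V eps 0 w - b (x0, 0))) p)%:E <= M%:E)%E) ->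
  forall T : R, 0 < T ->
  exists eps0 : R, 0 < eps0 /\
    (exists C : R, 0 < C /\
       forall eps, 0 < eps -> eps < eps0 -> forall t, 0 <= t -> t <= T ->
         (\int[P]_w (powR (enorm (X eps t w - Z eps t w)) p)%:E
            <= (C * (1 + T) * powR eps p)%:E)%E) /\
    (forall phi : 'rV[R]_n -> R, smooth phi -> periodic_fn phi ->
       exists C : R, forall eps, 0 < eps -> eps < eps0 -> forall t, 0 <= t -> t <= T ->
         (`| \int[P]_w (phi (X eps t w))%:E - \int[P]_w (phi (Z eps t w))%:E |
            <= (C * eps ^+ 2)%:E)%E).
Proof.
move=> n1 p4 sb pb filF bmW solX solZ rvV EV MV T T0.
(* Parameters carry a coordinate index, which [1 <= n] provides. *)
have i : 'I_n := Ordinal n1.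
exists 1; split; first exact: ltr01.
split=> [|phi sphi pphi].
  have [C C0 HC] := strong_error p4 sb pb filF bmW solX solZ rvV MV T0 i.
  by exists C; split=> // eps e0 e1 t t0 tT; exact: HC.
have [C HC] := weak_error p4 sb pb filF bmW solX solZ rvV EV MV T0 i sphi pphi.
by exists C => eps e0 e1 t t0 tT; exact: HC.
Qed.
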